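(* Let $T>0$ and $\mu\ge1$. Assume that the solution $(\zeta,\mathbf v)=(\zeta,v_1,v_2)$ of the $1$-periodic initial-value problem $$(1-b\Delta)\zeta_t+r_1\nabla\cdot\mathbf v+\lambda\nabla\cdot(\zeta\mathbf v)+a\nabla\cdot\Delta\mathbf v=0,$$ $$(1-d\Delta)\mathbf v_t+r_2\nabla\zeta+\tfrac{\lambda}{2}\nabla|\mathbf v|^2+c'\Delta\nabla\zeta=0,$$ $$\zeta(\cdot,0)=\zeta_0,\qquad \mathbf v(\cdot,0)=\mathbf v_0,$$ satisfies $\zeta,v_1,v_2\in C^1(0,T,H^\mu)$. Let $a,b,c,d$ be in one of the following cases: (C1) $b,d>0$, $a=c=0$; (C2) $b,d>0$, $a,c<0$; (C3) $b,d>0$, $a=0$, $c<0$; (C4) $b,d>0$, $a<0$, $c=0$. For an integer $N\ge 1$ let $(\zeta^N,\mathbf v^N)$, $\mathbf v^N=(v_1^N,v_2^N)$, be the solution, with values in $S_N\times S_N\times S_N$, of the Fourier–Galerkin semidiscrete problem $$(\zeta^N_t,\varphi)+r_1(\nabla\cdot\mathbf v^N,\varphi)+\lambda(\nabla\cdot(\zeta^N\mathbf v^N),\varphi)+a(\Delta\nabla\cdot\mathbf v^N,\varphi)-b(\Delta\zeta^N_t,\varphi)=0,\quad \varphi\in S_N,$$ $$\langle\mathbf v^N_t,\chi\rangle+r_2\langle\nabla\zeta^N,\chi\rangle+\tfrac{\lambda}{2}\langle\nabla|\mathbf v^N|^2,\chi\rangle+c'\langle\Delta\nabla\zeta^N,\chi\rangle-d\langle\Delta\mathbf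 v^N_t,\chi\rangle=0,\quad \chi\in S_N\times S_N,$$ $$\zeta^N(0)=P_N\zeta_0,\qquad \mathbf v^N(0)=P_N\mathbf v_0 .$$ Then $$\max_{0\le t\le T}\left(\|\zeta^N-\zeta\|+\|\mathbf v^N-\mathbf v\|\right)\lesssim N^{-\mu},$$ $$\max_{0\le t\le T}\left(\|\zeta^N-\zeta\|_1+\|\mathbf v^N-\mathbf v\|_1\right)\lesssim N^{1-\mu}.$$
   Context: $f\lesssim g$ means that $f\le Cg$ for some constant $C$ independent of the discretization parameter $N$; $C$ will generally depend on the final time $T$ and on the norm of the exact solution and its spatial derivatives. $\Omega=(0,1)^2$; $\zeta,\mathbf v,\zeta_0,\mathbf v_0$ are real-valued and $1$-periodic in each spatial variable. $H^\sigma=H^\sigma(\Omega)$ is the $L^2$-based Sobolev space of periodic functions of order $\sigma$, with norm $\|\cdot\|_\sigma$; $\|\cdot\|$ is the $L^2(\Omega)$ norm; for vector-valued functions the corresponding product norms are used. $C^1(0,T,H^\mu)$ is the space of continuously differentiable functions $u:[0,T]\to H^\mu$. $S_N=\mathrm{span}\{e^{2\pi i(k_xx+k_yy)}: k_x,k_y\in\mathbb Z,\ -N\le k_x,k_y\le N\}$, and $P_N$ is the $L^2(\Omega)$-orthogonal projection onto $S_N$, applied componentwise to vectors. $(\cdot,\cdot)$ is the $L^2(\Omega)$ inner product and $\langle\cdot,\cdot\rangle$ the $L^2$ inner product of vector-valued functions; $|\mathbf v|^2=v_1^2+v_2^2$. Here $a,b,c,d$ are real constants, and, for parameters $0\le\gamma<1$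 and $\delta>0$, $$\lambda=\frac{\delta^2-\gamma}{(\delta+\gamma)^2},\quad r_1=\frac{1}{\gamma+\delta},\quad r_2=1-\gamma,\quad c'=(1-\gamma)c.$$ *)

(* Defs.v *)
From mathcomp Require Import all_boot all_order all_algebra.
From mathcomp Require Import all_classical all_reals all_analysis.
From mathcomp Require Import complex.

Set Implicit Arguments.
Unset Strict Implicit.
Unset Printing Implicit Defensive.

Import Order.TTheory GRing.Theory Num.Theory.
Import numFieldNormedType.Exports.

Local Open Scope classical_set_scope.
Local Open Scope ring_scope.

Section PeriodicFunctions.
Variable R : realType.
Implicit Types (u f : R * R -> R) (g h : R * R -> R[i]).

Definition Omega : set (R * R) := `]0, 1[ `*` `]0, 1[.

Definition lebesgue2 :
    {measure set (measurableTypeR R * measurableTypeR R) -> \bar R} :=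
  (@lebesgue_measure R \x @lebesgue_measure R)%E.

Definition integralO f : R := (\int[lebesgue2]_(p in Omega) f p)%R.

Definition periodic (V : Type) (f : R * R -> V) : Prop :=
  forall x y, f (x + 1, y) = f (x, y) /\ f (x, y + 1) = f (x, y).

Definition of_real u : R * R -> R[i] := fun p => real_complex R (u p).

(* ∫_Ω g conj(h), the integral of a complex function being taken on real and
   imaginary parts *)
Definition inner g h : R[i] :=
  Complex (integralO (fun p => complex.Re (g p * conjc (h p))))
          (integralO (fun p => complex.Im (g p * conjc (h p)))).

Definition expmode (k : int * int) : R * R -> R[i] := fun p =>
  let theta := 2 * pi * (k.1%:~R * p.1 + k.2%:~R * p.2) in
  Complex (cos theta) (sin theta).

Definition fourier u (k : int * int) : R[i] := inner (of_real u) (expmode k).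

Definition l2norm u : \bar R := 'N[lebesgue2]_2%:E[EFin \o (u \_ Omega)].

(* Extended-valued; meaningful for u in L^2(Omega), where the Fourier
   coefficients are genuine integrals. *)
Definition hnorm (s : R) u : \bar R :=
  sqrte (\esum_(k in [set: int * int])
    ((1 + (k.1%:~R ^+ 2 + k.2%:~R ^+ 2)) `^ s * ComplexField.Normc.normc (fourier u k) ^+ 2)%:E).

(* Only for orders s >= 0, since the elements are functions; they are
   representatives, equality in H^s being equality almost everywhere. *)
Definition Hs (s : R) : set (R * R -> R) := [set u |
  [/\ measurable_fun [set: measurableTypeR R * measurableTypeR R] u,
      periodic u, (l2norm u < +oo)%E & (hnorm s u < +oo)%E]].

Definition vnorm (nrm : (R * R -> R) -> \bar R) (v1 v2 : R * R -> R) : \bar R :=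
  sqrte (nrm v1 ^+ 2 + nrm v2 ^+ 2)%E.

Definition SN (N : nat) : set (R * R -> R[i]) := [set g |
  exists c : 'I_(2 * N).+1 -> 'I_(2 * N).+1 -> R[i],
    forall p, g p = \sum_(i < (2 * N).+1) \sum_(j < (2 * N).+1)
      c i j * expmode (i%:Z - N%:Z, j%:Z - N%:Z) p].

Definition SN_real (N : nat) : set (R * R -> R) := [set u | SN N (of_real u)].

(* p = P_N u *)
Definition is_PN (N : nat) u p : Prop :=
  SN_real N p /\
  forall phi, SN N phi -> inner (of_real p) phi = inner (of_real u) phi.

(* u is in C^1([0,T], X) with derivative ut, where X is normed by nrm;
   one-sided at the end points. *)
Definition C1_time (T : R) (X : set (R * R -> R))
    (nrm : (R * R -> R) -> \bar R) (u ut : R -> R * R -> R) : Prop :=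
  forall t, 0 <= t <= T ->
  [/\ X (u t), X (ut t),
      nrm (fun p => (u s p - u t p) / (s - t) - ut t p)
        @[s --> within `[0, T] t^'] --> 0%E
    & nrm (fun p => ut s p - ut t p) @[s --> within `[0, T] (nbhs t)] --> 0%E].

End PeriodicFunctions.

Section DifferentialOperators.
Variable R : realType.
Implicit Types u v : R * R -> R.

Definition pd1 u : R * R -> R := fun p => derive1 (fun s : R => u (s, p.2)) p.1.
Definition pd2 u : R * R -> R := fun p => derive1 (fun s : R => u (p.1, s)) p.2.
Definition lap u : R * R -> R := fun p => pd1 (pd1 u) p + pd2 (pd2 u) p.
Definition divergence u v : R * R -> R := fun p => pd1 u p + pd2 v p.

Definition partials (s : seq bool) u : R * R -> R :=
  foldr (fun b f => if b then pd2 f else pd1 f) u s.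

Definition smooth u : Prop := forall s : seq bool,
  continuous (partials s u) /\
  forall x y, derivable (fun r : R => partials s u (r, y)) x 1 /\
              derivable (fun r : R => partials s u (x, r)) y 1.

Definition test_function u : Prop := periodic u /\ smooth u.

(* Periodic distributions, as functionals on the periodic smooth functions. *)
Definition distr := (R * R -> R) -> R.
Definition regular u : distr := fun phi => integralO (fun p => u p * phi p).
Definition dd1 (D : distr) : distr := fun phi => - D (pd1 phi).
Definition dd2 (D : distr) : distr := fun phi => - D (pd2 phi).
Definition dlap (D : distr) : distr := fun phi => dd1 (dd1 D) phi + dd2 (dd2 D) phi.
Definition ddiv (D1 D2 : distr) : distr := fun phi => dd1 D1 phi + dd2 D2 phi.

End DifferentialOperators.

Section BoussinesqSystem.
Variable R : realType.

Definition lambda (gamma delta : R) : R :=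
  (delta ^+ 2 - gamma) / (delta + gamma) ^+ 2.
Definition coef_r1 (gamma delta : R) : R := (gamma + delta)^-1.
Definition coef_r2 (gamma : R) : R := 1 - gamma.
Definition coef_c (gamma c : R) : R := (1 - gamma) * c.

(* The exact system at a fixed time, in the sense of periodic distributions:
   for low Sobolev regularity its third-order terms are not functions. *)
Definition boussinesq (a b c d gamma delta : R)
    (z v1 v2 zt v1t v2t : R * R -> R) : Prop :=
  let lam := lambda gamma delta in
  let Z := regular z in let V1 := regular v1 in let V2 := regular v2 in
  let Zt := regular zt in let V1t := regular v1t in let V2t := regular v2t in
  let ZV1 := regular (fun p => z p * v1 p) in
  let ZV2 := regular (fun p => z p * v2 p) in
  let VV := regular (fun p => v1 p ^+ 2 + v2 p ^+ 2) in
  forall phi, test_function phi ->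
  [/\ Zt phi - b * dlap Zt phi + coef_r1 gamma delta * ddiv V1 V2 phi
        + lam * ddiv ZV1 ZV2 phi + a * ddiv (dlap V1) (dlap V2) phi = 0,
      V1t phi - d * dlap V1t phi + coef_r2 gamma * dd1 Z phi
        + lam / 2 * dd1 VV phi + coef_c gamma c * dlap (dd1 Z) phi = 0
    & V2t phi - d * dlap V2t phi + coef_r2 gamma * dd2 Z phi
        + lam / 2 * dd2 VV phi + coef_c gamma c * dlap (dd2 Z) phi = 0].

Definition ip (f : R * R -> R) (phi : R * R -> R[i]) : R[i] :=
  inner (of_real f) phi.
Definition vip (f1 f2 : R * R -> R) (chi1 chi2 : R * R -> R[i]) : R[i] :=
  ip f1 chi1 + ip f2 chi2.

Definition galerkin (N : nat) (a b c d gamma delta : R)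
    (z v1 v2 zt v1t v2t : R * R -> R) : Prop :=
  let C := real_complex R in
  let lam := lambda gamma delta in
  let zv1 := fun p => z p * v1 p in
  let zv2 := fun p => z p * v2 p in
  let vv := fun p => v1 p ^+ 2 + v2 p ^+ 2 in
  (forall phi, SN N phi ->
    ip zt phi + C (coef_r1 gamma delta) * ip (divergence v1 v2) phi
      + C lam * ip (divergence zv1 zv2) phi + C a * ip (lap (divergence v1 v2)) phi
      - C b * ip (lap zt) phi = 0) /\
  (forall chi1 chi2, SN N chi1 -> SN N chi2 ->
    vip v1t v2t chi1 chi2 + C (coef_r2 gamma) * vip (pd1 z) (pd2 z) chi1 chi2
      + C (lam / 2) * vip (pd1 vv) (pd2 vv) chi1 chi2
      + C (coef_c gamma c) * vip (lap (pd1 z)) (lap (pd2 z)) chi1 chi2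
      - C d * vip (lap v1t) (lap v2t) chi1 chi2 = 0).

Definition exact_solution (T mu a b c d gamma delta : R)
    (z0 v10 v20 : R * R -> R) (z v1 v2 zt v1t v2t : R -> R * R -> R) : Prop :=
  [/\ C1_time T (Hs mu) (hnorm mu) z zt,
      C1_time T (Hs mu) (hnorm mu) v1 v1t,
      C1_time T (Hs mu) (hnorm mu) v2 v2t,
      forall t, 0 <= t <= T ->
        boussinesq a b c d gamma delta
          (z t) (v1 t) (v2 t) (zt t) (v1t t) (v2t t)
    & {ae lebesgue2 R, forall p,
        [/\ z 0 p = z0 p, v1 0 p = v10 p & v2 0 p = v20 p]}].

Definition galerkin_solution (N : nat) (T a b c d gamma delta : R)
    (z0 v10 v20 : R * R -> R) (z v1 v2 zt v1t v2t : R -> R * R -> R) : Prop :=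
  [/\ C1_time T (SN_real N) (@l2norm R) z zt,
      C1_time T (SN_real N) (@l2norm R) v1 v1t,
      C1_time T (SN_real N) (@l2norm R) v2 v2t,
      forall t, 0 <= t <= T ->
        galerkin N a b c d gamma delta
          (z t) (v1 t) (v2 t) (zt t) (v1t t) (v2t t)
    & [/\ is_PN N z0 (z 0), is_PN N v10 (v1 0) & is_PN N v20 (v2 0)]].

Definition admissible_case (a b c d : R) : Prop :=
  [\/ [/\ 0 < b, 0 < d, a = 0 & c = 0],
      [/\ 0 < b, 0 < d, a < 0 & c < 0],
      [/\ 0 < b, 0 < d, a = 0 & c < 0]
    | [/\ 0 < b, 0 < d, a < 0 & c = 0]].

End BoussinesqSystem.

(* Main.v *)
Require Import Defs.
From mathcomp Require Import all_boot all_order all_algebra.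
From mathcomp Require Import all_classical all_reals all_analysis.
From mathcomp Require Import measurable_realfun complex ring lra zify.

(** Everything is done on Fourier coefficients. Let [theta], [xi] be the
    differences between the Galerkin solution and the projection [P_N] of the
    exact one. In the energy [sum_k w1 |theta_k|^2 + w2 |xi_k|^2], with [w1]
    proportional to [(r2 - c' K)(1 + b K)] and [w2] to [(r1 - a K)(1 + d K)],
    [K = |2 pi k|^2], the linear terms cancel. The products are bounded by a
    trilinear Sobolev inequality and, when the weights control [theta] in [H^1]
    but [xi] only in [L^2], by absolute summability of the coefficients of
    [zeta], read off from the equation for [v_t]. Terms quadratic in the error
    are absorbed as long as [N * energy <= 1], which a continuity argument
    ensures for large [N]. The residual of the truncation of a product is
    estimated by the [H^1] norm of one factor times the [L^2] tail of the other,
    with no logarithmic loss, and so is of order [N^(-mu)]. For the finitely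
    many remaining [N] the same stability estimate, now between two Galerkin
    solutions, bounds the error uniformly. *)

Set Implicit Arguments.
Unset Strict Implicit.
Unset Printing Implicit Defensive.

Import Order.TTheory GRing.Theory Num.Theory.
Import numFieldNormedType.Exports.
Local Open Scope classical_set_scope.
Local Open Scope ring_scope.

(** * Finite sums over lattice boxes and elementary series *)

Section FiniteSums.
Variable R : realType.

(** The obstacle is that [mu] may equal 1: in two dimensions H^1 just fails to embed into the
    bounded functions, so products with the exact solution cannot be estimated pointwise. If both
    errors are measured in L^2, the multipliers met by the nonlinearity have order -1, and the
    derivative thus gained is what the trilinear inequality consumes. If [zeta] is in H^1 and [v] in
    L^2, the multiplier on the error of [zeta] has order +1, nothing is gained, and the product of
    the exact [zeta] with the velocity error needs coefficients in l^1. In that case [c < 0], and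
    the velocity equation gives [zeta] one derivative more than [v_t], up to the square of [v]
    smoothed by two orders. Absorbing the quadratic terms costs a factor [N] where a logarithm would
    do; this is harmless because the energy is of order N^(-2 mu) and [mu >= 1]. The H^1 error
    requires no second energy argument: on the box an inverse inequality multiplies the L^2 error by
    [N], and outside the box the error is the tail of the exact solution. The return from
    coefficients to functions is Parseval's identity, which rests on the density of trigonometric
    polynomials in L^2. *)

Lemma sum_subset_le (I : eqType) (s t : seq I) (F : I -> R) :
  uniq s -> {subset s <= t} -> (forall i, 0 <= F i) ->
  \sum_(i <- s) F i <= \sum_(i <- t) F i.
Proof.
elim: s t => [|x s IH] t /=; first by move=> _ _ F0; rewrite big_nil sumr_ge0.
case/andP=> xs us st F0.
have xt : x \in t by apply: st; rewrite mem_head.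
rewrite big_cons (perm_big _ (perm_to_rem xt)) /= big_cons lerD2l.
apply: IH => // y ys.
have yt : y \in t by apply: st; rewrite in_cons ys orbT.
have : y \in x :: rem x t by rewrite -(perm_mem (perm_to_rem xt)).
by rewrite in_cons => /orP[/eqP yx|//]; rewrite -yx ys in xs.
Qed.

(** Allowing any majorant [u i * v i] of [a i ^+ 2] keeps square roots out of the weighted uses
    below. In the induction the cross term is at most the geometric mean of [U * q] and [p * V],
    hence at most their arithmetic mean. *)
Lemma cauchy_schwarz (I : eqType) (s : seq I) (a u v : I -> R) :
  (forall i, i \in s -> 0 <= u i) -> (forall i, i \in s -> 0 <= v i) ->
  (forall i, i \in s -> a i ^+ 2 <= u i * v i) ->
  (\sum_(i <- s) a i) ^+ 2 <= (\sum_(i <- s) u i) * (\sum_(i <- s) v i).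
Proof.
elim: s => [|x s IH] Hu Hv Ha; first by rewrite !big_nil expr0n /= mul0r.
have sub i : i \in s -> i \in x :: s by move=> h; rewrite in_cons h orbT.
have {IH} := IH (fun i h => Hu i (sub i h)) (fun i h => Hv i (sub i h))
  (fun i h => Ha i (sub i h)).
rewrite !big_cons.
have U0 : 0 <= \sum_(i <- s) u i.
  by rewrite big_seq sumr_ge0 // => i h; apply/Hu/sub.
have V0 : 0 <= \sum_(i <- s) v i.
  by rewrite big_seq sumr_ge0 // => i h; apply/Hv/sub.
have hx := mem_head x s.
move: (Hu x hx) (Hv x hx) (Ha x hx) U0 V0.
move: (\sum_(i <- s) u i) (\sum_(i <- s) v i) (\sum_(i <- s) a i) => U V A.
move: (u x) (v x) (a x) => p q b p0 q0 hb U0 V0 hA.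
have key : A * b <= (U * q + p * V) / 2.
  apply: le_trans (ler_norm _) _.
  have h0 : 0 <= (U * q + p * V) / 2 by rewrite divr_ge0 ?addr_ge0 ?mulr_ge0.
  rewrite -(ler_pXn2r (n := 2)) ?nnegrE // real_normK ?num_real //.
  apply: (@le_trans _ _ ((U * V) * (p * q))).
    by rewrite exprMn ler_pM ?sqr_ge0.
  have := sqr_ge0 (U * q - p * V); nra.
nra.
Qed.

Lemma cauchy_schwarz2 (I J : eqType) (s : seq I) (t : seq J)
    (a u v : I -> J -> R) :
  (forall i j, 0 <= u i j) -> (forall i j, 0 <= v i j) ->
  (forall i j, a i j ^+ 2 <= u i j * v i j) ->
  (\sum_(i <- s) \sum_(j <- t) a i j) ^+ 2 <=
  (\sum_(i <- s) \sum_(j <- t) u i j) * (\sum_(i <- s) \sum_(j <- t) v i j).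
Proof.
move=> u0 v0 H; apply: cauchy_schwarz => i _.
- exact: sumr_ge0.
- exact: sumr_ge0.
- exact: cauchy_schwarz.
Qed.

(* For nonnegative [F], the possibly infinite sum of [F] is at most [M]. *)
Definition wsum_le (I : eqType) (F : I -> R) (M : R) : Prop :=
  forall s : seq I, uniq s -> \sum_(i <- s) F i <= M.

Lemma wsum_le_inj (I J : eqType) (F : I -> R) M (f : J -> I) :
  injective f -> wsum_le F M -> wsum_le (F \o f) M.
Proof.
move=> fi FM s us; have := FM (map f s); rewrite map_inj_uniq // => /(_ us).
by rewrite big_map.
Qed.

Lemma wsum_le_ge0 (I : eqType) (F : I -> R) (M : R) : wsum_le F M -> 0 <= M.
Proof. by move/(_ nil isT); rewrite big_nil. Qed.

Lemma wsum_le_weaken (I : eqType) (F G : I -> R) (M M' : R) :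
  (forall i, F i <= G i) -> M <= M' -> wsum_le G M -> wsum_le F M'.
Proof.
move=> FG MM' GM s us; apply: le_trans MM'; apply: le_trans (GM s us).
exact: ler_sum.
Qed.

Lemma wsum_leZ (I : eqType) (F : I -> R) (M c : R) : 0 <= c ->
  wsum_le F M -> wsum_le (fun i => c * F i) (c * M).
Proof. by move=> c0 FM s us; rewrite -mulr_sumr ler_wpM2l // FM. Qed.

(** [locked] keeps simplification from unfolding the list of the integers of modulus at most [N]. *)
Definition zrange (N : nat) : seq int :=
  locked [seq i%:Z - N%:Z | i <- iota 0 (2 * N).+1].
Definition box (N : nat) : seq (int * int) := [seq (i, j) | i <- zrange N, j <- zrange N].

Lemma zrange_uniq N : uniq (zrange N).
Proof. by rewrite /zrange -lock map_inj_uniq ?iota_uniq // => i j; lia. Qed.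

Lemma mem_zrange N i : (i \in zrange N) = (`|i| <= N)%N.
Proof.
rewrite /zrange -lock; apply/mapP/idP => [[j]|h].
  by rewrite mem_iota => hj ->; lia.
by exists (absz (i + N%:Z)); [rewrite mem_iota|]; lia.
Qed.

Lemma box_uniq N : uniq (box N).
Proof. by apply: allpairs_uniq; rewrite ?zrange_uniq // => -[? ?] [? ?]. Qed.

Lemma mem_box N k : (k \in box N) = (`|k.1| <= N)%N && (`|k.2| <= N)%N.
Proof.
rewrite -!mem_zrange; case: k => k1 k2 /=.
apply/allpairsP/andP => [[[x y] /= [hx hy [-> ->]]]//|[h1 h2]].
by exists (k1, k2).
Qed.

Lemma box_sub N M : (N <= M)%N -> {subset box N <= box M}.
Proof. by move=> NM k; rewrite !mem_box => /andP[h1 h2]; rewrite !(leq_trans _ NM). Qed.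

Lemma zrange_exists (s : seq int) : exists N, {subset s <= zrange N}.
Proof.
elim: s => [|x s [N HN]]; first by exists 0%N.
exists (maxn N `|x|); move=> y; rewrite in_cons mem_zrange => /orP[/eqP ->|/HN].
  exact: leq_maxr.
by rewrite mem_zrange => h; rewrite (leq_trans h) // leq_maxl.
Qed.

Lemma box_exists (s : seq (int * int)) : exists N, {subset s <= box N}.
Proof.
elim: s => [|x s [N HN]]; first by exists 0%N.
exists (maxn N (maxn `|x.1| `|x.2|)) => y; rewrite in_cons => /orP[/eqP ->|/HN].
  by rewrite mem_box !leq_max !leqnn !orbT.
by rewrite !mem_box !leq_max => /andP[-> ->].
Qed.

Lemma big_box N (F : int * int -> R) :
  \sum_(k <- box N) F k = \sum_(i <- zrange N) \sum_(j <- zrange N) F (i, j).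
Proof. by rewrite big_allpairs. Qed.

Lemma zrange_sumS N (F : int -> R) :
  \sum_(i <- zrange N.+1) F i =
  F (N.+1%:Z) + F (- N.+1%:Z) + \sum_(i <- zrange N) F i.
Proof.
have p : perm_eq (zrange N.+1) [:: N.+1%:Z, - N.+1%:Z & zrange N].
  apply: uniq_perm; first exact: zrange_uniq.
    by rewrite !cons_uniq !in_cons !mem_zrange zrange_uniq; lia.
  by move=> i; rewrite !in_cons !mem_zrange; lia.
by rewrite (perm_big _ p) /= !big_cons addrA.
Qed.

Lemma zrange_sum0 (F : int -> R) : \sum_(i <- zrange 0) F i = F 0.
Proof. by rewrite /zrange -lock /= big_cons big_nil addr0 subrr. Qed.

Lemma wsum_le_zrange (F : int -> R) (M : R) : (forall i, 0 <= F i) ->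
  (forall N, \sum_(i <- zrange N) F i <= M) -> wsum_le F M.
Proof.
move=> F0 FM s us; have [N HN] := zrange_exists s.
by apply: le_trans (FM N); apply: sum_subset_le.
Qed.

Lemma wsum_le_box (F : int * int -> R) (M : R) : (forall i, 0 <= F i) ->
  (forall N, \sum_(i <- box N) F i <= M) -> wsum_le F M.
Proof.
move=> F0 FM s us; have [N HN] := box_exists s.
by apply: le_trans (FM N); apply: sum_subset_le.
Qed.

(** Telescoping: the two terms of modulus n contribute at most 4 (1/n - 1/(n+1)), the term at 0
    contributes 1. *)
Lemma sum_inv_sqr : wsum_le (fun i : int => (1 + i%:~R ^+ 2)^-1) 5.
Proof.
apply: wsum_le_zrange => [i|N]; first by rewrite invr_ge0 addr_ge0 ?sqr_ge0.
suff : \sum_(i <- zrange N) (1 + i%:~R ^+ 2)^-1 <= 5 - 4 / (N.+1%:R : R).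
  by move/le_trans; apply; rewrite gerBl divr_ge0.
elim: N => [|N IH]; first by rewrite zrange_sum0 expr0n /= addr0 invr1; lra.
rewrite zrange_sumS mulrNz sqrrN.
apply: le_trans (lerD (lexx _) IH) _.
rewrite -pmulrn -(natr1 N.+1).
have : 1 <= (N.+1%:R : R) by rewrite ler1n.
move: (N.+1%:R : R) => n n1.
have h : (1 + n ^+ 2)^-1 <= 2 * (n^-1 - (n + 1)^-1).
  have -> : 2 * (n^-1 - (n + 1)^-1) = 2 / (n * (n + 1)).
    by field; rewrite !gt_eqF //; lra.
  rewrite -[leLHS]mul1r ler_pdivrMr; last nra.
  by rewrite mulrAC ler_pdivlMr; nra.
lra.
Qed.

(** The decay in [n] is what [hankel_fst] relies on. Telescoping again, now from n^2 + x^2 >= (n +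
    x)^2 / 2. *)
Lemma sum_inv_row (n : R) : 1 <= n ->
  wsum_le (fun q : int => (n ^+ 2 + q%:~R ^+ 2)^-1) (5 / n).
Proof.
move=> n1; apply: wsum_le_zrange => [i|N].
  by rewrite invr_ge0 addr_ge0 ?sqr_ge0.
have n0 : 0 < n by lra.
suff : \sum_(i <- zrange N) (n ^+ 2 + i%:~R ^+ 2)^-1 <=
    n^-1 + 4 / n - 4 / (n + N%:R).
  move/le_trans; apply; have : 0 <= 4 / (n + N%:R) by rewrite divr_ge0 // addr_ge0 // ltW.
  by move: (4 / (n + _)) => x x0; lra.
elim: N => [|N IH].
  rewrite zrange_sum0 expr0n /= addr0 addr0 addrK lef_pV2 ?posrE; nra.
rewrite zrange_sumS mulrNz sqrrN.
apply: le_trans (lerD (lexx _) IH) _.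
rewrite -pmulrn -(natr1 N) (addrA n).
have : 0 <= (N%:R : R) by [].
move: (N%:R : R) => x x0.
have h : (n ^+ 2 + (x + 1) ^+ 2)^-1 <= 2 * ((n + x)^-1 - (n + x + 1)^-1).
  have -> : 2 * ((n + x)^-1 - (n + x + 1)^-1) = 2 / ((n + x) * (n + x + 1)).
    by field; rewrite !gt_eqF //; lra.
  rewrite -[leLHS]mul1r ler_pdivrMr; last nra.
  rewrite mulrAC ler_pdivlMr; last nra.
  have := sqr_ge0 (n - (x + 1)); nra.
lra.
Qed.

Lemma sum_inv_sqrt n :
  \sum_(1 <= j < n.+1) (Num.sqrt j%:R)^-1 <= 2 * Num.sqrt (n%:R : R).
Proof.
elim: n => [|n IH]; first by rewrite big_geq // sqrtr0 mulr0.
rewrite big_nat_recr //=; apply: le_trans (lerD IH (lexx _)) _.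
have : 0 < Num.sqrt (n.+1%:R : R) by rewrite sqrtr_gt0 ltr0n.
have := sqrtr_ge0 (n%:R : R).
have := sqr_sqrtr (ler0n R n); have := sqr_sqrtr (ler0n R n.+1).
rewrite -(natr1 n); move: (Num.sqrt _) (Num.sqrt _) => x y hx hy y0 x0.
rewrite -lerBrDl -[leLHS]mul1r ler_pdivrMr //.
have := sqr_ge0 (x - y); nra.
Qed.

End FiniteSums.

(** * The lattice weight of the Sobolev norms *)

Section Weight.
Variable R : realType.
Implicit Types (k m : int * int) (f g h : int * int -> R).

Lemma eq_lew (x y : R) : x = y -> x <= y.
Proof. by move->. Qed.

Definition wt k : R := 1 + (k.1%:~R ^+ 2 + k.2%:~R ^+ 2).

Lemma wtE k : wt k = 1 + (k.1%:~R ^+ 2 + k.2%:~R ^+ 2).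
Proof. by []. Qed.

Lemma wt_ge1 k : 1 <= wt k.
Proof. by rewrite /wt lerDl addr_ge0 ?sqr_ge0. Qed.

Lemma wt_gt0 k : 0 < wt k.
Proof. exact: lt_le_trans (wt_ge1 k). Qed.

Lemma wt_ge0 k : 0 <= wt k.
Proof. exact/ltW/wt_gt0. Qed.

End Weight.
#[global] Hint Extern 0 (is_true (0 < wt _ _)) => solve [exact: wt_gt0] : core.
#[global] Hint Extern 0 (is_true (0 <= wt _ _)) => solve [exact: wt_ge0] : core.
#[global] Hint Extern 0 (is_true (1 <= wt _ _)) => solve [exact: wt_ge1] : core.

(* [lia] does not see through projections of pairs. *)
Ltac plia := repeat match goal with
  | |- context [fst ?p] => move: (fst p) => ?
  | |- context [snd ?p] => move: (snd p) => ?
  end; lia.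

Ltac nneg := repeat first
  [ exact: sqr_ge0 | exact: wt_ge0 | exact: sqrtr_ge0 | assumption
  | apply: mulr_ge0 | apply: addr_ge0 | rewrite invr_ge0 | apply: exprn_ge0
  | apply: sumr_ge0 => ? _ ]; trivial; by [].

(** * Weighted lattice sums and trilinear convolution estimates *)

Section Convolutions.
Variable R : realType.
Implicit Types (k m : int * int) (f g h : int * int -> R).
Local Notation wt := (wt R).

Lemma sum_inv_wt_sqr : wsum_le (fun k => (wt k ^+ 2)^-1) 25.
Proof.
apply: wsum_le_box => [k|N]; first by rewrite invr_ge0 sqr_ge0.
rewrite big_box.
apply: (@le_trans _ _ (\sum_(i <- zrange N) (1 + i%:~R ^+ 2)^-1 * 5)).
  apply: ler_sum => i _.
  apply: (@le_trans _ _ (\sum_(j <- zrange N) (1 + i%:~R ^+ 2)^-1 * (1 + j%:~R ^+ 2)^-1)).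
    apply: ler_sum => j _; rewrite -invfM lef_pV2 ?posrE ?exprn_gt0 ?mulr_gt0 //.
    - by rewrite /wt /=; have := sqr_ge0 (i%:~R : R); have := sqr_ge0 (j%:~R : R); nra.
    - by rewrite ltr_pwDl ?sqr_ge0.
    - by rewrite ltr_pwDl ?sqr_ge0.
  rewrite -mulr_sumr ler_wpM2l ?invr_ge0 ?addr_ge0 ?sqr_ge0 //.
  by apply: sum_inv_sqr; exact: zrange_uniq.
rewrite -mulr_suml -[25]/(5 * 5)%:R natrM ler_wpM2r //.
by apply: sum_inv_sqr; exact: zrange_uniq.
Qed.

(** Dropping the first frequency bounds each of the 2N + 1 rows by 5. The true growth is
    logarithmic, but a factor [N] is affordable since the quadratic terms are estimated under
    [N%:R * E <= 1]. *)
Lemma sum_inv_wt_box N : \sum_(k <- box N) (wt k)^-1 <= 5 * (2 * N).+1%:R.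
Proof.
rewrite big_box.
apply: (@le_trans _ _ (\sum_(i <- zrange N) 5)).
  apply: ler_sum => i _; apply: (@le_trans _ _ (\sum_(j <- zrange N) (1 + j%:~R ^+ 2)^-1)).
    apply: ler_sum => j _; rewrite lef_pV2 ?posrE //.
      by rewrite lerD2l lerDr sqr_ge0.
    by rewrite ltr_pwDl ?sqr_ge0.
  by apply: sum_inv_sqr; exact: zrange_uniq.
by rewrite big_const_seq count_predT iter_addr_0 /zrange -lock size_map size_iota mulr_natr.
Qed.

(** The inequality between geometric and arithmetic means separates the two factors, and each of
    them is a translate of the same summable sequence; the bound is therefore uniform in [k]. *)
Lemma sum_inv_wt_shift (s : seq (int * int)) k : uniq s ->
  \sum_(m <- s) (wt (k - m) * wt m)^-1 <= 25.
Proof.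
move=> us.
apply: (@le_trans _ _ (\sum_(m <- s) (2^-1 * (wt (k - m) ^+ 2)^-1 + 2^-1 * (wt m ^+ 2)^-1))).
  apply: ler_sum => m _; rewrite invfM -!exprVn.
  by have := sqr_ge0 ((wt (k - m))^-1 - (wt m)^-1); nra.
rewrite big_split /= -!mulr_sumr.
have h1 := sum_inv_wt_sqr us.
have inj : injective (fun m : int * int => k - m) by move=> x y /addrI /oppr_inj.
have h2 := wsum_le_inj inj sum_inv_wt_sqr us.
rewrite /= in h2; lra.
Qed.

Lemma sub_inj_r k : injective (fun m : int * int => k - m).
Proof. by move=> x y /addrI /oppr_inj. Qed.

Lemma sub_inj_l k : injective (fun m : int * int => m - k).
Proof. by move=> x y /addIr. Qed.

Section Trilinear.
Variables (s t : seq (int * int)) (f g h : int * int -> R).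
Hypotheses (us : uniq s) (ut : uniq t).

Let S := \sum_(k <- s) \sum_(m <- t) h k * f (k - m) * g m.

Lemma sum_shift_r (F : int * int -> R) (c : R) (a : int * int -> R) A :
  (forall k, 0 <= a k) -> wsum_le F c -> \sum_(k <- s) a k <= A -> 0 <= c ->
  \sum_(k <- s) \sum_(m <- t) F (k - m) * a k <= A * c.
Proof.
move=> a0 Fc aA c0; apply: le_trans (ler_wpM2r c0 aA).
rewrite mulr_suml; apply: ler_sum => k _; rewrite -mulr_suml mulrC ler_wpM2l //.
exact: (wsum_le_inj (sub_inj_r (k := k)) Fc ut).
Qed.

Lemma sum_shift_l (F : int * int -> R) (c : R) (a : int * int -> R) A :
  (forall k, 0 <= a k) -> wsum_le F c -> \sum_(k <- t) a k <= A -> 0 <= c ->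
  \sum_(k <- s) \sum_(m <- t) F (k - m) * a m <= A * c.
Proof.
move=> a0 Fc aA c0; apply: le_trans (ler_wpM2r c0 aA).
rewrite exchange_big mulr_suml /=; apply: ler_sum => k _.
rewrite -mulr_suml mulrC ler_wpM2l //.
exact: (wsum_le_inj (sub_inj_l (k := k)) Fc us).
Qed.

(** Two factors in H^1 and one in L^2, [al] telling whether [g] or [h] is the second one in H^1. It
    stands in for the missing embedding into bounded functions: Cauchy-Schwarz leaves the H^1
    factors with their weights, and the reciprocal weights are summed by [sum_inv_wt_shift] for each
    frequency of the L^2 factor. *)
Lemma trilinear_sobolev (al : bool) (F G H : R) :
  wsum_le (fun k => wt k * f k ^+ 2) F ->
  \sum_(m <- t) wt m ^+ al * g m ^+ 2 <= G ->
  \sum_(k <- s) wt k ^+ (~~ al) * h k ^+ 2 <= H ->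
  S ^+ 2 <= 25 * F * G * H.
Proof.
move=> hF hG hH.
have F0 := wsum_le_ge0 hF.
have G0 : 0 <= G by apply: le_trans hG; nneg.
have H0 : 0 <= H by apply: le_trans hH; nneg.
case: al hG hH => /= hG hH.
- apply: (@le_trans _ _ ((\sum_(k <- s) \sum_(m <- t) (wt (k - m) * f (k - m) ^+ 2) * (wt m * g m ^+ 2))
    * (\sum_(k <- s) \sum_(m <- t) h k ^+ 2 * (wt (k - m) * wt m)^-1))).
    apply: cauchy_schwarz2 => k m.
    + nneg.
    + nneg.
    + apply: eq_lew; field.
      by rewrite ?gt_eqF.
  have -> : 25 * F * G * H = (G * F) * (H * 25) by ring.
  apply: ler_pM.
  + nneg.
  + nneg.
  + apply: (@sum_shift_l (fun k => wt k * f k ^+ 2) F (fun k => wt k * g k ^+ 2)) => // k; nneg.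
  + apply: le_trans (ler_wpM2r (ler0n _ 25) hH); rewrite mulr_suml; apply: ler_sum => k _.
    by rewrite expr0 mul1r -mulr_sumr ler_wpM2l ?sqr_ge0 // sum_inv_wt_shift.
- apply: (@le_trans _ _ ((\sum_(k <- s) \sum_(m <- t) (wt (k - m) * f (k - m) ^+ 2) * (wt k * h k ^+ 2))
    * (\sum_(k <- s) \sum_(m <- t) g m ^+ 2 * (wt (k - m) * wt k)^-1))).
    apply: cauchy_schwarz2 => k m.
    + nneg.
    + nneg.
    + apply: eq_lew; field.
      by rewrite ?gt_eqF.
  have -> : 25 * F * G * H = (H * F) * (G * 25) by ring.
  apply: ler_pM.
  + nneg.
  + nneg.
  + apply: (@sum_shift_r (fun k => wt k * f k ^+ 2) F (fun k => wt k * h k ^+ 2)) => // k; nneg.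
  + apply: le_trans (ler_wpM2r (ler0n _ 25) hG); rewrite exchange_big mulr_suml /=; apply: ler_sum => m _.
    rewrite expr0 mul1r -mulr_sumr ler_wpM2l ?sqr_ge0 //.
    under eq_bigr => k _ do rewrite -[k - m]opprB /wt /= !mulrNz !sqrrN -/(wt (m - k)).
    exact: sum_inv_wt_shift.
Qed.

(** Young's inequality by the Schur test: [f (k - m)] is shared equally between the two factors of
    Cauchy-Schwarz. *)
Lemma trilinear_young_f (A G H : R) :
  (forall k, 0 <= f k) -> wsum_le f A ->
  \sum_(m <- t) g m ^+ 2 <= G -> \sum_(k <- s) h k ^+ 2 <= H ->
  S ^+ 2 <= A ^+ 2 * G * H.
Proof.
move=> f0 hA hG hH; have A0 := wsum_le_ge0 hA.
apply: (@le_trans _ _ ((\sum_(k <- s) \sum_(m <- t) f (k - m) * h k ^+ 2)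
    * (\sum_(k <- s) \sum_(m <- t) f (k - m) * g m ^+ 2))).
  apply: cauchy_schwarz2 => k m; [nneg|nneg|by apply: eq_lew; ring].
have -> : A ^+ 2 * G * H = (H * A) * (G * A) by ring.
apply: ler_pM.
- nneg.
- nneg.
- apply: (@sum_shift_r f A (fun k => h k ^+ 2)) => // k; nneg.
- apply: (@sum_shift_l f A (fun k => g k ^+ 2)) => // k; nneg.
Qed.

Lemma trilinear_young_h (A F G : R) :
  (forall k, 0 <= h k) -> \sum_(k <- s) h k <= A ->
  wsum_le (fun k => f k ^+ 2) F -> \sum_(m <- t) g m ^+ 2 <= G ->
  S ^+ 2 <= A ^+ 2 * F * G.
Proof.
move=> h0 hA hF hG; have F0 := wsum_le_ge0 hF.
have A0 : 0 <= A by apply: le_trans hA; apply: sumr_ge0.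
apply: (@le_trans _ _ ((\sum_(k <- s) \sum_(m <- t) h k * g m ^+ 2)
    * (\sum_(k <- s) \sum_(m <- t) f (k - m) ^+ 2 * h k))).
  apply: cauchy_schwarz2 => k m; [nneg|nneg|by apply: eq_lew; ring].
have -> : A ^+ 2 * F * G = (A * G) * (A * F) by ring.
apply: ler_pM.
- nneg.
- nneg.
- have G0 : 0 <= G by apply: le_trans hG; apply: sumr_ge0 => ? _; rewrite sqr_ge0.
  apply: le_trans (ler_wpM2r G0 hA); rewrite mulr_suml; apply: ler_sum => k _.
  by rewrite -mulr_sumr ler_wpM2l.
- exact: (@sum_shift_r (fun k => f k ^+ 2)).
Qed.

End Trilinear.

(** An inverse inequality: summability of the coefficients is bought with a factor [N]. The 15 comes
    from 5 (2N + 1) <= 15 N. *)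
Lemma l1_box N f F : (0 < N)%N ->
  \sum_(k <- box N) wt k * f k ^+ 2 <= F ->
  (\sum_(k <- box N) f k) ^+ 2 <= 15 * N%:R * F.
Proof.
move=> N0 hF.
have F0 : 0 <= F by apply: le_trans hF; nneg.
apply: (@le_trans _ _ ((\sum_(k <- box N) (wt k)^-1) * (\sum_(k <- box N) wt k * f k ^+ 2))).
  apply: cauchy_schwarz => k _; [nneg|nneg|].
  by rewrite mulrA mulVf ?mul1r ?gt_eqF.
apply: ler_pM => //.
- by apply: sumr_ge0 => ? _; rewrite invr_ge0.
- nneg.
apply: le_trans (sum_inv_wt_box N) _.
have : 1 <= (N%:R : R) by rewrite ler1n.
by rewrite -(natr1 (2 * N)) natrM; move: (N%:R : R) => x; lra.
Qed.

End Convolutions.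

(** * Convolutions mapping frequencies outside the box into it *)

Section Hankel.
Variable R : realType.
Implicit Types (k m l : int * int) (f g h : int * int -> R).

Let rt (z : int) : R := Num.sqrt z%:~R.

(** [N + 1 - i] is the distance from column [i] to the first column beyond the right edge of the
    box; it is at least 1 and takes each value once, so the sum compares with [sum_inv_sqrt]. *)
Let sum_inv_rt N (n : int) :
  \sum_(i <- zrange N | (N%:Z + 1 - i <= n)%R) (rt (N%:Z + 1 - i))^-1 <= 2 * rt n.
Proof.
have [n0|n0] := ltP n 1.
  rewrite big1_seq; first by rewrite mulr_ge0 ?sqrtr_ge0.
  by move=> i /andP[h]; rewrite mem_zrange => h'; exfalso; lia.
pose s : seq nat := [seq absz (N%:Z + 1 - i)%R | i : int <- [seq i : int <- zrange N | N%:Z + 1 - i <= n]].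
have us : uniq s.
  rewrite map_inj_in_uniq ?filter_uniq ?zrange_uniq // => x y.
  by rewrite !mem_filter !mem_zrange => /andP[_ ?] /andP[_ ?]; lia.
have sub : {subset s <= index_iota 1 `|n|.+1}.
  move=> j /mapP[i hi ->]; move: hi; rewrite mem_filter mem_zrange => /andP[h h'].
  by rewrite mem_index_iota; lia.
have := sum_subset_le us sub (F := fun j => (Num.sqrt (j%:R : R))^-1).
rewrite big_map big_filter => H.
have -> : rt n = Num.sqrt `|n|%N%:R by rewrite /rt -[in LHS](gez0_abs (_ : 0 <= n)) //; lia.
apply: le_trans (sum_inv_sqrt R `|n|%N).
apply: le_trans (H _); last by move=> i; rewrite invr_ge0 sqrtr_ge0.
rewrite le_eqVlt; apply/orP; left; apply/eqP.
rewrite big_seq_cond [RHS]big_seq_cond; apply: eq_bigr => i.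
rewrite mem_zrange => /andP[h h']; rewrite /rt; congr (Num.sqrt _)^-1.
by rewrite -[in LHS](gez0_abs (_ : 0 <= N%:Z + 1 - i)) //; lia.
Qed.

(* The first frequency of [k] is at most [N], that of [m] exceeds [N]: the
   operator is of Hankel type in that variable, and Hilbert-Schmidt because
   [H^1] functions of two variables have traces in [H^(1/2)] on lines.  The
   weight [wt / sqrt n], with [n] the distance of the first frequencies, is
   what makes both factors summable. *)
Lemma hankel_fst N f g F G (t : seq (int * int)) : uniq t ->
  (forall m, m \in t -> N%:Z < m.1) ->
  wsum_le (fun k => wt R k * f k ^+ 2) F -> \sum_(m <- t) g m ^+ 2 <= G ->
  \sum_(k <- box N) (\sum_(m <- t) f (k - m) * g m) ^+ 2 <= 10 * F * G.
Proof.
move=> ut tN hF hG.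
have F0 := wsum_le_ge0 hF.
have [L HL] := box_exists [seq k - m | k <- box N, m <- t].
have inBx k m : k \in box N -> m \in t -> k - m \in box L.
  by move=> hk hm; apply: HL; apply/allpairsP; exists (k, m).
have rt0 z : 0 <= rt z by exact: sqrtr_ge0.
(* For [l.1 >= 0] the square root is 0, and so is the quotient by it; no such [l] arises as a
   difference [k - m] with [k] in the box and [m] in [t]. *)
pose phi l := wt R l * f l ^+ 2 / rt (- l.1).
have phi0 l : 0 <= phi l by rewrite /phi; nneg.
pose A (i : int) := \sum_(l <- box L | (l.1 <= i - N%:Z - 1)%R) phi l.
have A0 i : 0 <= A i by apply: sumr_ge0.
pose B k := \sum_(m <- t) g m ^+ 2 * (rt (m.1 - k.1) / wt R (k - m)).
have step1 k : k \in box N -> (\sum_(m <- t) f (k - m) * g m) ^+ 2 <= A k.1 * B k.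
  move=> hk; apply: (@le_trans _ _ ((\sum_(m <- t) phi (k - m)) * B k)).
    apply: cauchy_schwarz => m hm //.
      by rewrite mulr_ge0 ?sqr_ge0 // divr_ge0.
    rewrite /phi /= opprB.
    have r0 : rt (m.1 - k.1) != 0.
      rewrite gt_eqF // sqrtr_gt0 ltr0z; have := tN _ hm.
      by move: hk; rewrite mem_box; plia.
    apply: eq_lew; field; by rewrite r0 gt_eqF.
  apply: ler_wpM2r.
    by apply: sumr_ge0 => m _; rewrite mulr_ge0 ?sqr_ge0 // divr_ge0.
  have -> : \sum_(m <- t) phi (k - m) = \sum_(l <- [seq k - m | m <- t]) phi l.
    by rewrite big_map.
  rewrite /A -[leRHS]big_filter.
  apply: sum_subset_le => // [|l /mapP[m hm ->]].
    by rewrite map_inj_uniq //; exact: sub_inj_r.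
  rewrite mem_filter inBx // andbT /=.
  by move: hk; rewrite mem_box; have := tN _ hm; rewrite /=; plia.
(* With n the distance of the first frequencies, the sum over the second one gives 5/n, so [rt n]
   times it is [5 / rt n]. Replacing n by its least value N + 1 - i makes the bound independent of
   [m]. *)
have stepB i : i \in zrange N ->
    \sum_(j <- zrange N) B (i, j) <= 5 * G / rt (N%:Z + 1 - i).
  rewrite mem_zrange => hi; rewrite /B exchange_big /=.
  have rti : 0 < rt (N%:Z + 1 - i) by rewrite sqrtr_gt0 ltr0z; lia.
  apply: (@le_trans _ _ (\sum_(m <- t) g m ^+ 2 * (5 / rt (N%:Z + 1 - i)))); last first.
    rewrite -mulr_suml mulrA; apply: ler_wpM2r; first by rewrite invr_ge0.
    by rewrite mulrC ler_wpM2l.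
  rewrite big_seq [leRHS]big_seq; apply: ler_sum => m hm.
  rewrite -mulr_sumr ler_wpM2l ?sqr_ge0 // -mulr_sumr.
  have hn := tN _ hm.
  have n1 : 1 <= ((m.1 - i)%:~R : R) by rewrite ler1z; move: hi hn; plia.
  have n0 : 0 < ((m.1 - i)%:~R : R) by apply: lt_le_trans n1.
  have rn0 : 0 < rt (m.1 - i) by rewrite sqrtr_gt0.
  apply: (@le_trans _ _ (rt (m.1 - i) * (5 / (m.1 - i)%:~R))).
    apply: ler_wpM2l => //.
    have := wsum_le_inj (@addIr _ (- m.2)) (sum_inv_row n1) (zrange_uniq N).
    apply: le_trans; apply: ler_sum => j _ /=.
    rewrite lef_pV2 ?posrE //; last by rewrite ltr_pwDl ?exprn_gt0 ?sqr_ge0.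
    rewrite /wt /= -[(i - m.1)]opprB mulrNz sqrrN.
    by rewrite addrA lerD2r lerDr.
  rewrite -{1}(sqr_sqrtr (ltW n0)) -/(rt _).
  have -> : rt (m.1 - i) * (5 / rt (m.1 - i) ^+ 2) = 5 / rt (m.1 - i).
    by field; rewrite gt_eqF.
  rewrite ler_pM2l // lef_pV2 ?posrE // ler_sqrt ?ler0z ?ltr0z ?ler_int; move: hi hn; plia.
apply: (@le_trans _ _ (\sum_(i <- zrange N) A i * (5 * G / rt (N%:Z + 1 - i)))).
  apply: (@le_trans _ _ (\sum_(k <- box N) A k.1 * B k)).
    by rewrite big_seq [leRHS]big_seq; apply: ler_sum.
  rewrite big_box big_seq [leRHS]big_seq; apply: ler_sum => i hi.
  by rewrite /= -mulr_sumr ler_wpM2l // stepB.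
have G0 : 0 <= G by apply: le_trans hG; apply: sumr_ge0 => ? _; rewrite sqr_ge0.
(* After exchanging the sums, the inner sum over [i] is at most [2 * rt (- l.1)] and cancels the
   square root in [phi l]. *)
have -> : \sum_(i <- zrange N) A i * (5 * G / rt (N%:Z + 1 - i)) =
  5 * G * \sum_(l <- box L) phi l *
     \sum_(i <- zrange N | (N%:Z + 1 - i <= - l.1)%R) (rt (N%:Z + 1 - i))^-1.
  under eq_bigr => i _ do rewrite /A mulr_suml big_mkcond /=.
  rewrite exchange_big mulr_sumr /=; apply: eq_bigr => l _.
  rewrite mulr_sumr mulr_sumr [RHS]big_mkcond /=; apply: eq_bigr => i _.
  have -> : (l.1 <= i - N%:Z - 1) = (N%:Z + 1 - i <= - l.1) by plia.
  by case: ifP => // _; ring.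
have -> : 10 * F * G = 5 * G * (2 * F) by ring.
apply: ler_wpM2l; first by rewrite mulr_ge0.
apply: (@le_trans _ _ (\sum_(l <- box L) 2 * (wt R l * f l ^+ 2))); last first.
  by rewrite -mulr_sumr ler_wpM2l // hF // box_uniq.
apply: ler_sum => l _.
apply: le_trans (ler_wpM2l (phi0 l) (sum_inv_rt N (- l.1))) _.
rewrite /phi; have w0 : 0 <= wt R l * f l ^+ 2 by rewrite mulr_ge0 ?sqr_ge0.
have [->|r0] := eqVneq (rt (- l.1)) 0; first by rewrite !mulr0 mulr_ge0.
by apply: eq_lew; field.
Qed.

(** What [hankel_fst] sees of a symmetry of the square; with it each side of the box can be moved to
    the right one. *)
Definition lattice_symmetry (s : int * int -> int * int) :=
  [/\ involutive s, {morph s : k m / k - m}, forall k, wt R (s k) = wt R k &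
      forall N k, (s k \in box N) = (k \in box N)].

Lemma hankel_symmetry s N f g F G (t : seq (int * int)) :
  lattice_symmetry s -> uniq t ->
  (forall m, m \in t -> N%:Z < (s m).1) ->
  wsum_le (fun k => wt R k * f k ^+ 2) F -> \sum_(m <- t) g m ^+ 2 <= G ->
  \sum_(k <- box N) (\sum_(m <- t) f (k - m) * g m) ^+ 2 <= 10 * F * G.
Proof.
move=> [sK sB sw sb] ut tN hF hG.
have si := inv_inj sK.
have p : perm_eq (box N) (map s (box N)).
  apply: uniq_perm; rewrite ?map_inj_uniq ?box_uniq // => k.
  by rewrite -[k in RHS]sK mem_map // sb.
rewrite (perm_big _ p) /= big_map.
have := @hankel_fst N (f \o s) (g \o s) F G (map s t).
rewrite map_inj_uniq // => /(_ ut) H.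
apply: le_trans (H _ _ _).
- apply: ler_sum => k _; rewrite big_map /=; apply: eq_lew; congr (_ ^+ 2).
  by apply: eq_bigr => m _; rewrite sB !sK.
- by move=> m /mapP[m' hm' ->]; exact: tN.
- apply: wsum_le_weaken (wsum_le_inj si hF) => // k /=.
  by rewrite sw.
- rewrite big_map /=; under eq_bigr => m _ do rewrite sK.
  exact: hG.
Qed.

Let neg1 k : int * int := (- k.1, k.2).
Let swap k : int * int := (k.2, k.1).
(** Both signs change because the quarter turn from [k] to [(- k.2, k.1)] is not an involution. *)
Let nswap k : int * int := (- k.2, - k.1).

(** A frequency outside the box exceeds [N] in one of four directions. The four pieces recombine by
    (a + b + c + d)^2 <= 4 (a^2 + b^2 + c^2 + d^2), whence 160 = 4 * 4 * 10. *)
Lemma truncated_product N f g F G (t : seq (int * int)) : uniq t ->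
  (forall m, m \in t -> m \notin box N) ->
  wsum_le (fun k => wt R k * f k ^+ 2) F -> \sum_(m <- t) g m ^+ 2 <= G ->
  \sum_(k <- box N) (\sum_(m <- t) f (k - m) * g m) ^+ 2 <= 160 * F * G.
Proof.
move=> ut tN hF hG.
have S1 : lattice_symmetry id by split.
have S2 : lattice_symmetry neg1.
  split.
  - by move=> [x y]; rewrite /neg1 /= opprK.
  - by move=> k m; rewrite /neg1 /= opprD.
  - by move=> k; rewrite /wt /= mulrNz sqrrN.
  - by move=> M k; rewrite !mem_box /= abszN.
have S3 : lattice_symmetry swap.
  split.
  - by move=> [x y].
  - by move=> k m.
  - by move=> k; rewrite /wt /= [_^+2 + _]addrC.
  - by move=> M k; rewrite !mem_box /= andbC.
have S4 : lattice_symmetry nswap.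
  split.
  - by move=> [x y]; rewrite /nswap /= !opprK.
  - by move=> k m; rewrite /nswap /= !opprD.
  - by move=> k; rewrite /wt /= !mulrNz !sqrrN [_^+2 + _]addrC.
  - by move=> M k; rewrite !mem_box /= !abszN andbC.
have piece s (P : pred (int * int)) : lattice_symmetry s ->
    (forall m, m \in t -> P m -> N%:Z < (s m).1) ->
    \sum_(k <- box N) (\sum_(m <- t | P m) f (k - m) * g m) ^+ 2 <= 10 * F * G.
  move=> Ss HP; under eq_bigr => k _ do rewrite -big_filter.
  apply: (@hankel_symmetry s) => //; rewrite ?filter_uniq //.
    by move=> m; rewrite mem_filter => /andP[? ?]; exact: HP.
  rewrite big_filter; apply: le_trans hG; rewrite [leRHS](bigID P) /= lerDl.
  by apply: sumr_ge0 => ? _; rewrite sqr_ge0.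
(* Each frequency is assigned to the first direction that applies, so that the pieces are
   disjoint. *)
pose P1 m := N%:Z < m.1.
pose P2 m := ~~ P1 m && (N%:Z < - m.1).
pose P3 m := [&& ~~ P1 m, ~~ (N%:Z < - m.1) & N%:Z < m.2].
pose P4 m := [&& ~~ P1 m, ~~ (N%:Z < - m.1) & ~~ (N%:Z < m.2)].
have h1 := piece id P1 S1 (fun m _ Pm => Pm).
have h2 : \sum_(k <- box N) (\sum_(m <- t | P2 m) f (k - m) * g m) ^+ 2 <= 10 * F * G.
  by apply: (piece neg1) => // m _ /andP[].
have h3 : \sum_(k <- box N) (\sum_(m <- t | P3 m) f (k - m) * g m) ^+ 2 <= 10 * F * G.
  by apply: (piece swap) => // m _ /and3P[].
have h4 : \sum_(k <- box N) (\sum_(m <- t | P4 m) f (k - m) * g m) ^+ 2 <= 10 * F * G.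
  apply: (piece nswap) => // m /tN; rewrite mem_box /P4 /P1 /nswap /=.
  by move=> + /and3P[]; plia.
have split4 k : \sum_(m <- t) f (k - m) * g m =
    \sum_(m <- t | P1 m) f (k - m) * g m + \sum_(m <- t | P2 m) f (k - m) * g m +
    \sum_(m <- t | P3 m) f (k - m) * g m + \sum_(m <- t | P4 m) f (k - m) * g m.
  rewrite (bigID P1) /= (bigID (fun m => N%:Z < - m.1) (fun m => ~~ P1 m)) /=.
  rewrite (bigID (fun m : int * int => N%:Z < m.2) (fun m => ~~ P1 m && ~~ (N%:Z < - m.1))) /=.
  rewrite !addrA; congr (_ + _ + _ + _).
    by apply: eq_bigl => m; rewrite /P3 andbA.
  by apply: eq_bigl => m; rewrite /P4 andbA.
apply: (@le_trans _ _ (4 * (10 * F * G + 10 * F * G + 10 * F * G + 10 * F * G))); last by lra.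
apply: (@le_trans _ _ (4 * (\sum_(k <- box N) (\sum_(m <- t | P1 m) f (k - m) * g m) ^+ 2
   + \sum_(k <- box N) (\sum_(m <- t | P2 m) f (k - m) * g m) ^+ 2
   + \sum_(k <- box N) (\sum_(m <- t | P3 m) f (k - m) * g m) ^+ 2
   + \sum_(k <- box N) (\sum_(m <- t | P4 m) f (k - m) * g m) ^+ 2))); last first.
  by rewrite ler_wpM2l // !lerD.
rewrite -!big_split mulr_sumr /=; apply: ler_sum => k _; rewrite split4.
move: (bigop _ _ _) (bigop _ _ _) (bigop _ _ _) (bigop _ _ _) => a b c d.
have := sqr_ge0 (a - b); have := sqr_ge0 (a - c); have := sqr_ge0 (a - d).
have := sqr_ge0 (b - c); have := sqr_ge0 (b - d); have := sqr_ge0 (c - d).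
nra.
Qed.

End Hankel.

(** * Growth rate of the energy, for nonnegative sequences *)

Section EnergyRate.
Variable R : realType.
Implicit Types (k m : int * int) (f g h : int * int -> R).
Local Notation wt := (wt R).

Lemma wsum_le_support N (F : int * int -> R) M : (forall k, 0 <= F k) ->
  (forall k, k \notin box N -> F k = 0) -> \sum_(k <- box N) F k <= M ->
  wsum_le F M.
Proof.
move=> F0 Fs FM s us; apply: le_trans FM.
have -> : \sum_(k <- s) F k = \sum_(k <- [seq k <- s | k \in box N]) F k.
  rewrite big_filter [RHS]big_mkcond /=; apply: eq_bigr => k _.
  by case: ifPn => // /Fs.
apply: sum_subset_le => //; rewrite ?filter_uniq // => k.
by rewrite mem_filter => /andP[].
Qed.

(** Weaker than a bound with the square root of [c], but it keeps the constants polynomial. *)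
Lemma le_of_sqr_le (S c E : R) : 0 <= c -> 0 <= E ->
  S ^+ 2 <= c * E ^+ 2 -> S <= (1 + c) * E.
Proof.
move=> c0 E0 h; rewrite leNgt; apply/negP => lt.
have : ((1 + c) * E) ^+ 2 < S ^+ 2 by rewrite ltr_pXn2r ?nnegrE //; nra.
nra.
Qed.

(** [al] and [be] tell whether the energy controls the error of [zeta], respectively of [v], in H^1
    rather than in L^2. [c0] compares the energy with these norms and bounds the multipliers, [M]
    bounds the reference in H^1, [A] its first component in l^1, and [eps2] the squared
    residuals. *)
Variables (N : nat) (al be : bool) (c0 M A E eps2 : R).
Hypotheses (N0 : (0 < N)%N) (ab : ~~ (al && be)) (c01 : 1 <= c0)
  (E0 : 0 <= E) (eps0 : 0 <= eps2) (NE : N%:R * E <= 1) (M0 : 0 <= M).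

(** One summand for each kind of term: reference factor in H^1, reference factor in l^1, quadratic
    in the error, residual. The leading 1 is that of [le_of_sqr_le]. *)
Definition energy_constant := 1 + (25 * M * c0 ^+ 3 + A ^+ 2 * c0 ^+ 3 + 15 * c0 ^+ 4 + c0 ^+ 2).
Local Notation B := energy_constant.
Local Notation EE := (E + eps2).

Let c00 : 0 <= c0. Proof. exact: le_trans c01. Qed.

Let Bparts : let b := 25 * M * c0 ^+ 3 + A ^+ 2 * c0 ^+ 3 + 15 * c0 ^+ 4 + c0 ^+ 2 in
  [/\ 25 * M * c0 ^+ 3 <= b, A ^+ 2 * c0 ^+ 3 <= b, 15 * c0 ^+ 4 <= b & c0 ^+ 2 <= b].
Proof.
have h1 : 0 <= 25 * M * c0 ^+ 3 by nneg.
have h2 : 0 <= A ^+ 2 * c0 ^+ 3 by nneg.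
have h3 : 0 <= 15 * c0 ^+ 4 by nneg.
have h4 : 0 <= c0 ^+ 2 by nneg.
by split; lra.
Qed.

Lemma energy_constant_ge0 : 0 <= B.
Proof. by apply: addr_ge0 => //; have [_ _ _] := Bparts; apply: le_trans; exact: sqr_ge0. Qed.

Let boundB S c : S ^+ 2 <= c * EE ^+ 2 ->
  c <= 25 * M * c0 ^+ 3 + A ^+ 2 * c0 ^+ 3 + 15 * c0 ^+ 4 + c0 ^+ 2 ->
  S <= B * EE.
Proof.
move=> h hc; apply: le_of_sqr_le.
- by have [_ _ _] := Bparts; apply: le_trans; exact: sqr_ge0.
- exact: addr_ge0.
by apply: le_trans h _; rewrite ler_wpM2r ?sqr_ge0.
Qed.

Let sqE (x y : R) : x <= y -> 0 <= x -> x ^+ 2 <= y ^+ 2.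
Proof. by move=> xy x0; rewrite ler_pXn2r ?nnegrE //; lra. Qed.

Let EEE : E ^+ 2 <= EE ^+ 2. Proof. by apply: sqE => //; rewrite lerDl. Qed.

Let drop_weight (x : bool) (s : seq (int * int)) f G :
  \sum_(k <- s) wt k ^+ x * f k ^+ 2 <= G -> \sum_(k <- s) f k ^+ 2 <= G.
Proof.
apply: le_trans; apply: ler_sum => k _; rewrite -[leLHS]mul1r.
by rewrite ler_wpM2r ?sqr_ge0 // exprn_ege1.
Qed.

Let nbound (S X : R) : S ^+ 2 <= X -> X <= N%:R * (15 * c0 ^+ 4 * E ^+ 3) -> S <= B * EE.
Proof.
move=> h hX; apply: (@boundB _ (15 * c0 ^+ 4)).
  apply: le_trans h _; apply: le_trans hX _.
  have -> : N%:R * (15 * c0 ^+ 4 * E ^+ 3) = 15 * c0 ^+ 4 * ((N%:R * E) * E ^+ 2) by ring.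
  apply: ler_wpM2l; first by nneg.
  apply: le_trans EEE; rewrite -[leRHS]mul1r ler_wpM2r ?sqr_ge0 //.
by case: Bparts.
Qed.

Section Terms.
Variables (x : bool) (f g h : int * int -> R).
Hypotheses (f0 : forall k, 0 <= f k) (g0 : forall k, 0 <= g k) (h0 : forall k, 0 <= h k).
Hypothesis hh : \sum_(k <- box N) wt k ^+ (~~ x) * h k ^+ 2 <= c0 ^+ 2 * E.
Let S := \sum_(k <- box N) \sum_(m <- box N) h k * f (k - m) * g m.

(** [g] is an error and [h] an error after its multiplier. Exactly one of them carries the H^1
    weight, which together with [f] in H^1 is the situation of [trilinear_sobolev]. *)
Lemma reference_term : wsum_le (fun k => wt k * f k ^+ 2) M ->
  \sum_(k <- box N) wt k ^+ x * g k ^+ 2 <= c0 * E -> S <= B * EE.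
Proof.
move=> hf hg; apply: (@boundB _ (25 * M * c0 ^+ 3)).
  apply: le_trans (trilinear_sobolev (box_uniq N) (box_uniq N) hf hg hh) _.
  have -> : 25 * M * (c0 * E) * (c0 ^+ 2 * E) = 25 * M * c0 ^+ 3 * E ^+ 2 by ring.
  by apply: ler_wpM2l EEE; nneg.
by case: Bparts.
Qed.

(** Both errors are used in L^2 only, so the reference factor has to be absolutely summable. *)
Lemma wiener_term : wsum_le f A ->
  \sum_(k <- box N) g k ^+ 2 <= c0 * E -> S <= B * EE.
Proof.
move=> hf hg; apply: (@boundB _ (A ^+ 2 * c0 ^+ 3)).
  apply: le_trans (trilinear_young_f (box_uniq N) (box_uniq N) f0 hf hg (drop_weight hh)) _.
  have -> : A ^+ 2 * (c0 * E) * (c0 ^+ 2 * E) = A ^+ 2 * c0 ^+ 3 * E ^+ 2 by ring.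
  by apply: ler_wpM2l EEE; nneg.
by case: Bparts.
Qed.

(** Whichever of [f] and [h] carries the H^1 weight is summed by [l1_box]. The resulting factor
    [N * E] is at most 1, which reduces a term cubic in the errors to the size of the energy. *)
Lemma quadratic_term : (forall k, k \notin box N -> f k = 0) ->
  \sum_(k <- box N) wt k ^+ x * f k ^+ 2 <= c0 * E ->
  \sum_(k <- box N) g k ^+ 2 <= c0 * E -> S <= B * EE.
Proof.
move=> fs hf hg.
have hf2 : wsum_le (fun k => f k ^+ 2) (c0 * E).
  apply: (@wsum_le_support N) => [k|k /fs ->|]; first exact: sqr_ge0.
    by rewrite expr0n.
  exact: drop_weight hf.
move: hh hf; case: x => /= hh' hf.
- pose a := \sum_(k <- box N) f k.
  have ha : a ^+ 2 <= 15 * N%:R * (c0 * E).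
    by apply: l1_box => //; under eq_bigr do rewrite -[wt _]expr1.
  have fa : wsum_le f a by exact: (@wsum_le_support N).
  have := trilinear_young_f (box_uniq N) (box_uniq N) f0 fa hg (drop_weight (x := false) hh').
  move/nbound; apply.
  have -> : N%:R * (15 * c0 ^+ 4 * E ^+ 3) = (15 * N%:R * (c0 * E)) * (c0 * E) * (c0 ^+ 2 * E) by ring.
  by do 2 (apply: ler_wpM2r; first by nneg).
- pose a := \sum_(k <- box N) h k.
  have ha : a ^+ 2 <= 15 * N%:R * (c0 ^+ 2 * E).
    by apply: l1_box => //; under eq_bigr do rewrite -[wt _]expr1.
  have := trilinear_young_h (box_uniq N) h0 (lexx a) hf2 hg.
  move/nbound; apply.
  have -> : N%:R * (15 * c0 ^+ 4 * E ^+ 3) = (15 * N%:R * (c0 ^+ 2 * E)) * (c0 * E) * (c0 * E) by ring.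
  by do 2 (apply: ler_wpM2r; first by nneg).
Qed.

Lemma residual_term r : \sum_(k <- box N) r k ^+ 2 <= eps2 ->
  \sum_(k <- box N) h k * r k <= B * EE.
Proof.
move=> hr; apply: (@boundB _ (c0 ^+ 2)).
  apply: (@le_trans _ _ ((c0 ^+ 2 * E) * eps2)).
    apply: (@le_trans _ _ ((\sum_(k <- box N) h k ^+ 2) * (\sum_(k <- box N) r k ^+ 2))).
      apply: cauchy_schwarz => k _; [nneg|nneg|by rewrite exprMn].
    by apply: ler_pM => //; [nneg|nneg|exact: drop_weight hh].
  rewrite -mulrA ler_wpM2l ?sqr_ge0 //; have := E0; have := eps0; nra.
by case: Bparts.
Qed.

End Terms.

Variables (w1 w2 T X1 X2 z u1 u2 r0 r1 r2 : int * int -> R) (a1 a2 : bool -> int * int -> R).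
Hypotheses (T0 : forall k, 0 <= T k) (X10 : forall k, 0 <= X1 k) (X20 : forall k, 0 <= X2 k).
Hypotheses (z0 : forall k, 0 <= z k) (u10 : forall k, 0 <= u1 k) (u20 : forall k, 0 <= u2 k).
Hypotheses (Ts : forall k, k \notin box N -> T k = 0)
  (X1s : forall k, k \notin box N -> X1 k = 0) (X2s : forall k, k \notin box N -> X2 k = 0).
Hypotheses (hz : wsum_le (fun k => wt k * z k ^+ 2) M)
  (hu1 : wsum_le (fun k => wt k * u1 k ^+ 2) M)
  (hu2 : wsum_le (fun k => wt k * u2 k ^+ 2) M)
  (hzA : al -> wsum_le z A).
Hypotheses (hr0 : \sum_(k <- box N) r0 k ^+ 2 <= eps2)
  (hr1 : \sum_(k <- box N) r1 k ^+ 2 <= eps2)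
  (hr2 : \sum_(k <- box N) r2 k ^+ 2 <= eps2).
Hypotheses (hw1 : forall k, wt k ^+ al <= c0 * w1 k) (hw2 : forall k, wt k ^+ be <= c0 * w2 k).
Hypotheses (a10 : forall j k, 0 <= a1 j k) (a20 : forall j k, 0 <= a2 j k).
Hypotheses (ha1 : forall j k, wt k ^+ (~~ al) * a1 j k ^+ 2 <= c0 * wt k ^+ al)
  (ha2 : forall j k, wt k ^+ (~~ be) * a2 j k ^+ 2 <= c0 * wt k ^+ be).
Hypothesis hE : E = \sum_(k <- box N) (w1 k * T k ^+ 2 + w2 k * (X1 k ^+ 2 + X2 k ^+ 2)).

Let conv f g k := \sum_(m <- box N) f (k - m) * g m.

Let w10 k : 0 <= w1 k.
Proof. by have := le_trans (exprn_ge0 al (wt_ge0 R k)) (hw1 k); rewrite pmulr_rge0 // (lt_le_trans ltr01 c01). Qed.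
Let w20 k : 0 <= w2 k.
Proof. by have := le_trans (exprn_ge0 be (wt_ge0 R k)) (hw2 k); rewrite pmulr_rge0 // (lt_le_trans ltr01 c01). Qed.

Let TE : \sum_(k <- box N) wt k ^+ al * T k ^+ 2 <= c0 * E.
Proof.
rewrite hE mulr_sumr; apply: ler_sum => k _.
apply: (@le_trans _ _ (c0 * w1 k * T k ^+ 2)); first by rewrite ler_wpM2r ?sqr_ge0.
by rewrite -mulrA ler_wpM2l // lerDl; nneg.
Qed.
Let X1E : \sum_(k <- box N) wt k ^+ be * X1 k ^+ 2 <= c0 * E.
Proof.
rewrite hE mulr_sumr; apply: ler_sum => k _.
apply: (@le_trans _ _ (c0 * w2 k * X1 k ^+ 2)); first by rewrite ler_wpM2r ?sqr_ge0.
rewrite -mulrA ler_wpM2l //.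
have : 0 <= w2 k * X2 k ^+ 2 by nneg.
have : 0 <= w1 k * T k ^+ 2 by nneg.
lra.
Qed.
Let X2E : \sum_(k <- box N) wt k ^+ be * X2 k ^+ 2 <= c0 * E.
Proof.
rewrite hE mulr_sumr; apply: ler_sum => k _.
apply: (@le_trans _ _ (c0 * w2 k * X2 k ^+ 2)); first by rewrite ler_wpM2r ?sqr_ge0.
rewrite -mulrA ler_wpM2l //.
have : 0 <= w2 k * X1 k ^+ 2 by nneg.
have : 0 <= w1 k * T k ^+ 2 by nneg.
lra.
Qed.

(** For an error in H^1 the multiplier may have order 1, for an error in L^2 it has order -1; in
    both cases the product carries the complementary weight [~~ x]. *)
Let multiplier (x : bool) (a f : int * int -> R) :
  (forall k, wt k ^+ (~~ x) * a k ^+ 2 <= c0 * wt k ^+ x) ->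
  \sum_(k <- box N) wt k ^+ x * f k ^+ 2 <= c0 * E ->
  \sum_(k <- box N) wt k ^+ (~~ x) * (a k * f k) ^+ 2 <= c0 ^+ 2 * E.
Proof.
move=> ha hf; rewrite expr2 -mulrA; apply: le_trans (ler_wpM2l c00 hf).
rewrite mulr_sumr; apply: ler_sum => k _; rewrite exprMn [leLHS]mulrA [leRHS]mulrA.
by apply: ler_wpM2r (ha k); exact: sqr_ge0.
Qed.

Let pair_sum (h f g : int * int -> R) :
  \sum_(k <- box N) h k * conv f g k =
  \sum_(k <- box N) \sum_(m <- box N) h k * f (k - m) * g m.
Proof.
by apply: eq_bigr => k _; rewrite mulr_sumr; apply: eq_bigr => m _; rewrite !mulrA.
Qed.

Let zeta_rate a X r u : (forall k, 0 <= X k) -> (forall k, 0 <= a k) ->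
  (forall k, wt k ^+ (~~ al) * a k ^+ 2 <= c0 * wt k ^+ al) ->
  \sum_(k <- box N) wt k ^+ be * X k ^+ 2 <= c0 * E ->
  \sum_(k <- box N) r k ^+ 2 <= eps2 ->
  (forall k, 0 <= u k) -> wsum_le (fun k => wt k * u k ^+ 2) M ->
  \sum_(k <- box N) a k * T k * (conv z X k + conv u T k + conv T X k + r k)
    <= 4 * (B * EE).
Proof.
move=> X0 a0 ha hX hr u0 hu.
have hh := multiplier ha TE.
have h0 k : 0 <= a k * T k by nneg.
have hX' := drop_weight hX.
have h1 : \sum_(k <- box N) a k * T k * conv z X k <= B * EE.
  rewrite (pair_sum (fun k => a k * T k)).
  have : (al -> wsum_le z A) /\ ~~ (al && be) by [].
  (* When [al] holds, neither the multiplied [T] nor [X] is controlled in H^1: this is the place for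
     the l^1 bound [hzA]. *)
  move: hh; case: (al) => /= hh [hA hab].
    exact: (wiener_term (x := true) z0 hh (hA isT) hX').
  apply: (reference_term (x := false) hh hz).
  by under eq_bigr do rewrite expr0 mul1r.
have h2 : \sum_(k <- box N) a k * T k * conv u T k <= B * EE.
  by rewrite (pair_sum (fun k => a k * T k)); exact: (reference_term hh hu TE).
have h3 : \sum_(k <- box N) a k * T k * conv T X k <= B * EE.
  by rewrite (pair_sum (fun k => a k * T k)); exact: (quadratic_term T0 h0 hh Ts TE hX').
have h4 := residual_term hh hr.
under eq_bigr do rewrite !mulrDr.
rewrite !big_split /=; lra.
Qed.

(** All error factors are velocities with the same weight, so the Sobolev bound always applies to
    the terms with a reference factor. The 7 counts 2 + 2 + 1 + 1 + 1. *)
Let velocity_rate a X : (forall k, 0 <= X k) -> (forall k, 0 <= a k) ->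
  (forall k, wt k ^+ (~~ be) * a k ^+ 2 <= c0 * wt k ^+ be) ->
  \sum_(k <- box N) wt k ^+ be * X k ^+ 2 <= c0 * E ->
  \sum_(k <- box N) a k * X k * (2 * conv u1 X1 k + 2 * conv u2 X2 k
     + conv X1 X1 k + conv X2 X2 k + r0 k) <= 7 * (B * EE).
Proof.
move=> X0 a0 ha hX.
have hh := multiplier ha hX.
have h0 k : 0 <= a k * X k by nneg.
have ref u Y : (forall k, 0 <= u k) -> (forall k, 0 <= Y k) ->
    wsum_le (fun k => wt k * u k ^+ 2) M ->
    \sum_(k <- box N) wt k ^+ be * Y k ^+ 2 <= c0 * E ->
    \sum_(k <- box N) a k * X k * conv u Y k <= B * EE.
  move=> u0 Y0 hu hY; rewrite (pair_sum (fun k => a k * X k)).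
  exact: (reference_term hh hu hY).
have quad Y : (forall k, 0 <= Y k) -> (forall k, k \notin box N -> Y k = 0) ->
    \sum_(k <- box N) wt k ^+ be * Y k ^+ 2 <= c0 * E ->
    \sum_(k <- box N) a k * X k * conv Y Y k <= B * EE.
  move=> Y0 Ys hY; rewrite (pair_sum (fun k => a k * X k)).
  exact: (quadratic_term Y0 h0 hh Ys hY (drop_weight hY)).
have h1 := ref _ _ u10 X10 hu1 X1E.
have h2 := ref _ _ u20 X20 hu2 X2E.
have h3 := quad _ X10 X1s X1E.
have h4 := quad _ X20 X2s X2E.
have h5 := residual_term hh hr0.
under eq_bigr do rewrite !mulrDr.
rewrite !big_split /=.
have two Y : \sum_(k <- box N) a k * X k * (2 * Y k) = 2 * \sum_(k <- box N) a k * X k * Y k.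
  by rewrite mulr_sumr; apply: eq_bigr => k _; ring.
rewrite !two; lra.
Qed.

(** 22 = 4 + 4 + 7 + 7: one contribution for each of the two products [zeta v1], [zeta v2], and one
    for each velocity component. *)
Lemma energy_rate :
  \sum_(k <- box N)
     (a1 false k * T k * (conv z X1 k + conv u1 T k + conv T X1 k + r1 k) +
      a1 true k * T k * (conv z X2 k + conv u2 T k + conv T X2 k + r2 k)) +
  \sum_(k <- box N)
     (a2 false k * X1 k + a2 true k * X2 k) *
       (2 * conv u1 X1 k + 2 * conv u2 X2 k + conv X1 X1 k + conv X2 X2 k + r0 k)
  <= 22 * (B * EE).
Proof.
have h1 := zeta_rate X10 (a10 false) (ha1 false) X1E hr1 u10 hu1.
have h2 := zeta_rate X20 (a10 true) (ha1 true) X2E hr2 u20 hu2.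
have h3 := velocity_rate X10 (a20 false) (ha2 false) X1E.
have h4 := velocity_rate X20 (a20 true) (ha2 true) X2E.
under [X in _ + X]eq_bigr do rewrite mulrDl.
rewrite !big_split /=; lra.
Qed.

End EnergyRate.

(** * The modulus of complex numbers *)

Notation nc := ComplexField.Normc.normc.

Section ComplexModulus.
Variable R : realType.
Implicit Types x y : R[i].

Lemma nc_ge0 x : 0 <= nc x.
Proof. by case: x => a b; rewrite sqrtr_ge0. Qed.

Lemma nc_sqr x : nc x ^+ 2 = complex.Re x ^+ 2 + complex.Im x ^+ 2.
Proof. by case: x => a b /=; rewrite sqr_sqrtr // addr_ge0 ?sqr_ge0. Qed.

Lemma nc0 : nc (0 : R[i]) = 0.
Proof. by rewrite /= expr0n /= addr0 sqrtr0. Qed.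

Lemma ncM x y : nc (x * y) = nc x * nc y.
Proof. exact: ComplexField.Normc.normcM. Qed.

Lemma nc_real (r : R) : nc (real_complex R r) = `|r|.
Proof. by rewrite /= [0 ^+ 2]expr0n /= addr0 sqrtr_sqr. Qed.

Lemma ncD x y : nc (x + y) <= nc x + nc y.
Proof. exact: le_normcD. Qed.

Lemma ncN x : nc (- x) = nc x.
Proof. by case: x => a b /=; rewrite !sqrrN. Qed.

Lemma ncB x y : nc (x - y) <= nc x + nc y.
Proof. by rewrite -[nc y]ncN ncD. Qed.

Lemma nc_sqrD x y : nc (x + y) ^+ 2 <= 2 * nc x ^+ 2 + 2 * nc y ^+ 2.
Proof.
have h := ncD x y; apply: (@le_trans _ _ ((nc x + nc y) ^+ 2)).
  by apply: lerXn2r => //; rewrite nnegrE ?addr_ge0 ?nc_ge0.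
by have := sqr_ge0 (nc x - nc y); lra.
Qed.

Lemma nc_sum (I : Type) (s : seq I) (P : pred I) (F : I -> R[i]) :
  nc (\sum_(i <- s | P i) F i) <= \sum_(i <- s | P i) nc (F i).
Proof.
elim/big_ind2: _ => [|x1 x2 y1 y2 h1 h2|//]; first by rewrite nc0.
exact: le_trans (ncD _ _) (lerD h1 h2).
Qed.

Lemma le_nc_of_sqr (t : R) x : t ^+ 2 <= nc x ^+ 2 -> t <= nc x.
Proof.
move=> h; rewrite leNgt; apply/negP => lt.
by have := nc_ge0 x; move: h lt; nra.
Qed.

Lemma Re_le_nc x : `|complex.Re x| <= nc x.
Proof.
by apply: le_nc_of_sqr; rewrite real_normK ?num_real // nc_sqr lerDl sqr_ge0.
Qed.

Lemma Im_le_nc x : `|complex.Im x| <= nc x.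
Proof.
by apply: le_nc_of_sqr; rewrite real_normK ?num_real // nc_sqr lerDr sqr_ge0.
Qed.

Lemma ReD x y : complex.Re (x + y) = complex.Re x + complex.Re y.
Proof. by case: x y => [? ?] [? ?]. Qed.

Lemma ImD x y : complex.Im (x + y) = complex.Im x + complex.Im y.
Proof. by case: x y => [? ?] [? ?]. Qed.

End ComplexModulus.

(** * The system mode by mode and its energy inequality *)

Section FourierSystem.
Variable R : realType.
Implicit Types (k m : int * int).
Local Notation C := (real_complex R).
Local Notation ii := (Complex 0 1 : R[i]).

Definition kap1 k : R := 2 * pi * k.1%:~R.
Definition kap2 k : R := 2 * pi * k.2%:~R.
Definition kapsq k : R := kap1 k ^+ 2 + kap2 k ^+ 2.

Variables (a b c' d r1 r2 lam : R).

(* The k-th Fourier mode of the system; [p1], [p2] and [q] stand for the modes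
   of the products [zeta v1], [zeta v2] and [|v|^2]. *)
Definition fourier_system k (z v1 v2 zt v1t v2t p1 p2 q : R[i]) : Prop :=
  [/\ C (1 + b * kapsq k) * zt +
        ii * (C (kap1 k) * (C (r1 - a * kapsq k) * v1 + C lam * p1) +
              C (kap2 k) * (C (r1 - a * kapsq k) * v2 + C lam * p2)) = 0,
      C (1 + d * kapsq k) * v1t +
        ii * (C (kap1 k) * (C (r2 - c' * kapsq k) * z + C (lam / 2) * q)) = 0
    & C (1 + d * kapsq k) * v2t +
        ii * (C (kap2 k) * (C (r2 - c' * kapsq k) * z + C (lam / 2) * q)) = 0].

Lemma fourier_system_sub k z v1 v2 zt v1t v2t p1 p2 q z' v1' v2' zt' v1t' v2t' p1' p2' q' :
  fourier_system k z v1 v2 zt v1t v2t p1 p2 q ->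
  fourier_system k z' v1' v2' zt' v1t' v2t' p1' p2' q' ->
  fourier_system k (z - z') (v1 - v1') (v2 - v2') (zt - zt') (v1t - v1t') (v2t - v2t')
    (p1 - p1') (p2 - p2') (q - q').
Proof.
move=> [h1 h2 h3] [g1 g2 g3]; split.
- by have := congr2 (fun x y => x - y) h1 g1; rewrite /= subrr => <-; ring.
- by have := congr2 (fun x y => x - y) h2 g2; rewrite /= subrr => <-; ring.
- by have := congr2 (fun x y => x - y) h3 g3; rewrite /= subrr => <-; ring.
Qed.

(** The factor [q] is common to both weights: the coupling cancels whatever its value, so it is free
    to lower the order of both at each frequency. *)
Definition weight1 (q : R) k := (r2 - c' * kapsq k) * (1 + b * kapsq k) * q.
Definition weight2 (q : R) k := (r1 - a * kapsq k) * (1 + d * kapsq k) * q.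

(* twice the real part of [x^* y], the derivative of [|x|^2] when [y = x'] *)
Definition dnorm2 (x y : R[i]) : R :=
  2 * (complex.Re x * complex.Re y + complex.Im x * complex.Im y).

(** The quantity inside the absolute value is the imaginary part of conj(x + iy) (s + it). *)
Lemma cross_le_nc (x y s t : R) :
  `|x * t - y * s| <= nc (Complex x y) * nc (Complex s t).
Proof.
rewrite -ncM; apply: le_nc_of_sqr; rewrite real_normK ?num_real // ncM exprMn !nc_sqr /=.
have := sqr_ge0 (x * s + y * t); nra.
Qed.

Lemma cross_scaled_le (e l kk x y s t : R) : 0 <= e ->
  e * l * kk * (x * t - y * s) <=
  e * `|l| * `|kk| * (nc (Complex x y) * nc (Complex s t)).
Proof.
move=> e0; apply: le_trans (ler_norm _) _.
rewrite !normrM (ger0_norm e0); apply: ler_wpM2l; first by rewrite !mulr_ge0.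
exact: cross_le_nc.
Qed.

(* The weights make the skew coupling of [z] and [v] cancel. *)
Lemma fourier_system_energy q k z v1 v2 zt v1t v2t p1 p2 p0 :
  0 <= q -> 0 <= r2 - c' * kapsq k -> 0 <= r1 - a * kapsq k ->
  fourier_system k z v1 v2 zt v1t v2t p1 p2 p0 ->
  weight1 q k * dnorm2 z zt + weight2 q k * (dnorm2 v1 v1t + dnorm2 v2 v2t) <=
  2 * `|lam| * (r2 - c' * kapsq k) * q * `|kap1 k| * nc z * nc p1 +
  2 * `|lam| * (r2 - c' * kapsq k) * q * `|kap2 k| * nc z * nc p2 +
  (`|lam| * (r1 - a * kapsq k) * q * `|kap1 k| * nc v1 +
   `|lam| * (r1 - a * kapsq k) * q * `|kap2 k| * nc v2) * nc p0.
Proof.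
rewrite /weight1 /weight2 /fourier_system /dnorm2.
move: (kapsq k) (kap1 k) (kap2 k) => K k1 k2 q0.
set rA := r2 - _; set rB := r1 - _ => A0 B0.
set sb := 1 + b * K; set sd := 1 + d * K.
case: z v1 v2 zt v1t v2t p1 p2 p0 => [x y] [x1 y1] [x2 y2] [xt yt] [x1t y1t] [x2t y2t]
  [s1 t1] [s2 t2] [s0 t0] [].
move=> /(congr1 (fun w => (complex.Re w, complex.Im w))) /= [e1 e2].
move=> /(congr1 (fun w => (complex.Re w, complex.Im w))) /= [e3 e4].
move=> /(congr1 (fun w => (complex.Re w, complex.Im w))) /= [e5 e6].
have f1 : sb * xt = k1 * (rB * y1 + lam * t1) + k2 * (rB * y2 + lam * t2) by lra.
have f2 : sb * yt = - (k1 * (rB * x1 + lam * s1) + k2 * (rB * x2 + lam * s2)) by lra.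
have f3 : sd * x1t = k1 * (rA * y + lam / 2 * t0) by lra.
have f4 : sd * y1t = - (k1 * (rA * x + lam / 2 * s0)) by lra.
have f5 : sd * x2t = k2 * (rA * y + lam / 2 * t0) by lra.
have f6 : sd * y2t = - (k2 * (rA * x + lam / 2 * s0)) by lra.
have g1 := cross_scaled_le lam k1 x y s1 t1 (mulr_ge0 (ler0n R 2) (mulr_ge0 A0 q0)).
have g2 := cross_scaled_le lam k2 x y s2 t2 (mulr_ge0 (ler0n R 2) (mulr_ge0 A0 q0)).
have g3 := cross_scaled_le lam k1 x1 y1 s0 t0 (mulr_ge0 B0 q0).
have g4 := cross_scaled_le lam k2 x2 y2 s0 t0 (mulr_ge0 B0 q0).
have := lerD (lerD g1 g2) (lerD g3 g4).
set rhs := (X in _ <= X -> _) => H.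
(* The factors [1 + b * K] and [1 + d * K] of the weights are moved onto the time derivatives, which
   the equations then eliminate. *)
have -> : forall X, rA * sb * q * (2 * (x * xt + y * yt)) + X =
    rA * q * (2 * (x * (sb * xt) + y * (sb * yt))) + X by move=> X; ring.
have -> : rB * sd * q * (2 * (x1 * x1t + y1 * y1t) + 2 * (x2 * x2t + y2 * y2t)) =
    rB * q * (2 * (x1 * (sd * x1t) + y1 * (sd * y1t)) + 2 * (x2 * (sd * x2t) + y2 * (sd * y2t))).
  by ring.
rewrite f1 f2 f3 f4 f5 f6.
apply: (@le_trans _ _ rhs).
  by apply: le_trans H; apply: eq_lew; field.
by apply: eq_lew; rewrite /rhs /=; ring.
Qed.

Definition cconv N (f g : int * int -> R[i]) k : R[i] :=
  \sum_(m <- box N) f (k - m) * g m.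

Lemma nc_cconv N f g k :
  nc (cconv N f g k) <= \sum_(m <- box N) nc (f (k - m)) * nc (g m).
Proof. by apply: le_trans (nc_sum _ _ _) _; apply: ler_sum => m _; rewrite ncM. Qed.

(** The hypotheses of [energy_rate] for the actual symbols: signs, coercivity of the two weights in
    H^1 or L^2 according to [al] and [be], and the order of the multipliers that the nonlinear terms
    meet. *)
Definition admissible_weight (al be : bool) (c0 : R) (q : int * int -> R) : Prop :=
  [/\ forall k, [/\ 0 <= q k, 0 <= r2 - c' * kapsq k & 0 <= r1 - a * kapsq k],
      forall k, wt R k ^+ al <= c0 * weight1 (q k) k,
      forall k, wt R k ^+ be <= c0 * weight2 (q k) k,
      forall k (x : R), x = `|kap1 k| \/ x = `|kap2 k| -> wt R k ^+ (~~ al) *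
        (2 * `|lam| * (r2 - c' * kapsq k) * q k * x) ^+ 2 <= c0 * wt R k ^+ al
    & forall k (x : R), x = `|kap1 k| \/ x = `|kap2 k| -> wt R k ^+ (~~ be) *
        (`|lam| * (r1 - a * kapsq k) * q k * x) ^+ 2 <= c0 * wt R k ^+ be].

Definition energy q N (z v1 v2 : int * int -> R[i]) : R :=
  \sum_(k <- box N) (weight1 (q k) k * nc (z k) ^+ 2 +
    weight2 (q k) k * (nc (v1 k) ^+ 2 + nc (v2 k) ^+ 2)).

Definition energy_derivative q N (z v1 v2 zt v1t v2t : int * int -> R[i]) : R :=
  \sum_(k <- box N) (weight1 (q k) k * dnorm2 (z k) (zt k) +
    weight2 (q k) k * (dnorm2 (v1 k) (v1t k) + dnorm2 (v2 k) (v2t k))).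

(** The products have the form of a difference: (z + th)(u + x) - z u = z x + u th + th x. The
    sequences [s0], [s1], [s2] are the residuals of the reference. *)
Lemma energy_inequality al be (c0 : R) (q : int * int -> R) (M A : R) N (eps2 : R)
    (z u1 u2 th x1 x2 tht x1t x2t s1 s2 s0 : int * int -> R[i]) :
  (0 < N)%N -> ~~ (al && be) -> 1 <= c0 -> 0 <= eps2 -> 0 <= M ->
  admissible_weight al be c0 q ->
  (forall k, k \notin box N -> [/\ th k = 0, x1 k = 0 & x2 k = 0]) ->
  wsum_le (fun k => wt R k * nc (z k) ^+ 2) M ->
  wsum_le (fun k => wt R k * nc (u1 k) ^+ 2) M ->
  wsum_le (fun k => wt R k * nc (u2 k) ^+ 2) M ->
  (al -> wsum_le (fun k => nc (z k)) A) ->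
  \sum_(k <- box N) nc (s0 k) ^+ 2 <= eps2 ->
  \sum_(k <- box N) nc (s1 k) ^+ 2 <= eps2 ->
  \sum_(k <- box N) nc (s2 k) ^+ 2 <= eps2 ->
  (forall k, k \in box N -> fourier_system k (th k) (x1 k) (x2 k) (tht k) (x1t k) (x2t k)
    (cconv N z x1 k + cconv N u1 th k + cconv N th x1 k + s1 k)
    (cconv N z x2 k + cconv N u2 th k + cconv N th x2 k + s2 k)
    (2 * cconv N u1 x1 k + 2 * cconv N u2 x2 k + cconv N x1 x1 k + cconv N x2 x2 k + s0 k)) ->
  let E := energy q N th x1 x2 in
  N%:R * E <= 1 ->
  energy_derivative q N th x1 x2 tht x1t x2t <=
  22 * (energy_constant c0 M A * (E + eps2)).
Proof.
move=> N0 ab c01 e0 M0 [hpos hw1 hw2 ha1 ha2] hs hz hu1 hu2 hA hs0 hs1 hs2 hsys E NE.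
have c00 : 0 < c0 by lra.
have w10 k : 0 <= weight1 (q k) k.
  by have := le_trans (exprn_ge0 al (wt_ge0 R k)) (hw1 k); rewrite pmulr_rge0.
have w20 k : 0 <= weight2 (q k) k.
  by have := le_trans (exprn_ge0 be (wt_ge0 R k)) (hw2 k); rewrite pmulr_rge0.
have E0 : 0 <= E.
  apply: sumr_ge0 => k _; rewrite addr_ge0 // mulr_ge0 // ?sqr_ge0 //.
  by rewrite addr_ge0 ?sqr_ge0.
pose kk (j : bool) k : R := if j then `|kap2 k| else `|kap1 k|.
have kkP j k : kk j k = `|kap1 k| \/ kk j k = `|kap2 k| by case: j; [right|left].
have kk0 j k : 0 <= kk j k by case: j => /=.
have H := @energy_rate R N al be c0 M A E eps2 N0 ab c01 E0 e0 NE M0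
  (fun k => weight1 (q k) k) (fun k => weight2 (q k) k)
  (fun k => nc (th k)) (fun k => nc (x1 k)) (fun k => nc (x2 k))
  (fun k => nc (z k)) (fun k => nc (u1 k)) (fun k => nc (u2 k))
  (fun k => nc (s0 k)) (fun k => nc (s1 k)) (fun k => nc (s2 k))
  (fun j k => 2 * `|lam| * (r2 - c' * kapsq k) * q k * kk j k)
  (fun j k => `|lam| * (r1 - a * kapsq k) * q k * kk j k).
apply: le_trans (H _ _ _ _ _ _ _ _ _ _ _ _ _ _ _ _ _ _ _ _ _ _ _) => //=;
  try by move=> k; rewrite nc_ge0.
all: try by move=> k /hs[h1 h2 h3]; rewrite ?h1 ?h2 ?h3 nc0.
all: try by move=> j k; have [? ? ?] := hpos k; rewrite !mulr_ge0.
all: try by move=> j k; first [apply: ha1 | apply: ha2].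
- rewrite -big_split /= /energy_derivative big_seq [leRHS]big_seq; apply: ler_sum => k hk.
  have [q0 A0 B0] := hpos k.
  apply: le_trans (fourier_system_energy q0 A0 B0 (hsys k hk)) _.
  apply: lerD; first apply: lerD.
  + apply: ler_wpM2l; first by rewrite !mulr_ge0 ?nc_ge0.
    apply: le_trans (ncD _ _) _; rewrite lerD2r.
    apply: le_trans (ncD _ _) _; apply: lerD (nc_cconv _ _ _ _).
    by apply: le_trans (ncD _ _) _; apply: lerD (nc_cconv _ _ _ _) (nc_cconv _ _ _ _).
  + apply: ler_wpM2l; first by rewrite !mulr_ge0 ?nc_ge0.
    apply: le_trans (ncD _ _) _; rewrite lerD2r.
    apply: le_trans (ncD _ _) _; apply: lerD (nc_cconv _ _ _ _).
    by apply: le_trans (ncD _ _) _; apply: lerD (nc_cconv _ _ _ _) (nc_cconv _ _ _ _).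
  + apply: ler_wpM2l; first by rewrite addr_ge0 // !mulr_ge0 ?nc_ge0.
    apply: le_trans (ncD _ _) _; rewrite lerD2r.
    apply: le_trans (ncD _ _) _; apply: lerD (nc_cconv _ _ _ _).
    apply: le_trans (ncD _ _) _; apply: lerD (nc_cconv _ _ _ _).
    have n2 : nc (2 : R[i]) = 2.
      by have := nc_real (2 : R); rewrite rmorph_nat ger0_norm.
    apply: le_trans (ncD _ _) _; rewrite !ncM n2.
    by apply: lerD; apply: ler_wpM2l => //; apply: nc_cconv.
Qed.

End FourierSystem.

(** * Choice of the weights in the four cases *)

Section Weights.
Variable R : realType.
Implicit Types (k m : int * int).
Local Notation wt := (wt R).

Let P : R := (2 * pi) ^+ 2.

Let P0 : 0 < P.
Proof. by rewrite exprn_gt0 // mulr_gt0 // pi_gt0. Qed.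

Lemma kapsq_wt k : kapsq R k = (2 * pi) ^+ 2 * (wt k - 1).
Proof. by rewrite /kapsq /kap1 /kap2 /wt; ring. Qed.

Lemma kapsq_ge0 k : 0 <= kapsq R k.
Proof. by rewrite addr_ge0 ?sqr_ge0. Qed.

Lemma affine_lower (e f : R) k : 0 < e -> 0 < f ->
  Num.min e (f * P) * wt k <= e + f * kapsq R k.
Proof.
move=> e0 f0; rewrite kapsq_wt -/P mulrA.
have : Num.min e (f * P) <= e by rewrite ge_min lexx.
have : Num.min e (f * P) <= f * P by rewrite ge_min lexx orbT.
have := wt_ge1 R k; move: (Num.min _ _) => x; nra.
Qed.

(** [s] distinguishes a symbol of order two from a constant one, which lets the four cases be
    treated at once. *)
Lemma symbol_bounds (e f : R) (s : bool) : 0 < e -> (if s then 0 < f else f == 0) ->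
  exists m M : R, [/\ 0 < m, 0 < M &
    forall k, m * wt k ^+ s <= e + f * kapsq R k <= M * wt k ^+ s].
Proof.
move=> e0; case: s => [f0|/eqP ->].
  exists (Num.min e (f * P)), (e + f * P); split.
  - by rewrite lt_min e0 mulr_gt0.
  - by rewrite addr_gt0 // mulr_gt0.
  move=> k; rewrite expr1 affine_lower //= kapsq_wt -/P.
  by have := wt_ge1 R k; have := mulr_gt0 f0 P0; nra.
by exists e, e; split => // k; rewrite mul0r addr0 expr0 mulr1 lexx.
Qed.

(** [s] stands for [c' < 0] and [s'] for [a < 0]. The raw weights are of order [1 + s] and [1 + s']
    in [wt]; dividing by [wt ^+ (s && s').+1] removes their common part. What remains is L^2 for
    both unknowns if [s = s'], H^1 for [zeta] alone if only [s] holds, and H^1 for [v] alone if only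
    [s'] holds. *)
Lemma admissible_weight_exists (b c' d a r1 r2 lam : R) (s s' : bool) :
  0 < b -> 0 < d -> 0 < r1 -> 0 < r2 ->
  (if s then c' < 0 else c' == 0) -> (if s' then a < 0 else a == 0) ->
  exists c0 q, 1 <= c0 /\
    admissible_weight a b c' d r1 r2 lam (s && ~~ s') (s' && ~~ s) c0 q.
Proof.
move=> b0 d0 r10 r20 hc ha.
have [|mX [MX [mX0 MX0 hX]]] := @symbol_bounds r2 (- c') s r20.
  by case: s hc; rewrite ?oppr_gt0 ?oppr_eq0.
have [|mY [MY [mY0 MY0 hY]]] := @symbol_bounds r1 (- a) s' r10.
  by case: s' ha; rewrite ?oppr_gt0 ?oppr_eq0.
pose mb := Num.min 1 (b * P); pose md := Num.min 1 (d * P).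
have mb0 : 0 < mb by rewrite lt_min ltr01 mulr_gt0.
have md0 : 0 < md by rewrite lt_min ltr01 mulr_gt0.
have hb k : mb * wt k <= 1 + b * kapsq R k by exact: affine_lower.
have hd k : md * wt k <= 1 + d * kapsq R k by exact: affine_lower.
pose q k := (wt k ^+ (s && s').+1)^-1.
have q0 k : 0 < q k by rewrite invr_gt0 exprn_gt0.
(* Bookkeeping of exponents over the four values of [s] and [s']: [I1] and [I1'] give the order of
   the weights, [I2] and [I2'] that of the multipliers, with one [wt k] standing for the squared
   frequency. *)
have I1 k : wt k ^+ s * wt k * q k = wt k ^+ (s && ~~ s').
  by rewrite /q; have := lt0r_neq0 (wt_gt0 R k); case: (s); case: (s') => /= h; field.
have I1' k : wt k ^+ s' * wt k * q k = wt k ^+ (s' && ~~ s).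
  by rewrite /q; have := lt0r_neq0 (wt_gt0 R k); case: (s); case: (s') => /= h; field.
have I2 k : wt k ^+ (~~ (s && ~~ s')) * (wt k ^+ s * q k) ^+ 2 * wt k = wt k ^+ (s && ~~ s').
  by rewrite /q; have := lt0r_neq0 (wt_gt0 R k); case: (s); case: (s') => /= h; field.
have I2' k : wt k ^+ (~~ (s' && ~~ s)) * (wt k ^+ s' * q k) ^+ 2 * wt k = wt k ^+ (s' && ~~ s).
  by rewrite /q; have := lt0r_neq0 (wt_gt0 R k); case: (s); case: (s') => /= h; field.
pose c1 := (mX * mb)^-1; pose c2 := (mY * md)^-1.
pose c3 := 4 * lam ^+ 2 * MX ^+ 2 * P; pose c4 := lam ^+ 2 * MY ^+ 2 * P.
have c10 : 0 <= c1 by rewrite invr_ge0 ltW // mulr_gt0.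
have c20 : 0 <= c2 by rewrite invr_ge0 ltW // mulr_gt0.
have PP := ltW P0.
have c30 : 0 <= c3 by rewrite /c3; nneg.
have c40 : 0 <= c4 by rewrite /c4; nneg.
have X0 k : 0 <= r2 + - c' * kapsq R k.
  by have /andP[h _] := hX k; apply: le_trans h; rewrite mulr_ge0 ?exprn_ge0 // ltW.
have Y0 k : 0 <= r1 + - a * kapsq R k.
  by have /andP[h _] := hY k; apply: le_trans h; rewrite mulr_ge0 ?exprn_ge0 // ltW.
have xP k x : x = `|kap1 R k| \/ x = `|kap2 R k| -> 0 <= x /\ x ^+ 2 <= P * wt k.
  have : kapsq R k <= P * wt k by rewrite kapsq_wt -/P; have := P0; nra.
  rewrite /kapsq => h [] ->; (split; first exact: normr_ge0).
    rewrite real_normK ?num_real //.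
    by have := sqr_ge0 (kap2 R k); move: h; lra.
  rewrite real_normK ?num_real //.
  by have := sqr_ge0 (kap1 R k); move: h; lra.
have W0 k (t : bool) : 0 <= wt k ^+ t by rewrite exprn_ge0.
have sqle (x y : R) : 0 <= x -> x <= y -> x ^+ 2 <= y ^+ 2 by move=> x0 xy; nra.
exists (1 + (c1 + c2 + c3 + c4)), q; split; first lra.
have cle k (t : bool) c : c <= 1 + (c1 + c2 + c3 + c4) ->
    c * wt k ^+ t <= (1 + (c1 + c2 + c3 + c4)) * wt k ^+ t.
  by move=> h; rewrite ler_wpM2r.
rewrite /admissible_weight /weight1 /weight2; split.
- by move=> k; have := X0 k; have := Y0 k; rewrite !mulNr => -> ->; rewrite ltW.
- move=> k; rewrite -mulNr; have /andP[hXk _] := hX k.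
  apply: (@le_trans _ _ (c1 * ((mX * wt k ^+ s) * (mb * wt k) * q k))).
    rewrite -I1 /c1; apply: eq_lew; field; by rewrite ?gt_eqF.
  apply: ler_pM => //; first by rewrite !mulr_ge0 // ?ltW.
    by rewrite -!addrA; have := addr_ge0 c20 (addr_ge0 c30 c40); lra.
  rewrite ler_wpM2r //; first exact: ltW.
  by apply: ler_pM => //; rewrite mulr_ge0 // ltW.
- move=> k; rewrite -mulNr; have /andP[hYk _] := hY k.
  apply: (@le_trans _ _ (c2 * ((mY * wt k ^+ s') * (md * wt k) * q k))).
    rewrite -I1' /c2; apply: eq_lew; field; by rewrite ?gt_eqF.
  apply: ler_pM => //; first by rewrite !mulr_ge0 // ?ltW.
    by have := addr_ge0 c10 (addr_ge0 c30 c40); lra.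
  rewrite ler_wpM2r //; first exact: ltW.
  by apply: ler_pM => //; rewrite mulr_ge0 // ltW.
- move=> k x /xP[x0 xx]; rewrite -mulNr; have /andP[_ hXk] := hX k.
  apply: le_trans (cle k _ c3 _); last by have := addr_ge0 c10 (addr_ge0 c20 c40); lra.
  rewrite -I2 /c3.
  have -> : (2 * `|lam| * (r2 + - c' * kapsq R k) * q k * x) ^+ 2 =
      4 * lam ^+ 2 * ((r2 + - c' * kapsq R k) * q k) ^+ 2 * x ^+ 2.
    by rewrite -[lam ^+ 2]real_normK ?num_real //; ring.
  have -> : 4 * lam ^+ 2 * MX ^+ 2 * P * (wt k ^+ (~~ (s && ~~ s')) * (wt k ^+ s * q k) ^+ 2 * wt k) =
     wt k ^+ (~~ (s && ~~ s')) * (4 * lam ^+ 2 * ((MX * wt k ^+ s) * q k) ^+ 2 * (P * wt k)).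
    by ring.
  rewrite ler_wpM2l //; apply: ler_pM => //; [nneg|nneg|].
  apply: ler_wpM2l; first by nneg.
  apply: sqle; first by rewrite mulr_ge0 // ltW.
  by rewrite ler_pM2r.
- move=> k x /xP[x0 xx]; rewrite -mulNr; have /andP[_ hYk] := hY k.
  apply: le_trans (cle k _ c4 _); last by have := addr_ge0 c10 (addr_ge0 c20 c30); lra.
  rewrite -I2' /c4.
  have -> : (`|lam| * (r1 + - a * kapsq R k) * q k * x) ^+ 2 =
      lam ^+ 2 * ((r1 + - a * kapsq R k) * q k) ^+ 2 * x ^+ 2.
    by rewrite -[lam ^+ 2]real_normK ?num_real //; ring.
  have -> : lam ^+ 2 * MY ^+ 2 * P * (wt k ^+ (~~ (s' && ~~ s)) * (wt k ^+ s' * q k) ^+ 2 * wt k) =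
     wt k ^+ (~~ (s' && ~~ s)) * (lam ^+ 2 * ((MY * wt k ^+ s') * q k) ^+ 2 * (P * wt k)).
    by ring.
  rewrite ler_wpM2l //; apply: ler_pM => //; [nneg|nneg|].
  apply: ler_wpM2l; first by nneg.
  apply: sqle; first by rewrite mulr_ge0 // ltW.
  by rewrite ler_pM2r.
Qed.

Lemma boussinesq_weight (a b c d gamma delta : R) :
  0 <= gamma < 1 -> 0 < delta -> admissible_case a b c d ->
  exists al be c0 q, [/\ 1 <= c0, ~~ (al && be), al -> 0 < d /\ coef_c gamma c < 0 &
    admissible_weight a b (coef_c gamma c) d (coef_r1 gamma delta) (coef_r2 gamma)
      (lambda gamma delta) al be c0 q].
Proof.
move=> /andP[g0 g1] d0 hcase.
have r10 : 0 < coef_r1 gamma delta by rewrite invr_gt0; lra.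
have r20 : 0 < coef_r2 gamma by rewrite /coef_r2; lra.
have cc : c = 0 -> coef_c gamma c == 0 by move=> ->; rewrite /coef_c mulr0.
have cn : c < 0 -> coef_c gamma c < 0 by move=> h; rewrite /coef_c pmulr_rlt0 //; lra.
have [s [s' [hb hd hs hs']]] : exists s s' : bool, [/\ 0 < b, 0 < d,
    (if s then coef_c gamma c < 0 else coef_c gamma c == 0) & (if s' then a < 0 else a == 0)].
  case: hcase => [[? ? -> /cc ?]|[? ? ? /cn ?]|[? ? -> /cn ?]|[? ? ? /cc ?]].
  - by exists false, false.
  - by exists true, true.
  - by exists true, false.
  - by exists false, true.
have [c0 [q [c01 H]]] := admissible_weight_exists (lambda gamma delta) hb hd r10 r20 hs hs'.
exists (s && ~~ s'), (s' && ~~ s), c0, q; split => //.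
- by case: (s) (s') => [] [].
- by move: hs => /[swap] /andP[-> _].
Qed.

End Weights.

(** * One-sided time derivatives and a Gronwall lemma *)

Section TimeDerivative.
Variables (R : realType) (T : R).
Implicit Types (f g : R -> R) (t s : R).

(* Differentiability relative to [0, T], hence one-sided at the end points. *)
Definition has_deriv f t l : Prop := forall e, 0 < e -> exists2 h, 0 < h &
  forall s, 0 <= s <= T -> `|s - t| < h -> `|f s - f t - (s - t) * l| <= e * `|s - t|.

Lemma has_derivD f g t l l' : has_deriv f t l -> has_deriv g t l' ->
  has_deriv (fun s => f s + g s) t (l + l').
Proof.
move=> df dg e e0; have e20 : 0 < e / 2 by rewrite divr_gt0.
have [h h0 Hf] := df _ e20; have [h' h'0 Hg] := dg _ e20.
exists (Num.min h h'); first by rewrite lt_min h0.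
move=> s sT; rewrite lt_min => /andP[/(Hf _ sT) h1 /(Hg _ sT) h2].
have -> : f s + g s - (f t + g t) - (s - t) * (l + l') =
  (f s - f t - (s - t) * l) + (g s - g t - (s - t) * l') by ring.
by apply: le_trans (ler_normD _ _) _; lra.
Qed.

Lemma has_deriv_cst c t : has_deriv (fun=> c) t 0.
Proof.
by move=> e e0; exists 1 => // s _ _; rewrite mulr0 subr0 subrr normr0 mulr_ge0 // ltW.
Qed.

Lemma has_derivZ f t l c : has_deriv f t l -> has_deriv (fun s => c * f s) t (c * l).
Proof.
move=> df e e0; have c0 : 0 < `|c| + 1 by rewrite ltr_pwDr.
have [h h0 H] := df _ (divr_gt0 e0 c0); exists h => // s sT /(H _ sT) h1.
have -> : c * f s - c * f t - (s - t) * (c * l) = c * (f s - f t - (s - t) * l) by ring.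
rewrite normrM; apply: le_trans (ler_wpM2l (normr_ge0 _) h1) _.
rewrite mulrA ler_wpM2r // mulrCA ler_piMr ?ltW //.
by rewrite ltr_pdivrMr // mul1r ltrDl.
Qed.

Lemma has_deriv_lipschitz f t l : has_deriv f t l -> exists2 h, 0 < h &
  forall s, 0 <= s <= T -> `|s - t| < h -> `|f s - f t| <= (`|l| + 1) * `|s - t|.
Proof.
move=> df; have [h h0 H] := df _ ltr01; exists h => // s sT /(H _ sT) h1.
have -> : f s - f t = (f s - f t - (s - t) * l) + (s - t) * l by ring.
apply: le_trans (ler_normD _ _) _; rewrite normrM; lra.
Qed.

Lemma has_deriv_cont f t l e : has_deriv f t l -> 0 < e -> exists2 h, 0 < h &
  forall s, 0 <= s <= T -> `|s - t| < h -> `|f s - f t| < e.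
Proof.
move=> /has_deriv_lipschitz[h h0 H] e0.
have l0 : 0 < `|l| + 1 by rewrite ltr_pwDr.
exists (Num.min h (e / (`|l| + 1))); first by rewrite lt_min h0 divr_gt0.
move=> s sT; rewrite lt_min => /andP[/(H _ sT) h1 h2].
by apply: le_lt_trans h1 _; rewrite mulrC -ltr_pdivlMr.
Qed.

Lemma has_deriv_sqr f t l : has_deriv f t l ->
  has_deriv (fun s => f s ^+ 2) t (2 * (f t * l)).
Proof.
move=> df e e0.
have c0 : 0 < 2 * `|f t| + 1 by rewrite ltr_pwDr // mulr_ge0.
have c20 : 0 < 2 * (2 * `|f t| + 1) by rewrite mulr_gt0.
have [h h0 H] := df _ (divr_gt0 e0 c20).
have [h' h'0 H'] := has_deriv_lipschitz df.
have l0 : 0 < (`|l| + 1) ^+ 2 by rewrite exprn_gt0 // ltr_pwDr.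
exists (Num.min h (Num.min h' (e / (2 * (`|l| + 1) ^+ 2)))).
  by rewrite !lt_min h0 h'0 divr_gt0 // mulr_gt0.
move=> s sT; rewrite !lt_min => /and3P[/(H _ sT) h1 /(H' _ sT) h2 h3].
have -> : f s ^+ 2 - f t ^+ 2 - (s - t) * (2 * (f t * l)) =
  (f s - f t) ^+ 2 + 2 * f t * (f s - f t - (s - t) * l) by ring.
apply: le_trans (ler_normD _ _) _.
rewrite (ger0_norm (sqr_ge0 _)) -(real_normK (num_real (f s - f t))).
have a1 : `|f s - f t| ^+ 2 <= e / 2 * `|s - t|.
  apply: (@le_trans _ _ (((`|l| + 1) * `|s - t|) ^+ 2)).
    by rewrite ler_pXn2r ?nnegrE // mulr_ge0 // addr_ge0.
  rewrite exprMn [X in _ * X]expr2 mulrA ler_wpM2r //.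
  rewrite mulrC -ler_pdivlMr //; apply/ltW; apply: lt_le_trans h3 _.
  by rewrite invfM mulrA.
have a2 : `|2 * f t * (f s - f t - (s - t) * l)| <= e / 2 * `|s - t|.
  rewrite normrM; apply: le_trans (ler_wpM2l (normr_ge0 _) h1) _.
  rewrite mulrA ler_wpM2r // normrM (ger0_norm (ler0n _ 2)) mulrCA ler_wpM2l ?(ltW e0) //.
  by rewrite invfM mulrCA ler_piMr ?invr_ge0 // ler_pdivrMr // mul1r; lra.
lra.
Qed.

Lemma has_deriv_sum (I : Type) (r : seq I) (f l : I -> R -> R) t :
  (forall i, has_deriv (f i) t (l i t)) ->
  has_deriv (fun s => \sum_(i <- r) f i s) t (\sum_(i <- r) l i t).
Proof.
move=> H; elim: r => [|x r IH].
  rewrite big_nil (_ : (fun s => _) = fun=> 0); first exact: has_deriv_cst.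
  by apply/funext => s; rewrite big_nil.
rewrite big_cons (_ : (fun s => _) = (fun s => f x s + \sum_(i <- r) f i s)).
  exact: has_derivD.
by apply/funext => s; rewrite big_cons.
Qed.

Hypothesis T0 : 0 < T.

(* Local boundedness on [0, T] is global; [Q s B] is to be read [F s <= B]. *)
Lemma locally_bounded (Q : R -> R -> Prop) :
  (forall s B B', B <= B' -> Q s B -> Q s B') ->
  (forall t, 0 <= t <= T -> exists2 h, 0 < h & exists B,
      forall s, 0 <= s <= T -> `|s - t| < h -> Q s B) ->
  exists B, forall s, 0 <= s <= T -> Q s B.
Proof.
move=> Qmono Qloc.
pose A := [set t | 0 <= t <= T /\ exists B, forall s, 0 <= s <= t -> Q s B].
have A0 : A 0.
  split; first by rewrite lexx ltW.
  have [|h h0 [B HB]] := Qloc 0; first by rewrite lexx ltW.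
  by exists B => s /le_anti <-; apply: HB; rewrite ?lexx ?ltW // subrr normr0.
have hsA : has_sup A by split; [exists 0|exists T => t [/andP[]]].
pose t0 := sup A.
have t00 : 0 <= t0 by apply: ub_le_sup => //; case: hsA.
have t0T : t0 <= T by apply: ge_sup; [exists 0|move=> t [/andP[]]].
have [|h h0 [B HB]] := Qloc t0; first by rewrite t00.
have [t [/andP[t1 t2] [B' HB']] lt] := sup_adherent h0 hsA.
have key : forall s, 0 <= s <= Num.min T (t0 + h / 2) -> Q s (Num.max B B').
  move=> s; rewrite le_min => /and3P[s0 sT sh].
  have [st|ts] := leP s t.
    by apply: Qmono (HB' s _); rewrite ?le_max ?lexx ?orbT // s0.
  apply: Qmono (HB s _ _); rewrite ?le_max ?lexx // ?s0 //.
  have : t0 - h < t by []. rewrite ltr_norml; lra.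
have At : A (Num.min T (t0 + h / 2)).
  split; last by exists (Num.max B B').
  by rewrite ge_min lexx /= andbT le_min (ltW T0) /= addr_ge0 // divr_ge0 // ltW.
have : Num.min T (t0 + h / 2) <= t0 by apply: ub_le_sup => //; case: hsA.
rewrite ge_min => /orP[Tt|]; last by lra.
exists (Num.max B B') => s /andP[s0 sT]; apply: key.
by rewrite s0 le_min sT /=; lra.
Qed.

Lemma has_deriv_bounded f (l : R -> R) :
  (forall t, 0 <= t <= T -> has_deriv f t (l t)) ->
  exists B, forall s, 0 <= s <= T -> `|f s| <= B.
Proof.
move=> df; apply: (@locally_bounded (fun s B => `|f s| <= B)).
  by move=> s B B' BB' h; apply: le_trans BB'.
move=> t tT; have [h h0 H] := has_deriv_cont (df t tT) ltr01.
exists h => //; exists (`|f t| + 1) => s sT /(H s sT).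
by have := ler_normD (f t) (f s - f t); rewrite subrKC; lra.
Qed.

(* Gronwall with a continuity argument: the growth rate is only controlled as
   long as [F] stays below [delta], which the barrier [y] guarantees. *)
Lemma gronwall_barrier (F F' : R -> R) (K y0 delta : R) :
  0 <= K -> 0 < y0 ->
  (forall t, 0 <= t <= T -> has_deriv F t (F' t)) ->
  F 0 < y0 -> y0 * expR ((K + 1) * T) <= delta ->
  (forall t, 0 <= t <= T -> F t <= delta -> F' t <= K * F t) ->
  forall t, 0 <= t <= T -> F t <= y0 * expR ((K + 1) * T).
Proof.
move=> K0 y00 dF F0 yd HF.
(* The barrier grows at the rate [K + 1], strictly faster than the rate [K] allowed to [F]. *)
pose y t := y0 * expR ((K + 1) * t).
have K10 : 0 < K + 1 by lra.
have ymono s t : s <= t -> y s <= y t.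
  by move=> st; rewrite ler_pM2l // ler_expR ler_pM2l.
have ypos t : 0 < y t by rewrite mulr_gt0 // expR_gt0.
suff H t : 0 <= t <= T -> F t < y t.
  by move=> t tT; apply: le_trans (ltW (H t tT)) (ymono _ _ _); case/andP: tT.
move=> tT; rewrite ltNge; apply/negP => yF.
pose A := [set t | 0 <= t <= T /\ y t <= F t].
have At : A t by [].
have hiA : has_inf A by split; [exists t|exists 0 => s [/andP[]]].
pose t0 := inf A.
have lb s : A s -> t0 <= s by apply: ge_inf; case: hiA.
have t00 : 0 <= t0 by apply: lb_le_inf; [exists t|move=> s [/andP[]]].
have t0T : t0 <= T by apply: le_trans (lb _ At) _; case/andP: tT.
have t0in : 0 <= t0 <= T by rewrite t00.
have before s : 0 <= s -> s < t0 -> F s < y s.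
  move=> s0 st; rewrite ltNge; apply/negP => yFs.
  have : A s by split => //; rewrite s0 (ltW (lt_le_trans st t0T)).
  by move/lb; rewrite leNgt st.
have At0 : y t0 <= F t0.
  rewrite leNgt; apply/negP => lt.
  have [|h h0 H] := has_deriv_cont (dF t0 t0in) (e := y t0 - F t0); first by lra.
  have [s [sT yFs] sh] := inf_adherent h0 hiA.
  have ts := lb s (conj sT yFs).
  have : `|s - t0| < h by rewrite ger0_norm; move: sh; rewrite -/t0; lra.
  move/(H s sT); rewrite ltr_norml => /andP[_].
  by have := ymono _ _ ts; lra.
have t0pos : 0 < t0.
  rewrite lt_neqAle t00 andbT; apply/eqP => e.
  by move: At0; rewrite -e /y mulr0 expR0 mulr1; lra.
have Ft0 : F t0 <= y t0.
  rewrite leNgt; apply/negP => lt.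
  have [|h h0 H] := has_deriv_cont (dF t0 t0in) (e := F t0 - y t0); first by lra.
  pose s := Num.max 0 (t0 - h / 2).
  have s0 : 0 <= s by rewrite le_max lexx.
  have st : s < t0 by rewrite gt_max t0pos /=; lra.
  have hs : t0 - h / 2 <= s by rewrite le_max lexx orbT.
  have sT : 0 <= s <= T by rewrite s0 (ltW (lt_le_trans st t0T)).
  have : `|s - t0| < h by rewrite ltr_norml; lra.
  move/(H s sT); rewrite ltr_norml => /andP[+ _].
  by have := before s s0 st; have := ymono _ _ (ltW st); lra.
have eqF : F t0 = y t0 by apply/le_anti/andP.
have F't : F' t0 <= K * y t0.
  by rewrite -eqF; apply: HF => //; rewrite eqF; apply: le_trans (ymono _ _ t0T) yd.
have [|h h0 H] := dF t0 t0in (y t0 / 4); first by rewrite divr_gt0.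
(* A step back from the first contact [t0]. There [F] is below the barrier, so up to [t0] it gains
   more than [y] does. With the tolerance 1/4 above and [eta <= 1 / (2 (K + 1)^2)] this gives 3/4
   eta <= p^2 <= eta / 2 for p = (K + 1) eta, a contradiction. *)
pose eta := Num.min (Num.min (h / 2) t0) ((2 * (K + 1) ^+ 2)^-1).
have eta0 : 0 < eta.
  by rewrite !lt_min divr_gt0 //= t0pos invr_gt0 mulr_gt0 // exprn_gt0.
have e1 : eta <= h / 2 by rewrite !ge_min lexx.
have e2 : eta <= t0 by rewrite !ge_min lexx orbT.
have e3 : eta * (2 * (K + 1) ^+ 2) <= 1.
  by rewrite -ler_pdivlMr ?mul1r ?ge_min ?lexx ?orbT // mulr_gt0 // exprn_gt0.
pose s := t0 - eta.
have s0 : 0 <= s by rewrite subr_ge0.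
have st : s < t0 by rewrite gtrBl.
have sT : 0 <= s <= T by rewrite s0 (ltW (lt_le_trans st t0T)).
have dist : s - t0 = - eta by rewrite /s; ring.
have : `|s - t0| < h by rewrite dist normrN gtr0_norm //; lra.
move/(H s sT); rewrite dist normrN (gtr0_norm eta0) ler_norml => /andP[h1 _].
have h2 : F s < y s := before s s0 st.
have h3 : y s * (1 + (K + 1) * eta) <= y t0.
  have -> : y t0 = y s * expR ((K + 1) * eta).
    by rewrite /y -mulrA -expRD /s; congr (_ * expR _); ring.
  by rewrite ler_pM2l // expR_ge1Dx.
have yt := ypos t0; have ys := ypos s.
have h4 : y t0 - y s <= eta * ((K + 1 / 4) * y t0).
  have : y t0 - F s <= eta * F' t0 + y t0 / 4 * eta by move: h1; rewrite eqF; lra.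
  have : eta * F' t0 <= eta * (K * y t0) by rewrite ler_pM2l.
  lra.
pose p := (K + 1) * eta.
have p0 : 0 < p by rewrite mulr_gt0.
have pK : p * (K + 1) <= 1 / 2.
  have -> : p * (K + 1) = eta * (2 * (K + 1) ^+ 2) / 2 by rewrite /p; field.
  lra.
have h5 : y t0 - y s <= (p - 3 / 4 * eta) * y t0.
  by apply: le_trans h4 _; rewrite /p; apply: eq_lew; field.
have h6 : (1 - p + 3 / 4 * eta) * (1 + p) <= 1.
  rewrite -(ler_pM2r yt) mul1r; apply: le_trans h3.
  by rewrite mulrAC ler_pM2r; [move: h5; lra|lra].
have h7 : p ^+ 2 <= eta / 2.
  have -> : p ^+ 2 = eta * (p * (K + 1)) by rewrite /p; ring.
  by rewrite ler_pM2l //; lra.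
nra.
Qed.

End TimeDerivative.

(** * Square integrable functions on the unit square *)

Section SquareIntegrable.
Variable R : realType.
Local Notation PT := (measurableTypeR R * measurableTypeR R)%type.
Local Notation mu := (lebesgue2 R).
Local Notation Om := (@Omega R).
Implicit Types (u v f g : R * R -> R).

Lemma measurable_Omega : measurable (Om : set PT).
Proof. by apply: measurableX; exact: measurable_itv. Qed.

Lemma lebesgue2_setX (A B : set (measurableTypeR R)) : measurable A -> measurable B ->
  mu (A `*` B) = (lebesgue_measure A * lebesgue_measure B)%E.
Proof. by move=> mA mB; exact: product_measure1E. Qed.

Lemma lebesgue2_Omega : mu Om = 1%E.
Proof.
rewrite lebesgue2_setX; [|exact: measurable_itv..].
by rewrite lebesgue_measure_itv /= lte_fin ltr01 oppr0 adde0 mule1.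
Qed.

Definition measurable2 u := measurable_fun [set: PT] u.
Definition intg u := mu.-integrable Om (EFin \o u).
Definition L2 u := measurable2 u /\ intg (fun p => u p ^+ 2).

Lemma measurable2_Omega u : measurable2 u -> measurable_fun (Om : set PT) u.
Proof. by move=> mu_; apply: measurable_funTS. Qed.

Lemma measurable2M u v : measurable2 u -> measurable2 v -> measurable2 (fun p => u p * v p).
Proof. by move=> hu hv; apply: measurable_funM. Qed.

Lemma measurable2D u v : measurable2 u -> measurable2 v -> measurable2 (fun p => u p + v p).
Proof. by move=> hu hv; apply: measurable_funD. Qed.

Lemma measurable2_cst c : measurable2 (fun=> c).
Proof. exact: measurable_cst. Qed.

Lemma measurable2Z c u : measurable2 u -> measurable2 (fun p => c * u p).
Proof. by move=> hu; apply: measurable2M => //; exact: measurable2_cst. Qed.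

Lemma measurable2_sqr u : measurable2 u -> measurable2 (fun p => u p ^+ 2).
Proof. by move=> hu; exact: measurable_funX. Qed.

Lemma intg_le f g : measurable2 f -> (forall p, `|f p| <= g p) -> intg g -> intg f.
Proof.
move=> mf fg; apply: le_integrable; first exact: measurable_Omega.
  by apply/measurable_EFinP; exact: measurable2_Omega.
by move=> p _ /=; rewrite lee_fin (le_trans (fg p)) // ler_norm.
Qed.

Lemma intg_cst c : intg (fun=> c).
Proof.
apply/integrableP; split; first exact: measurable_cst.
rewrite integral_cst; last exact: measurable_Omega.
by rewrite -/(mu Om) lebesgue2_Omega mule1 ltry.
Qed.

Lemma intgD f g : intg f -> intg g -> intg (fun p => f p + g p).
Proof. by move=> hf hg; have := integrableD measurable_Omega hf hg. Qed.

Lemma intgZ c f : intg f -> intg (fun p => c * f p).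
Proof. by move=> hf; have := integrableZl measurable_Omega c hf. Qed.

Lemma IO_D f g : intg f -> intg g ->
  integralO (fun p => f p + g p) = integralO f + integralO g.
Proof. by move=> hf hg; rewrite /integralO RintegralD //; exact: measurable_Omega. Qed.

Lemma IO_Z c f : intg f -> integralO (fun p => c * f p) = c * integralO f.
Proof. by move=> hf; rewrite /integralO RintegralZl //; exact: measurable_Omega. Qed.

Lemma IO_ge0 f : (forall p, 0 <= f p) -> 0 <= integralO f.
Proof. by move=> f0; apply: Rintegral_ge0. Qed.

Lemma IO_le f g : intg f -> intg g -> (forall p, Om p -> f p <= g p) -> integralO f <= integralO g.
Proof. by move=> hf hg fg; apply: le_Rintegral => //; exact: measurable_Omega. Qed.

Lemma eq_IO f g : (forall p, Om p -> f p = g p) -> integralO f = integralO g.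
Proof. by move=> fg; apply: eq_Rintegral => p; rewrite inE => /fg. Qed.

Lemma IO_cst c : integralO (fun _ : R * R => c) = c.
Proof.
rewrite /integralO Rintegral_cst; last exact: measurable_Omega.
by rewrite -/(mu Om) lebesgue2_Omega mulr1.
Qed.

Lemma IO_sum (I : eqType) (s : seq I) (f : I -> R * R -> R) :
  (forall i, i \in s -> intg (f i)) ->
  intg (fun p => \sum_(i <- s) f i p) /\
  integralO (fun p => \sum_(i <- s) f i p) = \sum_(i <- s) integralO (f i).
Proof.
elim: s => [|x s IH] H.
  rewrite big_nil (_ : (fun p => _) = fun=> 0); last by apply/funext => p; rewrite big_nil.
  by rewrite IO_cst; split => //; exact: intg_cst.
have [|h1 h2] := IH; first by move=> i hi; apply: H; rewrite in_cons hi orbT.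
have hx := H x (mem_head _ _).
rewrite big_cons (_ : (fun p => _) = (fun p => f x p + \sum_(i <- s) f i p)).
  by rewrite IO_D // h2; split => //; exact: intgD.
by apply/funext => p; rewrite big_cons.
Qed.

Lemma intg_mul u v : L2 u -> L2 v -> intg (fun p => u p * v p).
Proof.
move=> [mu_ iu] [mv iv]; apply: intg_le (intgD iu iv); first exact: measurable2M.
move=> p; rewrite ler_norml; have := sqr_ge0 (u p + v p); have := sqr_ge0 (u p - v p).
by have := sqr_ge0 (u p); have := sqr_ge0 (v p); nra.
Qed.

Lemma L2_bounded f B : measurable2 f -> (forall p, `|f p| <= B) -> L2 f.
Proof.
move=> mf fB; split => //; apply: intg_le (intg_cst (B ^+ 2)); first exact: measurable2_sqr.
move=> p; rewrite normrX ler_pXn2r ?nnegrE //; exact: le_trans (fB p).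
Qed.

Lemma L2_cst c : L2 (fun=> c).
Proof. by apply: (@L2_bounded _ `|c|) => //; exact: measurable2_cst. Qed.

Lemma intg_L2 u : L2 u -> intg u.
Proof.
move=> hu; have := intg_mul hu (L2_cst 1); congr intg.
by apply/funext => p; rewrite mulr1.
Qed.

Lemma L2_Z c u : L2 u -> L2 (fun p => c * u p).
Proof.
move=> [mu_ iu]; split; first exact: measurable2Z.
by under eq_fun do rewrite exprMn; exact: intgZ.
Qed.

Lemma L2_D u v : L2 u -> L2 v -> L2 (fun p => u p + v p).
Proof.
move=> hu hv; have [mu_ iu] := hu; have [mv iv] := hv.
split; first exact: measurable2D.
rewrite (_ : (fun p => _) = (fun p => u p ^+ 2 + 2 * (u p * v p) + v p ^+ 2)).
  by apply: intgD => //; apply: intgD => //; apply: intgZ; exact: intg_mul.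
by apply/funext => p; ring.
Qed.

Lemma L2_B u v : L2 u -> L2 v -> L2 (fun p => u p - v p).
Proof.
move=> hu hv; have := L2_D hu (L2_Z (-1) hv); congr L2.
by apply/funext => p; rewrite mulN1r.
Qed.

Lemma L2_sum (I : Type) (s : seq I) (f : I -> R * R -> R) :
  (forall i, L2 (f i)) -> L2 (fun p => \sum_(i <- s) f i p).
Proof.
move=> H; elim: s => [|x s IH].
  by under eq_fun do rewrite big_nil; exact: L2_cst.
by under eq_fun do rewrite big_cons; exact: L2_D.
Qed.

Lemma L2_mul_bounded f u B : measurable2 f -> (forall p, `|f p| <= B) -> L2 u ->
  L2 (fun p => f p * u p).
Proof.
move=> mf fB [mu_ iu]; split; first exact: measurable2M.
apply: intg_le (intgZ (B ^+ 2) iu); first by apply: measurable2_sqr; exact: measurable2M.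
move=> p; rewrite exprMn normrM (ger0_norm (sqr_ge0 (u p))) ler_wpM2r ?sqr_ge0 //.
by rewrite normrX ler_pXn2r ?nnegrE //; exact: le_trans (fB p).
Qed.

Lemma IO_cauchy_schwarz u v : L2 u -> L2 v ->
  integralO (fun p => u p * v p) ^+ 2 <=
  integralO (fun p => u p ^+ 2) * integralO (fun p => v p ^+ 2).
Proof.
move=> hu hv; have [_ iu] := hu; have [_ iv] := hv; have iuv := intg_mul hu hv.
set a := integralO (fun p => u p ^+ 2); set b := integralO (fun p => v p ^+ 2).
set c := integralO _.
have a0 : 0 <= a by apply: IO_ge0 => p; exact: sqr_ge0.
have b0 : 0 <= b by apply: IO_ge0 => p; exact: sqr_ge0.
have key x y : 0 <= x ^+ 2 * a + 2 * x * y * c + y ^+ 2 * b.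
  have -> : x ^+ 2 * a + 2 * x * y * c + y ^+ 2 * b =
      integralO (fun p => (x * u p + y * v p) ^+ 2).
    have -> : integralO (fun p => (x * u p + y * v p) ^+ 2) = integralO (fun p =>
        x ^+ 2 * u p ^+ 2 + (2 * x * y * (u p * v p) + y ^+ 2 * v p ^+ 2)).
      by apply: eq_IO => p _; ring.
    rewrite IO_D; [|exact: intgZ|by apply: intgD; exact: intgZ].
    rewrite IO_D; [|exact: intgZ..].
    by rewrite !IO_Z // addrA.
  by apply: IO_ge0 => p; exact: sqr_ge0.
(* If [b = 0] the form is affine in [y], and the choice below makes its value [- c ^+ 2]; otherwise
   the usual minimizer, cleared of denominators, is inserted. *)
have [b00|bn] := eqVneq b 0.
  rewrite b00 mulr0; have := key c (- (a + 1) / 2); rewrite b00 mulr0 addr0.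
  by have -> : c ^+ 2 * a + 2 * c * (- (a + 1) / 2) * c = - c ^+ 2; [field|rewrite oppr_ge0].
have bpos : 0 < b by rewrite lt_neqAle eq_sym bn.
have : 0 <= b * (a * b - c ^+ 2) by have := key b (- c); congr (0 <= _); ring.
by rewrite pmulr_rge0 // subr_ge0.
Qed.

Lemma IO_sqr_sum_le u v : L2 u -> L2 v ->
  integralO (fun p => (u p + v p) ^+ 2) <=
  2 * integralO (fun p => u p ^+ 2) + 2 * integralO (fun p => v p ^+ 2).
Proof.
move=> hu hv; have [_ iu] := hu; have [_ iv] := hv.
have [_ iuv] := L2_D hu hv.
rewrite -(IO_Z 2 iu) -(IO_Z 2 iv) -IO_D; [|exact: intgZ..].
apply: IO_le => //; first by apply: intgD; exact: intgZ.
by move=> p _; have := sqr_ge0 (u p - v p); nra.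
Qed.

Lemma EFin_IO f : intg f -> (integralO f)%:E = (\int[mu]_(p in Om) (f p)%:E)%E.
Proof.
by move=> hf; rewrite /integralO /Rintegral fineK //; apply: integrable_fin_num => //; exact: measurable_Omega.
Qed.

Lemma l2norm_poweR u : measurable2 u ->
  l2norm u = ((\int[mu]_(p in Om) (u p ^+ 2)%:E) `^ (2^-1))%E.
Proof.
move=> mu_; rewrite /l2norm unlock /=; congr (_ `^ _)%E.
rewrite [RHS]integral_mkcond; apply: eq_integral => p _ /=.
(* Off the square the restriction takes the default value [point], which is 0 in [R], and so is its
   power. *)
rewrite /patch; case: ifP => _ /=.
  by rewrite powR_mulrn ?normr_ge0 // real_normK // num_real.
by rewrite (_ : (point : R) = 0) // normr0 powR0.
Qed.

Lemma L2_l2norm u : L2 u -> l2norm u = (Num.sqrt (integralO (fun p => u p ^+ 2)))%:E.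
Proof.
move=> [mu_ iu]; rewrite l2norm_poweR // -EFin_IO // poweR_EFin powR12_sqrt //.
by apply: IO_ge0 => p; exact: sqr_ge0.
Qed.

(** The square root of an infinite integral is infinite, so a finite norm forces integrability of
    the square. *)
Lemma l2norm_L2 u : measurable2 u -> (l2norm u < +oo)%E -> L2 u.
Proof.
move=> mu_; rewrite l2norm_poweR // => h; split => //.
apply/integrableP; split.
  by apply/measurable_EFinP; apply: measurable2_Omega; exact: measurable2_sqr.
have -> : (\int[mu]_(p in Om) `|(EFin \o (fun p => (u p ^+ 2)%R)) p| =
    \int[mu]_(p in Om) (u p ^+ 2)%:E)%E.
  by apply: eq_integral => p _ /=; rewrite ger0_norm ?sqr_ge0.
have I0 : (0 <= \int[mu]_(p in Om) (u p ^+ 2)%:E)%E.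
  by apply: integral_ge0 => p _; rewrite lee_fin sqr_ge0.
move: h I0; set I := integral _ _ _; case: I => [r _ _|+ _|//]; first exact: ltry.
by rewrite poweRyr // gt_eqF ?invr_gt0.
Qed.

End SquareIntegrable.

(** * Trigonometric polynomials *)

Section TrigonometricPolynomials.
Variable R : realType.
Implicit Types (k m : int * int) (u v t : R * R -> R) (p : R * R).
Local Notation C := (real_complex R).

Definition phase k p : R := 2 * pi * (k.1%:~R * p.1 + k.2%:~R * p.2).

Lemma expmodeE k p : expmode k p = Complex (cos (phase k p)) (sin (phase k p)) :> R[i].
Proof. by []. Qed.

Lemma phaseD k m p : phase (k + m) p = phase k p + phase m p.
Proof. by rewrite /phase /= !intrD; ring. Qed.

Lemma phaseN k p : phase (- k) p = - phase k p.
Proof. by rewrite /phase /= !mulrNz; ring. Qed.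

Lemma expmodeD k m p : expmode (k + m) p = expmode k p * expmode m p :> R[i].
Proof.
rewrite !expmodeE phaseD cosD sinD; apply/eqP; rewrite eq_complex /=.
by apply/andP; split; apply/eqP; ring.
Qed.

Lemma expmode0 p : expmode (0 : int * int) p = 1 :> R[i].
Proof. by rewrite expmodeE /phase /= !mul0r addr0 mulr0 cos0 sin0. Qed.

Lemma expmodeN k p : expmode (- k) p = conjc (expmode k p) :> R[i].
Proof. by rewrite !expmodeE phaseN cosN sinN. Qed.

Definition trigpoly (f : R * R -> R[i]) : Prop :=
  exists N c, forall p, f p = \sum_(k <- box N) c k * expmode k p.

Lemma trig_sum_extend N M (c : int * int -> R[i]) p : (N <= M)%N ->
  \sum_(k <- box N) c k * expmode k p =
  \sum_(k <- box M) (if k \in box N then c k else 0) * expmode k p.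
Proof.
move=> NM.
transitivity (\sum_(k <- box M | k \in box N) c k * expmode k p).
  rewrite -[RHS]big_filter; apply: perm_big; apply: uniq_perm; rewrite ?filter_uniq ?box_uniq //.
  by move=> k; rewrite mem_filter; case: (boolP (k \in box N)) => //= /(box_sub NM).
by rewrite big_mkcond /=; apply: eq_bigr => k _; case: ifP => // _; rewrite mul0r.
Qed.

Lemma trigpoly_expmode k : trigpoly (expmode k).
Proof.
exists (maxn `|k.1| `|k.2|), (fun m => if m == k then 1 else 0) => p.
rewrite (bigD1_seq k) ?box_uniq //=; last by rewrite mem_box !leq_max !leqnn orbT.
rewrite eqxx mul1r big1 ?addr0 // => m /negPf ->.
by rewrite mul0r.
Qed.

Lemma trigpolyZ a f : trigpoly f -> trigpoly (fun p => a * f p).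
Proof.
move=> [N [c H]]; exists N, (fun k => a * c k) => p.
by rewrite H mulr_sumr; apply: eq_bigr => k _; rewrite mulrA.
Qed.

Lemma trigpolyD f g : trigpoly f -> trigpoly g -> trigpoly (fun p => f p + g p).
Proof.
move=> [N [c H]] [M [d H']]; exists (maxn N M),
  (fun k => (if k \in box N then c k else 0) + (if k \in box M then d k else 0)) => p.
rewrite H H' (trig_sum_extend _ _ (leq_maxl N M)) (trig_sum_extend _ _ (leq_maxr N M)).
by rewrite -big_split /=; apply: eq_bigr => k _; rewrite mulrDl.
Qed.

Lemma trigpoly_sum (I : Type) (s : seq I) (F : I -> R * R -> R[i]) :
  (forall i, trigpoly (F i)) -> trigpoly (fun p => \sum_(i <- s) F i p).
Proof.
move=> H; elim: s => [|x s IH].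
  exists 0%N, (fun=> 0) => p; rewrite big_nil big1 // => k _; exact: mul0r.
by under eq_fun do rewrite big_cons; exact: trigpolyD.
Qed.

Lemma trigpolyM f g : trigpoly f -> trigpoly g -> trigpoly (fun p => f p * g p).
Proof.
move=> [N [c H]] [M [d H']].
have -> : (fun p => f p * g p) = (fun p => \sum_(k <- box N) \sum_(m <- box M)
   (c k * d m) * expmode (k + m) p).
  apply/funext => p; rewrite H H' mulr_suml; apply: eq_bigr => k _.
  by rewrite mulr_sumr; apply: eq_bigr => m _; rewrite expmodeD; ring.
by do 2 (apply: trigpoly_sum => ?); apply: trigpolyZ; exact: trigpoly_expmode.
Qed.

Definition real_trig t := trigpoly (of_real t).

Lemma real_trig_cst a : real_trig (fun=> a).
Proof.
have := trigpolyZ (C a) (trigpoly_expmode 0); congr trigpoly.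
by apply/funext => p; rewrite expmode0 mulr1.
Qed.

Lemma real_trigD t v : real_trig t -> real_trig v -> real_trig (fun p => t p + v p).
Proof.
move=> ht hv; have := trigpolyD ht hv; congr trigpoly.
by apply/funext => p; rewrite /of_real rmorphD.
Qed.

Lemma real_trigM t v : real_trig t -> real_trig v -> real_trig (fun p => t p * v p).
Proof.
move=> ht hv; have := trigpolyM ht hv; congr trigpoly.
by apply/funext => p; rewrite /of_real rmorphM.
Qed.

Lemma real_trigX t n : real_trig t -> real_trig (fun p => t p ^+ n).
Proof.
move=> ht; elim: n => [|n IH]; first by under eq_fun do rewrite expr0; exact: real_trig_cst.
by under eq_fun do rewrite exprS; exact: real_trigM.
Qed.

Lemma real_trig_cos k : real_trig (fun p => cos (phase k p)).
Proof.
have := trigpolyD (trigpolyZ (C 2^-1) (trigpoly_expmode k)) (trigpolyZ (C 2^-1) (trigpoly_expmode (- k))).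
congr trigpoly; apply/funext => p; rewrite expmodeN expmodeE /of_real.
by apply/eqP; rewrite eq_complex /=; apply/andP; split; apply/eqP; field.
Qed.

Lemma real_trig_sin k : real_trig (fun p => sin (phase k p)).
Proof.
have := trigpolyD (trigpolyZ (Complex 0 (- 2^-1)) (trigpoly_expmode k))
  (trigpolyZ (Complex 0 2^-1) (trigpoly_expmode (- k))).
congr trigpoly; apply/funext => p; rewrite expmodeN expmodeE /of_real.
by apply/eqP; rewrite eq_complex /=; apply/andP; split; apply/eqP; field.
Qed.

Lemma measurable2_phase k : measurable2 (phase k).
Proof.
apply: measurable2Z; apply: measurable2D; apply: measurable2Z.
  exact: measurable_fst.
exact: measurable_snd.
Qed.

Lemma measurable2_cos k : measurable2 (fun p => cos (phase k p)).
Proof.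
apply: (measurableT_comp (f := @cos R)); last exact: measurable2_phase.
by apply: continuous_measurable_fun; exact: continuous_cos.
Qed.

Lemma measurable2_sin k : measurable2 (fun p => sin (phase k p)).
Proof.
apply: (measurableT_comp (f := @sin R)); last exact: measurable2_phase.
by apply: continuous_measurable_fun; exact: continuous_sin.
Qed.

Lemma cos_bound (x : R) : `|cos x| <= 1.
Proof. by rewrite ler_norml cos_geN1 cos_le1. Qed.

Lemma sin_bound (x : R) : `|sin x| <= 1.
Proof. by rewrite ler_norml sin_geN1 sin_le1. Qed.

Lemma L2_cos k : L2 (fun p : R * R => cos (phase k p)).
Proof. by apply: (@L2_bounded _ _ 1); [exact: measurable2_cos|move=> p; exact: cos_bound]. Qed.

Lemma L2_sin k : L2 (fun p : R * R => sin (phase k p)).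
Proof. by apply: (@L2_bounded _ _ 1); [exact: measurable2_sin|move=> p; exact: sin_bound]. Qed.

Lemma Re_sum (I : Type) (s : seq I) (F : I -> R[i]) :
  complex.Re (\sum_(i <- s) F i) = \sum_(i <- s) complex.Re (F i).
Proof. by elim: s => [|x s IH]; rewrite ?big_nil ?big_cons ?ReD ?IH. Qed.

Lemma Im_sum (I : Type) (s : seq I) (F : I -> R[i]) :
  complex.Im (\sum_(i <- s) F i) = \sum_(i <- s) complex.Im (F i).
Proof. by elim: s => [|x s IH]; rewrite ?big_nil ?big_cons ?ImD ?IH. Qed.

Lemma real_trig_L2 t : real_trig t -> L2 t.
Proof.
move=> [N [c H]].
have -> : t = (fun p => \sum_(k <- box N) (complex.Re (c k) * cos (phase k p)
    + (- complex.Im (c k)) * sin (phase k p))).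
  apply/funext => p; rewrite -[LHS]/(complex.Re (of_real t p)) H Re_sum.
  by apply: eq_bigr => k _; rewrite expmodeE; case: (c k) => a b /=; rewrite mulNr.
by apply: L2_sum => k; apply: L2_D; apply: L2_Z; [exact: L2_cos|exact: L2_sin].
Qed.

End TrigonometricPolynomials.

(** * Approximation of step functions by trigonometric polynomials *)

Section StepApproximation.
Variable R : realType.

(* Polynomials in [s] converging on [0, 1] to the indicator of [s < 1/2]. *)
Definition step_poly (n : nat) (s : R) : R := (1 - s ^+ n) ^+ (2 ^ n).

Lemma bernoulli_sub (x : R) m : 0 <= x <= 1 -> 1 - m%:R * x <= (1 - x) ^+ m.
Proof.
move=> /andP[x0 x1]; elim: m => [|m IH]; first by rewrite mul0r subr0 expr0.
rewrite exprS -natr1; apply: le_trans (ler_wpM2l _ IH); last by lra.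
have : 0 <= (m%:R : R) by []. nra.
Qed.

Lemma bernoulli_inv (x : R) m : 0 <= x <= 1 -> (1 - x) ^+ m * (1 + m%:R * x) <= 1.
Proof.
move=> /andP[x0 x1]; elim: m => [|m IH]; first by rewrite expr0 mul0r addr0 mulr1.
apply: le_trans IH; rewrite exprSr -mulrA ler_wpM2l ?exprn_ge0 //; first by lra.
by rewrite -natr1; have : 0 <= (m%:R : R) by []; nra.
Qed.

Lemma step_poly_itv n s : 0 <= s <= 1 -> 0 <= step_poly n s <= 1.
Proof.
move=> /andP[s0 s1]; have h : 0 <= s ^+ n <= 1 by rewrite exprn_ge0 // exprn_ile1.
by rewrite exprn_ge0 ?exprn_ile1 //; lra.
Qed.

(** The outer exponent [2 ^ n] places the threshold at 1/2: Bernoulli's inequality turns it into the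
    lower bound 1 - (2s)^n. Above the threshold the companion inequality gives the upper bound
    (2s)^(-n). *)
Lemma step_poly_lt s : 0 <= s -> s < 1 / 2 -> step_poly n s @[n --> \oo] --> (1 : R).
Proof.
move=> s0 s2.
have s01 : 0 <= s <= 1 by rewrite s0; lra.
apply: (@squeeze_cvgr _ _ _ _ (fun n => 1 - (2 * s) ^+ n) (fun=> 1)).
- near=> n; have /andP[_ ->] := step_poly_itv n s01; rewrite andbT.
  apply: le_trans (bernoulli_sub (2 ^ n) _); last by rewrite exprn_ge0 // exprn_ile1 //; case/andP: s01.
  by rewrite natrX exprMn.
- rewrite -[X in _ --> X]subr0; apply: cvgB; first exact: cvg_cst.
  by apply: cvg_expr; rewrite ger0_norm; lra.
- exact: cvg_cst.
Unshelve. all: end_near. Qed.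

Lemma step_poly_gt s : 1 / 2 < s -> s <= 1 -> step_poly n s @[n --> \oo] --> (0 : R).
Proof.
move=> s2 s1.
have s01 : 0 <= s <= 1 by rewrite s1; lra.
have s20 : 0 < 2 * s by lra.
apply: (@squeeze_cvgr _ _ _ _ (fun=> 0) (fun n => ((2 * s)^-1) ^+ n)).
- near=> n; have /andP[-> _] := step_poly_itv n s01 => /=.
  rewrite exprVn -[leRHS]mul1r ler_pdivlMr ?exprn_gt0 //.
  have h : 0 <= s ^+ n <= 1 by rewrite exprn_ge0 ?exprn_ile1 //; case/andP: s01.
  apply: le_trans (bernoulli_inv (2 ^ n) h).
  rewrite ler_wpM2l //; first by have /andP[] := step_poly_itv n s01.
  by rewrite natrX -exprMn lerDr.
- exact: cvg_cst.
- by apply: cvg_expr; rewrite ger0_norm ?invr_ge0 ?invf_lt1 //; lra.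
Unshelve. all: end_near. Qed.

(** [2 * pi * x - pi * a] is the angle measured from the midpoint of the arc over (0, a), so its
    cosine exceeds [cos (pi * a)] exactly inside this arc. *)
Lemma cos_sign (a x : R) : 0 < a -> a <= 1 -> 0 < x < 1 -> x != a ->
  if x < a then cos (pi * a) < cos (2 * pi * x - pi * a)
  else cos (2 * pi * x - pi * a) < cos (pi * a).
Proof.
move=> a0 a1 /andP[x0 x1] xa.
have pi0 := pi_gt0 R.
have lt_cos (y z : R) : 0 <= y -> y < z -> z <= pi -> cos z < cos y.
  move=> y0 yz zp; have yp : y <= pi by lra.
  by rewrite ltr_cos // in_itv /= ?y0 ?yp // zp andbT; lra.
have pap : pi * a <= pi by rewrite ler_piMr // ltW.
have pa0 : 0 < pi * a by rewrite mulr_gt0.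
have px0 : 0 < pi * x by rewrite mulr_gt0.
have px1 : pi * x < pi by rewrite gtr_pMr.
have -> : 2 * pi * x = 2 * (pi * x) by rewrite mulrA.
have lt_pi (y z : R) : y < z -> pi * y < pi * z by move=> yz; rewrite ltr_pM2l.
case: ltP => [/lt_pi|h].
  move: (pi * a) (pi * x) pap pa0 px0 px1 => A X *.
  have [y0|y0] := leP 0 (2 * X - A).
    by apply: lt_cos => //; lra.
  by rewrite -[ltRHS]cosN; apply: lt_cos; lra.
have /lt_pi : a < x by rewrite lt_neqAle eq_sym xa.
move: (pi * a) (pi * x) pap pa0 px0 px1 => A X *.
have [y0|y0] := leP (2 * X - A) pi.
  by apply: lt_cos => //; lra.
have -> : cos (2 * X - A) = cos (pi *+ 2 - (2 * X - A)).
  by rewrite -[in LHS]cosN -[in LHS]cosD2pi addrC.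
by apply: lt_cos; rewrite ?mulr2n; lra.
Qed.

Definition coord (b : bool) (p : R * R) : R := if b then p.2 else p.1.

Lemma coord_approx (b : bool) (a : R) : exists g : nat -> R * R -> R,
  [/\ forall n, real_trig (g n), forall n p, 0 <= g n p <= 1 &
    forall p, Omega p -> coord b p != a ->
      g n p @[n --> \oo] --> ((coord b p < a)%R%:R : R)].
Proof.
have [a0|a0] := leP a 0.
  exists (fun _ _ => 0); split => [n|n p|p [/= /andP[x0 _] /andP[y0 _]] _].
  - exact: real_trig_cst.
  - by rewrite lexx ler01.
  - have -> : (coord b p < a) = false.
      by apply/negbTE; rewrite -leNgt; case: (b) => /=; [exact: le_trans a0 (ltW y0)|exact: le_trans a0 (ltW x0)].
    exact: cvg_cst.
have [a1|a1] := ltP 1 a.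
  exists (fun _ _ => 1); split => [n|n p|p [/= /andP[_ x0] /andP[_ y0]] _].
  - exact: real_trig_cst.
  - by rewrite ler01 lexx.
  - have -> : (coord b p < a) = true.
      by case: (b) => /=; [exact: lt_trans y0 a1|exact: lt_trans x0 a1].
    exact: cvg_cst.
pose k : int * int := if b then (0, 1) else (1, 0).
have phk p : phase k p = 2 * pi * coord b p.
  by rewrite /phase /k /coord; case: (b) => /=; rewrite mul0r mul1r ?addr0 ?add0r.
(* A trigonometric polynomial of degree one with values in [0, 1]; in the unit square it is below
   1/2 exactly where the coordinate is less than [a], by [cos_sign]. Composing it with [step_poly]
   gives the approximations. *)
pose sg p := 1 / 2 + (-1 / 4) * (cos (phase k p) * cos (pi * a) +
   sin (phase k p) * sin (pi * a) + (- cos (pi * a))).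
have sgE p : sg p = 1 / 2 - (cos (2 * pi * coord b p - pi * a) - cos (pi * a)) / 4.
  by rewrite /sg phk cosB; field.
have sg01 p : 0 <= sg p <= 1.
  rewrite sgE; have := cos_bound (2 * pi * coord b p - pi * a); have := cos_bound (pi * a).
  rewrite !ler_norml; lra.
have sgt : real_trig sg.
  apply: real_trigD (real_trig_cst _) _; apply: real_trigM (real_trig_cst _) _.
  apply: real_trigD (real_trig_cst _); apply: real_trigD;
    apply: real_trigM (real_trig_cst _).
    exact: real_trig_cos.
  exact: real_trig_sin.
exists (fun n p => step_poly n (sg p)); split => [n|n p|p [/= px py] pa].
- rewrite /step_poly; apply: real_trigX.
  have := real_trigD (real_trig_cst 1) (real_trigM (real_trig_cst (-1)) (real_trigX n sgt)).
  by congr real_trig; apply/funext => p; rewrite mulN1r.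
- exact: step_poly_itv.
- have c01 : 0 < coord b p < 1 by case: (b) => /=; [move: py|move: px]; rewrite in_itv.
  have := cos_sign a0 a1 c01 pa; case: ltP => _ h.
    apply: step_poly_lt; first by case/andP: (sg01 p).
    by rewrite sgE; lra.
  apply: step_poly_gt; last by case/andP: (sg01 p).
  by rewrite sgE; lra.
Qed.

End StepApproximation.

(** * Density of trigonometric polynomials in L^2 *)

Import HBNNSimple.

Section Density.
Variable R : realType.
Local Notation RT := (measurableTypeR R).
Local Notation PT := (measurableTypeR R * measurableTypeR R)%type.
Local Notation mu := (lebesgue2 R).
Local Notation Om := (@Omega R).
Implicit Types (u v : R * R -> R).

Definition trig_approximable u := L2 u /\ forall e, 0 < e ->
  exists2 t, real_trig t & integralO (fun p => (u p - t p) ^+ 2) <= e.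

Lemma trig_approximable_trig t : real_trig t -> trig_approximable t.
Proof.
move=> ht; split; first exact: real_trig_L2.
move=> e e0; exists t => //; rewrite (_ : (fun p => _) = fun=> 0) ?IO_cst ?ltW //.
by apply/funext => p; rewrite subrr expr0n.
Qed.

Lemma trig_approximable_limit u : L2 u ->
  (forall e, 0 < e -> exists2 v, trig_approximable v &
     integralO (fun p => (u p - v p) ^+ 2) <= e) -> trig_approximable u.
Proof.
move=> hu H; split => // e e0; have e4 : 0 < e / 4 by rewrite divr_gt0.
have [v [hv Hv] uv] := H _ e4; have [t ht vt] := Hv _ e4.
exists t => //.
have := IO_sqr_sum_le (L2_B hu hv) (L2_B hv (real_trig_L2 ht)).
have -> : (fun p => (u p - v p + (v p - t p)) ^+ 2) = (fun p => (u p - t p) ^+ 2).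
  by apply/funext => p; rewrite addrA subrK.
lra.
Qed.

Lemma trig_approximableD u v : trig_approximable u -> trig_approximable v ->
  trig_approximable (fun p => u p + v p).
Proof.
move=> [hu Hu] [hv Hv]; split; first exact: L2_D.
move=> e e0; have e4 : 0 < e / 4 by rewrite divr_gt0.
have [t ht ut] := Hu _ e4; have [s hs vs] := Hv _ e4.
exists (fun p => t p + s p); first exact: real_trigD.
have := IO_sqr_sum_le (L2_B hu (real_trig_L2 ht)) (L2_B hv (real_trig_L2 hs)).
have -> : (fun p => (u p - t p + (v p - s p)) ^+ 2) = (fun p => (u p + v p - (t p + s p)) ^+ 2).
  by apply/funext => p; congr (_ ^+ 2); ring.
lra.
Qed.

Lemma trig_approximableZ c u : trig_approximable u -> trig_approximable (fun p => c * u p).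
Proof.
move=> [hu Hu]; split; first exact: L2_Z.
move=> e e0; have c0 : 0 < c ^+ 2 + 1 by rewrite ltr_pwDr ?sqr_ge0.
have [t ht ut] := Hu _ (divr_gt0 e0 c0).
exists (fun p => c * t p); first exact: real_trigM (real_trig_cst c) ht.
have -> : (fun p => (c * u p - c * t p) ^+ 2) = (fun p => c ^+ 2 * (u p - t p) ^+ 2).
  by apply/funext => p; ring.
rewrite IO_Z; last by have [] := L2_B hu (real_trig_L2 ht).
apply: le_trans (ler_wpM2l (sqr_ge0 c) ut) _.
rewrite mulrCA ler_piMr ?ltW //.
by rewrite ltr_pdivrMr // mul1r ltrDl.
Qed.

Lemma trig_approximable_sum (I : Type) (s : seq I) (F : I -> R * R -> R) :
  (forall i, trig_approximable (F i)) -> trig_approximable (fun p => \sum_(i <- s) F i p).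
Proof.
move=> H; elim: s => [|x s IH].
  by under eq_fun do rewrite big_nil; exact: trig_approximable_trig (real_trig_cst 0).
by under eq_fun do rewrite big_cons; exact: trig_approximableD.
Qed.

(** Dominated convergence for the squared differences, which are at most [4 * g ^+ 2]. The null set
    [Z] accommodates the lines on which the step approximations need not converge. *)
Lemma trig_approximable_dominated u (un : nat -> R * R -> R) g (Z : set PT) :
  measurable2 u -> L2 g -> measurable Z -> mu Z = 0%E ->
  (forall n, trig_approximable (un n)) ->
  (forall n p, `|un n p| <= g p) -> (forall p, `|u p| <= g p) ->
  (forall p, Om p -> ~ Z p -> un n p @[n --> \oo] --> u p) ->
  trig_approximable u.
Proof.
move=> mu_ hg mZ Z0 hun ung ug cv.
have hu : L2 u.
  split => //; have [mg ig] := hg; apply: intg_le ig; first exact: measurable2_sqr.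
  by move=> p; rewrite normrX ler_pXn2r ?nnegrE //; exact: le_trans (ug p).
apply: trig_approximable_limit => // e e0.
have hd n := L2_B hu (proj1 (hun n)).
have [|||||_ _ cvI] := @dominated_convergence _ PT R mu Om (@measurable_Omega R)
  (fun n p => ((u p - un n p) ^+ 2)%:E) (fun=> 0%E) (fun p => (4 * g p ^+ 2)%:E).
- move=> n; apply/measurable_EFinP; apply: measurable2_Omega; apply: measurable2_sqr.
  by have [] := hd n.
- exact: measurable_cst.
- exists Z; split => // p /= h; apply: contrapT => nZ; apply: h => Op.
  have -> : (0 : \bar R) = ((u p - u p) * (u p - u p))%:E by rewrite subrr mulr0.
  apply: cvg_EFin; first exact: nearW.
  under [X in X @ _ --> _]funext do rewrite /= expr2.
  by apply: cvgM; apply: cvgB; [exact: cvg_cst|exact: cv|exact: cvg_cst|exact: cv].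
- by have [_ ig] := hg; exact: intgZ.
- apply: aeW => p n _; rewrite abse_EFin lee_fin ger0_norm ?sqr_ge0 //.
  have := ung n p; have := ug p; rewrite !ler_norml; nra.
have {}cvI : (fun n => (integralO (fun p => (u p - un n p) ^+ 2))%:E) @ \oo --> 0%:E.
  move: cvI; rewrite integral0; apply: cvg_trans; apply: near_eq_cvg; near=> n.
  by rewrite EFin_IO //; have [] := hd n.
have /fine_cvgP[_ /= /cvgrPdist_le /(_ e e0)] := cvI.
move=> /filter_ex[n /=]; rewrite sub0r normrN => h.
by exists (un n) => //; apply: le_trans (ler_norm _) h.
Unshelve. all: end_near. Qed.

(** A pi-system generating the product sigma-algebra, whose indicators are products of two step
    functions of one coordinate. *)
Definition quadrants : set (set PT) :=
  [set A | exists a b : R, A = [set p | p.1 < a /\ p.2 < b]].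

Lemma quadrants_setI : setI_closed quadrants.
Proof.
move=> _ _ [a [b ->]] [a' [b' ->]]; exists (Num.min a a'), (Num.min b b').
by apply/seteqP; split => p /=; rewrite !lt_min; [move=> [[-> ->] [-> ->]]|move=> [/andP[? ?] /andP[? ?]]].
Qed.

Lemma measurable_quadrant (a b : R) : measurable ([set p | p.1 < a /\ p.2 < b] : set PT).
Proof.
have -> : [set p : PT | p.1 < a /\ p.2 < b] = `]-oo, a[ `*` `]-oo, b[.
  by apply/seteqP; split => p /=; rewrite !in_itv.
by apply: measurableX; exact: measurable_itv.
Qed.

Lemma measurable_quadrants : (@measurable _ PT) `<=` <<s quadrants >>.
Proof.
have rayE : @measurable _ RT = <<s @RGenInftyO.G R >> by exact: RGenInftyO.measurableE.
have key (f : PT -> R) : (forall a, <<s quadrants >> [set p | f p < a]) ->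
    preimage_set_system setT f (@measurable _ RT) `<=` <<s quadrants >>.
  move=> H _ [B mB <-].
  have : @measurable_fun _ _ (g_sigma_algebraType quadrants) RT setT f.
    apply: (@measurability _ _ (g_sigma_algebraType quadrants) RT setT f (@RGenInftyO.G R) rayE) => _ [_ [a ->] <-].
    have := H a; congr (<<s _ >> _).
    by apply/seteqP; split => p /=; rewrite in_itv /= ?setTI //; move=> [].
  by move/(_ measurableT _ mB).
apply: smallest_sub; first exact: smallest_sigma_algebra.
move=> A [|]; apply: key => a.
- have -> : [set p : PT | p.1 < a] = \bigcup_n [set p : PT | p.1 < a /\ p.2 < n%:R].
    apply/seteqP; split => [p /= h|p [n _ []]//].
    exists (Num.bound `|p.2|) => //; split => //.
    exact: le_lt_trans (ler_norm _) (archi_boundP (normr_ge0 _)).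
  apply: sigma_algebra_bigcup => n; apply: sub_sigma_algebra.
  by exists a, n%:R.
- have -> : [set p : PT | p.2 < a] = \bigcup_n [set p : PT | p.1 < n%:R /\ p.2 < a].
    apply/seteqP; split => [p /= h|p [n _ []]//].
    exists (Num.bound `|p.1|) => //; split => //.
    exact: le_lt_trans (ler_norm _) (archi_boundP (normr_ge0 _)).
  apply: sigma_algebra_bigcup => n; apply: sub_sigma_algebra.
  by exists n%:R, a.
Qed.

Lemma lebesgue2_null_line b (a : R) : measurable ([set p | coord b p = a] : set PT) /\
  mu [set p | coord b p = a] = 0%E.
Proof.
have m1 : measurable ([set a] : set RT) by exact: measurable_set1.
have -> : [set p : R * R | coord b p = a] = if b then setT `*` [set a] else [set a] `*` setT.
  by apply/seteqP; case: b => /=; split => p /=; rewrite /coord //; tauto.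
case: b; (split; first exact: measurableX); rewrite lebesgue2_setX // lebesgue_measure_set1.
  by rewrite mule0.
by rewrite mul0e.
Qed.

Lemma trig_approximable_quadrant (A : set PT) : quadrants A -> trig_approximable (\1_A).
Proof.
move=> [a [b ->]].
have [g [gt g01 gc]] := coord_approx false a.
have [h [ht h01 hc]] := coord_approx true b.
have [ma za] := lebesgue2_null_line false a.
have [mb zb] := lebesgue2_null_line true b.
apply: (@trig_approximable_dominated _ (fun n p => g n p * h n p) (fun=> 1)
  ([set p | coord false p = a] `|` [set p | coord true p = b])).
- by apply: measurable_indic; exact: measurable_quadrant.
- exact: L2_cst.
- exact: measurableU.
- by apply: null_set_setU.
- by move=> n; apply: trig_approximable_trig; exact: real_trigM.
- move=> n p; have /andP[g0 g1] := g01 n p; have /andP[h0 h1] := h01 n p.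
  by rewrite ger0_norm ?mulr_ge0 // mulr_ile1.
- by move=> p; rewrite indicE ger0_norm ?ler0n // lern1 leq_b1.
- move=> p Op; rewrite /= not_orP => -[/eqP pa /eqP pb].
  have -> : \1_[set p | p.1 < a /\ p.2 < b] p =
      (coord false p < a)%R%:R * (coord true p < b)%R%:R :> R.
    rewrite indicE -natrM mulnb; congr (_%:R); congr nat_of_bool.
    by apply/idP/andP; rewrite inE.
  by apply: cvgM; [exact: gc|exact: hc].
Qed.

(** Dynkin's argument: the measurable sets with approximable indicator contain the quadrants and are
    stable under proper differences and increasing unions. *)
Lemma trig_approximable_indic (A : set PT) : measurable A -> trig_approximable (\1_A).
Proof.
pose H := [set A : set PT | measurable A /\ trig_approximable (\1_A)].
suff HH : <<s quadrants >> `<=` H by move=> /measurable_quadrants /HH[].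
have Hle1 (B : set PT) p : `|\1_B p : R| <= 1.
  by rewrite indicE ger0_norm ?ler0n // lern1 leq_b1.
apply: lambda_system_subset => //.
- exact: quadrants_setI.
- split => //.
  + split => //; have := trig_approximable_trig (real_trig_cst (1 : R)); congr trig_approximable.
    by apply/funext => p; rewrite indicE in_setT.
  + move=> B C CB [mB hB] [mC hC]; split; first exact: measurableD.
    have := trig_approximableD hB (trig_approximableZ (-1) hC); congr trig_approximable.
    apply/funext => p; rewrite !indicE in_setD.
    have [Cp|nCp] := boolP (p \in C); last by rewrite andbT mulr0 addr0.
    have -> : p \in B by rewrite inE in Cp; rewrite inE; exact: CB.
    by rewrite mulN1r subrr.
  + move=> F ndF hF.
    have mF : measurable (\bigcup_n F n) by apply: bigcup_measurable => n _; case: (hF n).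
    split => //.
    apply: (@trig_approximable_dominated _ (fun n => \1_(F n)) (fun=> 1) set0) => //.
    * exact: measurable_indic.
    * exact: L2_cst.
    * by move=> n; case: (hF n).
    * move=> p Op _; rewrite [X in _ --> X]indicE.
      have [|nFp] := boolP (p \in \bigcup_n F n).
        rewrite inE => -[N _ FNp]; apply: cvg_near_cst; exists N => // n /= Nn.
        rewrite indicE (_ : p \in F n) // inE.
        by have /subsetPset := ndF _ _ Nn; apply.
      rewrite (_ : (fun n => _) = (fun=> 0)); first exact: cvg_cst.
      apply/funext => n; rewrite indicE (negPf (_ : p \notin F n)) //.
      by apply: contra nFp; rewrite !inE => Fnp; exists n.
- move=> B [a [b ->]]; split; first exact: measurable_quadrant.
  by apply: trig_approximable_quadrant; exists a, b.
Qed.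

(** Simple functions increase to [u], which itself serves as the dominating function. *)
Lemma trig_approximable_nonneg u : L2 u -> (forall p, 0 <= u p) -> trig_approximable u.
Proof.
move=> hu u0; have [mu_ iu] := hu.
have mfE : measurable_fun [set: PT] (EFin \o u) by exact/measurable_EFinP.
have cv p := @cvg_nnsfun_approx _ PT R setT measurableT _ mfE (fun x _ => u0 x) p I.
apply: (@trig_approximable_dominated _ (fun n p => nnsfun_approx measurableT mfE n p) u set0) => //.
- move=> n; set f := nnsfun_approx measurableT mfE n.
  have : trig_approximable (fun p => \sum_(y <- finmap.enum_fset (fset_set (range f))) y * \1_(f @^-1` [set y]) p).
    apply: trig_approximable_sum => y; apply: trig_approximableZ.
    by apply: trig_approximable_indic; exact: measurable_funPTI.
  congr trig_approximable; apply/funext => p.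
  by rewrite fimfunE fsbig_finite.
- move=> n p; rewrite ger0_norm ?fun_ge0 // -lee_fin nnsfun_approxE.
  by have := @le_approx _ PT R setT (EFin \o u) n p (fun x _ => u0 x) I.
- by move=> p; rewrite ger0_norm.
- by move=> p _ _; have /fine_cvgP[_] := cv p.
Qed.

Lemma L2_trig_approximable u : L2 u -> trig_approximable u.
Proof.
move=> hu; have [mu_ iu] := hu.
have mmax v : measurable2 v -> measurable2 (fun p => Num.max (v p) 0).
  by move=> mv; apply: measurable_maxr => //; exact: measurable_cst.
have part v : L2 v -> trig_approximable (fun p => Num.max (v p) 0).
  move=> [mv iv]; apply: trig_approximable_nonneg; last by move=> p; rewrite le_max lexx orbT.
  split; first exact: mmax.
  apply: intg_le iv; first by apply: measurable2_sqr; exact: mmax.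
  by move=> p; rewrite ger0_norm ?sqr_ge0 //; have [h|h] := leP (v p) 0; rewrite ?lexx // expr0n sqr_ge0.
have := trig_approximableD (part u hu) (trig_approximableZ (-1) (part _ (L2_Z (-1) hu))).
congr trig_approximable; apply/funext => p; rewrite !mulN1r.
have [h|/ltW h] := leP (u p) 0.
  by rewrite max_l ?oppr_ge0 // add0r opprK.
by rewrite max_r ?oppr_le0 // subr0.
Qed.

End Density.

(** * Sines and cosines of affine functions and their integrals over a period *)

Section AffineTrig.
Variable R : realType.

Global Instance is_derive_affine (al be x : R) : is_derive x 1 (fun y : R => al * y + be) al.
Proof.
have -> : (fun y : R => al * y + be) = (al \*: id) + cst be.
  by apply/funext => y; rewrite !fctE.
by apply: is_derive_eq; rewrite addr0 /GRing.scale /= mulr1.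
Qed.

Lemma is_derive_cos_affine (al be x : R) :
  is_derive x 1 (fun y : R => cos (al * y + be)) (- (al * sin (al * x + be))).
Proof.
have := @is_derive1_comp _ (@cos R) (fun y : R => al * y + be) x _ _ (is_derive_cos _) (is_derive_affine al be x).
by rewrite /comp mulNr mulrC.
Qed.

Lemma is_derive_sin_affine (al be x : R) :
  is_derive x 1 (fun y : R => sin (al * y + be)) (al * cos (al * x + be)).
Proof.
have := @is_derive1_comp _ (@sin R) (fun y : R => al * y + be) x _ _ (is_derive_sin _) (is_derive_affine al be x).
by rewrite /comp mulrC.
Qed.

Lemma continuous_cos_affine (al be : R) : continuous (fun y : R => cos (al * y + be)).
Proof.
by move=> x; apply/differentiable_continuous/derivable1_diffP; have [] := is_derive_cos_affine al be x.
Qed.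

Lemma continuous_sin_affine (al be : R) : continuous (fun y : R => sin (al * y + be)).
Proof.
by move=> x; apply/differentiable_continuous/derivable1_diffP; have [] := is_derive_sin_affine al be x.
Qed.

Lemma sin_period_int (n : int) (x : R) : sin (2 * pi * n%:~R + x) = sin x.
Proof.
have H (m : nat) (y : R) : sin (2 * pi * m%:R + y) = sin y.
  elim: m => [|m IH]; first by rewrite mulr0 add0r.
  rewrite -(natr1 m) mulrDr mulr1.
  have -> : 2 * pi * m%:R + 2 * pi + y = 2 * pi * m%:R + y + pi *+ 2 by rewrite -mulr_natl; ring.
  by rewrite sinD2pi IH.
case: n => n; first exact: H.
rewrite NegzE mulrNz mulrN -[LHS](H n.+1); congr sin.
by rewrite -pmulrn; ring.
Qed.

Lemma cos_period_int (n : int) (x : R) : cos (2 * pi * n%:~R + x) = cos x.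
Proof.
have H (m : nat) (y : R) : cos (2 * pi * m%:R + y) = cos y.
  elim: m => [|m IH]; first by rewrite mulr0 add0r.
  rewrite -(natr1 m) mulrDr mulr1.
  have -> : 2 * pi * m%:R + 2 * pi + y = 2 * pi * m%:R + y + pi *+ 2 by rewrite -mulr_natl; ring.
  by rewrite cosD2pi IH.
case: n => n; first exact: H.
rewrite NegzE mulrNz mulrN -[LHS](H n.+1); congr cos.
by rewrite -pmulrn; ring.
Qed.

Lemma integral_cos_affine (n : int) (be : R) : n != 0 ->
  (\int[lebesgue_measure]_(y in `]0%R, 1%R[) (cos (2 * pi * n%:~R * y + be))%:E = 0)%E.
Proof.
move=> n0; set al := 2 * pi * n%:~R.
have al0 : al != 0 by rewrite !mulf_neq0 ?intr_eq0 // gt_eqF // pi_gt0.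
have mc : measurable_fun setT (fun y : R => cos (al * y + be)).
  by apply: continuous_measurable_fun; exact: continuous_cos_affine.
rewrite -(integral_itv_bndoo true false); last first.
  by apply/measurable_EFinP; exact: measurable_funTS.
rewrite (@continuous_FTC2 _ _ (fun y => al^-1 * sin (al * y + be))) //.
- by rewrite mulr1 mulr0 add0r sin_period_int subee.
- by apply: continuous_subspaceT; exact: continuous_cos_affine.
- have c : continuous (fun y : R => al^-1 * sin (al * y + be)).
    by move=> y; apply: cvgM; [exact: cvg_cst|exact: continuous_sin_affine].
  split.
  + move=> y _; apply: derivableM; first exact: derivable_cst.
    by have [] := is_derive_sin_affine al be y.
  + exact/cvg_at_right_filter/c.
  + exact/cvg_at_left_filter/c.
- move=> y _; rewrite derive1E.
  have H := is_derive_sin_affine al be y.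
  rewrite deriveM; [|exact: derivable_cst|by have [] := H].
  by rewrite derive_cst scaler0 addr0 derive_val /GRing.scale /= mulKf.
Qed.

Lemma integral_sin_affine (n : int) (be : R) : n != 0 ->
  (\int[lebesgue_measure]_(y in `]0%R, 1%R[) (sin (2 * pi * n%:~R * y + be))%:E = 0)%E.
Proof.
move=> n0; rewrite -[RHS](integral_cos_affine (be - pi / 2) n0).
by apply: eq_integral => y _; rewrite addrA cosBpihalf.
Qed.

End AffineTrig.

(** * Fourier coefficients, Bessel's inequality and Parseval's identity *)

#[global] Arguments fourier : simpl never.

Section FourierCoefficients.
Variable R : realType.
Local Notation RT := (measurableTypeR R).
Local Notation PT := (measurableTypeR R * measurableTypeR R)%type.
Local Notation mu := (lebesgue2 R).
Local Notation Om := (@Omega R).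
Local Notation C := (real_complex R).
Implicit Types (u v f t : R * R -> R) (g : R * R -> R[i]) (k m : int * int) (c : int * int -> R[i]).

Lemma IO_mkcond u : intg u -> mu.-integrable setT ((EFin \o u) \_ Om).
Proof. by move=> hu; apply/(integrable_mkcond _ (@measurable_Omega R)). Qed.

(** Fubini's theorem in the form used for orthogonality: a mode integrates to zero along any
    direction in which its frequency is nonzero. *)
Lemma IO_zero_snd u : intg u ->
  (forall x, (\int[lebesgue_measure]_(y in `]0%R, 1%R[) (u (x, y))%:E = 0)%E) ->
  integralO u = 0.
Proof.
move=> hu H; apply: EFin_inj; rewrite EFin_IO // integral_mkcond.
rewrite -(integral12_prod_meas1 (IO_mkcond hu)).
rewrite -[RHS](integral0 lebesgue_measure setT); apply: eq_integral => x _.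
have [xin|xout] := boolP (x \in (`]0, 1[%classic : set R)); last first.
  rewrite -[RHS](integral0 lebesgue_measure setT); apply: eq_integral => y _.
  rewrite /patch ifF //; apply/negbTE; apply: contra xout.
  by rewrite !inE => -[].
rewrite -[RHS](H x) [RHS]integral_mkcond; apply: eq_integral => y _.
rewrite /patch; congr (if _ then _ else _); apply/idP/idP; rewrite !inE.
  by move=> [].
by move=> yin; split => //; rewrite inE in xin.
Qed.

Lemma IO_zero_fst u : intg u ->
  (forall y, (\int[lebesgue_measure]_(x in `]0%R, 1%R[) (u (x, y))%:E = 0)%E) ->
  integralO u = 0.
Proof.
move=> hu H; apply: EFin_inj; rewrite EFin_IO // integral_mkcond.
rewrite -(integral21_prod_meas1 (IO_mkcond hu)).
rewrite -[RHS](integral0 lebesgue_measure setT); apply: eq_integral => y _.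
have [yin|yout] := boolP (y \in (`]0, 1[%classic : set R)); last first.
  rewrite -[RHS](integral0 lebesgue_measure setT); apply: eq_integral => x _.
  rewrite /patch ifF //; apply/negbTE; apply: contra yout.
  by rewrite !inE => -[].
rewrite -[RHS](H y) [RHS]integral_mkcond; apply: eq_integral => x _.
rewrite /patch; congr (if _ then _ else _); apply/idP/idP; rewrite !inE.
  by move=> [].
by move=> xin; split => //; rewrite inE in yin.
Qed.

Lemma phase_affine_snd k (x y : R) :
  phase k (x, y) = 2 * pi * k.2%:~R * y + 2 * pi * (k.1%:~R * x).
Proof. by rewrite /phase /=; ring. Qed.

Lemma phase_affine_fst k (x y : R) :
  phase k (x, y) = 2 * pi * k.1%:~R * x + 2 * pi * (k.2%:~R * y).
Proof. by rewrite /phase /=; ring. Qed.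

Lemma IO_cos k : k != 0 -> integralO (fun p : R * R => cos (phase k p)) = 0.
Proof.
move=> k0; have hi := intg_L2 (@L2_cos R k).
have [k2|k2] := eqVneq k.2 0; last first.
  apply: IO_zero_snd => // x; under eq_integral do rewrite phase_affine_snd.
  exact: integral_cos_affine.
apply: IO_zero_fst => // y; under eq_integral do rewrite phase_affine_fst.
apply: integral_cos_affine; apply: contra k0 => /eqP k1.
by rewrite [k]surjective_pairing k1 k2.
Qed.

Lemma IO_sin k : integralO (fun p : R * R => sin (phase k p)) = 0.
Proof.
have [->|k0] := eqVneq k 0.
  rewrite -[RHS](@IO_cst R); apply: eq_IO => p _.
  by rewrite /phase /= !mul0r addr0 mulr0 sin0.
have hi := intg_L2 (@L2_sin R k).
have [k2|k2] := eqVneq k.2 0; last first.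
  apply: IO_zero_snd => // x; under eq_integral do rewrite phase_affine_snd.
  exact: integral_sin_affine.
apply: IO_zero_fst => // y; under eq_integral do rewrite phase_affine_fst.
apply: integral_sin_affine; apply: contra k0 => /eqP k1.
by rewrite [k]surjective_pairing k1 k2.
Qed.

Definition cintegral g : R[i] :=
  Complex (integralO (fun p => complex.Re (g p))) (integralO (fun p => complex.Im (g p))).
Definition cintg g := intg (fun p => complex.Re (g p)) /\ intg (fun p => complex.Im (g p)).

Lemma cintgZ a g : cintg g -> cintg (fun p => a * g p).
Proof.
case: a => x y [h1 h2]; split.
  rewrite (_ : (fun p => _) = fun p => x * complex.Re (g p) + (- y) * complex.Im (g p)).
    by apply: intgD; exact: intgZ.
  by apply/funext => p; case: (g p) => s t /=; rewrite mulNr.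
rewrite (_ : (fun p => _) = fun p => x * complex.Im (g p) + y * complex.Re (g p)).
  by apply: intgD; exact: intgZ.
by apply/funext => p; case: (g p).
Qed.

Lemma cintegralZ a g : cintg g -> cintegral (fun p => a * g p) = a * cintegral g.
Proof.
case: a => x y [h1 h2]; rewrite /cintegral; apply/eqP; rewrite eq_complex /=.
apply/andP; split; apply/eqP.
  rewrite (_ : (fun p => _) = fun p => x * complex.Re (g p) + (- y) * complex.Im (g p)).
    by rewrite IO_D ?IO_Z ?mulNr //; exact: intgZ.
  by apply/funext => p; case: (g p) => s t /=; rewrite mulNr.
rewrite (_ : (fun p => _) = fun p => x * complex.Im (g p) + y * complex.Re (g p)).
  by rewrite IO_D ?IO_Z //; exact: intgZ.
by apply/funext => p; case: (g p).
Qed.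

Lemma cintegral_sum (s : seq (int * int)) (F : int * int -> R * R -> R[i]) :
  (forall k, cintg (F k)) ->
  cintegral (fun p => \sum_(k <- s) F k p) = \sum_(k <- s) cintegral (F k).
Proof.
move=> H; apply/eqP; rewrite eq_complex /= Re_sum Im_sum /=; apply/andP; split; apply/eqP.
  rewrite (_ : (fun p => _) = fun p => \sum_(k <- s) complex.Re (F k p)).
    by have [] := @IO_sum _ _ s _ (fun k _ => proj1 (H k)).
  by apply/funext => p; rewrite Re_sum.
rewrite (_ : (fun p => _) = fun p => \sum_(k <- s) complex.Im (F k p)).
  by have [] := @IO_sum _ _ s _ (fun k _ => proj2 (H k)).
by apply/funext => p; rewrite Im_sum.
Qed.

Lemma cintg_mode u k : L2 u -> cintg (fun p => C (u p) * expmode k p).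
Proof.
move=> hu; split.
  have := intg_mul hu (@L2_cos R k); congr intg; apply/funext => p.
  by rewrite expmodeE /= mul0r subr0.
have := intg_mul hu (@L2_sin R k); congr intg; apply/funext => p.
by rewrite expmodeE /= mul0r addr0.
Qed.

Lemma fourier_cintegral u k :
  fourier u k = cintegral (fun p => C (u p) * expmode (- k) p).
Proof. by rewrite /fourier /inner /cintegral; under eq_fun do rewrite -expmodeN; under [in X in Complex _ X]eq_fun do rewrite -expmodeN. Qed.

Lemma fourierE u k : L2 u -> fourier u k =
  Complex (integralO (fun p => u p * cos (phase k p))) (- integralO (fun p => u p * sin (phase k p))).
Proof.
move=> hu; rewrite /fourier /inner; congr Complex.
  by apply: eq_IO => p _; rewrite expmodeE /=; ring.
have hi := intg_mul hu (@L2_sin R k).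
rewrite -mulN1r -IO_Z //; apply: eq_IO => p _.
by rewrite expmodeE /=; ring.
Qed.

Lemma fourierN u k : L2 u -> fourier u (- k) = conjc (fourier u k).
Proof.
move=> hu; rewrite !fourierE //=; congr Complex.
  by apply: eq_IO => p _; rewrite phaseN cosN.
have hi := intg_mul hu (@L2_sin R k).
congr (- _); rewrite -[RHS]mulN1r -IO_Z //; apply: eq_IO => p _.
by rewrite phaseN sinN; ring.
Qed.

Lemma fourierD u v k : L2 u -> L2 v ->
  fourier (fun p => u p + v p) k = fourier u k + fourier v k.
Proof.
move=> hu hv; rewrite !fourierE //; last exact: L2_D.
apply/eqP; rewrite eq_complex /=; apply/andP; split; apply/eqP.
  rewrite -IO_D; [|exact: intg_mul hu (@L2_cos R k)|exact: intg_mul hv (@L2_cos R k)].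
  by apply: eq_IO => p _; rewrite mulrDl.
rewrite -opprD -IO_D; [|exact: intg_mul hu (@L2_sin R k)|exact: intg_mul hv (@L2_sin R k)].
by congr (- _); apply: eq_IO => p _; rewrite mulrDl.
Qed.

Lemma fourierZ a u k : L2 u -> fourier (fun p => a * u p) k = C a * fourier u k.
Proof.
move=> hu; rewrite !fourierE //; last exact: L2_Z.
apply/eqP; rewrite eq_complex /= !mul0r subr0 addr0; apply/andP; split; apply/eqP.
  rewrite -IO_Z; last exact: intg_mul hu (@L2_cos R k).
  by apply: eq_IO => p _; rewrite mulrA.
rewrite mulrN -IO_Z; last exact: intg_mul hu (@L2_sin R k).
by congr (- _); apply: eq_IO => p _; rewrite mulrA.
Qed.

Lemma fourierB u v k : L2 u -> L2 v ->
  fourier (fun p => u p - v p) k = fourier u k - fourier v k.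
Proof.
move=> hu hv; have hv' := L2_Z (-1) hv.
transitivity (fourier (fun p => u p + -1 * v p) k).
  by congr (fourier _ k); apply/funext => p; rewrite mulN1r.
by rewrite fourierD // fourierZ // rmorphN1 mulN1r.
Qed.

Lemma fourier_cst a k : fourier (fun _ : R * R => a) k = if k == 0 then C a else 0.
Proof.
have h1 := @L2_cst R 1.
have -> : fourier (fun _ : R * R => a) k = C a * fourier (fun _ : R * R => 1) k.
  by rewrite -fourierZ //; congr (fourier _ k); apply/funext => p; rewrite mulr1.
rewrite fourierE //.
have -> : integralO (fun p : R * R => 1 * sin (phase k p)) = 0.
  by rewrite -[RHS](IO_sin k); apply: eq_IO => p _; rewrite mul1r.
have -> : integralO (fun p : R * R => 1 * cos (phase k p)) = integralO (fun p : R * R => cos (phase k p)).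
  by apply: eq_IO => p _; rewrite mul1r.
case: eqVneq => [->|k0]; last first.
  by rewrite IO_cos // oppr0; exact: mulr0.
rewrite (_ : integralO _ = 1) ?oppr0; first by exact: mulr1.
rewrite -[RHS](@IO_cst R); apply: eq_IO => p _.
by rewrite /phase /= !mul0r addr0 mulr0 cos0.
Qed.

(** With one factor a trigonometric polynomial the convolution is finite, hence exact. Taking
    [u = 1] yields orthogonality of the modes, [k = 0] the inner products, and a partial sum for [t]
    the coefficients of general products. *)
Lemma fourier_mul_trig u t N c k : L2 u ->
  (forall p, of_real t p = \sum_(m <- box N) c m * expmode m p) ->
  fourier (fun p => u p * t p) k = \sum_(m <- box N) fourier u (k - m) * c m.
Proof.
move=> hu ht; rewrite fourier_cintegral.
have -> : (fun p => C (u p * t p) * expmode (- k) p) =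
    (fun p => \sum_(m <- box N) c m * (C (u p) * expmode (- (k - m)) p)).
  apply/funext => p; rewrite rmorphM /= -[C (t p)]/(of_real t p) ht mulr_sumr mulr_suml.
  by apply: eq_bigr => m _; rewrite opprB expmodeD; ring.
rewrite cintegral_sum; last by move=> m; apply: cintgZ; exact: cintg_mode.
apply: eq_bigr => m _; rewrite cintegralZ; last exact: cintg_mode.
by rewrite -fourier_cintegral mulrC.
Qed.

Lemma fourier_trig t N c k :
  (forall p, of_real t p = \sum_(m <- box N) c m * expmode m p) ->
  fourier t k = if k \in box N then c k else 0.
Proof.
move=> ht; have -> : fourier t k = fourier (fun p => 1 * t p) k.
  by congr (fourier _ k); apply/funext => p; rewrite mul1r.
rewrite (fourier_mul_trig _ (L2_cst 1) ht).
under eq_bigr do rewrite fourier_cst subr_eq0.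
case: ifP => hk.
  rewrite (bigD1_seq k) ?box_uniq //= eqxx mul1r big1 ?addr0 // => m.
  by rewrite eq_sym => /negPf ->; rewrite mul0r.
rewrite big1_seq // => m /andP[_ hm]; case: eqP => [e|_]; last by rewrite mul0r.
by rewrite e hm in hk.
Qed.

Lemma fourier0_IO u : complex.Re (fourier u 0) = integralO u.
Proof.
rewrite /fourier /inner /=; apply: eq_IO => p _.
by rewrite /= !mul0r addr0 mulr0 cos0 mulr1 subr0.
Qed.

(** The real part makes the function real by construction; [partial_sumE] shows that nothing is
    discarded. *)
Definition partial_sum N u (p : R * R) : R :=
  complex.Re (\sum_(m <- box N) fourier u m * expmode m p : R[i]).

Lemma box_opp N : perm_eq (box N) [seq - k | k <- box N].
Proof.
have oi : injective (fun k : int * int => - k) by move=> x y /eqP; rewrite eqr_opp => /eqP.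
apply: uniq_perm; rewrite ?map_inj_uniq ?box_uniq // => k.
rewrite -[k in RHS]opprK mem_map //.
by rewrite !mem_box /= !abszN.
Qed.

Lemma hermitian_sum_real N (c : int * int -> R[i]) (p : R * R) : (forall k, c (- k) = conjc (c k)) ->
  complex.Im (\sum_(m <- box N) c m * expmode m p) = 0.
Proof.
move=> hc; set S := \sum_(m <- box N) _.
suff : conjc S = S by case: S => a b [] /=; lra.
rewrite {2}/S (perm_big _ (box_opp N)) /= big_map /S rmorph_sum; apply: eq_bigr => m _.
by rewrite rmorphM hc expmodeN.
Qed.

Lemma partial_sumE N u p : L2 u ->
  of_real (partial_sum N u) p = \sum_(m <- box N) fourier u m * expmode m p.
Proof.
move=> hu; rewrite /of_real /partial_sum.
have := @hermitian_sum_real N (fourier u) p (fun k => fourierN k hu).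
by case: (\sum_(m <- _) _) => a b /= ->.
Qed.

Lemma real_trig_partial_sum N u : L2 u -> real_trig (partial_sum N u).
Proof. by move=> hu; exists N, (fourier u) => p; rewrite partial_sumE. Qed.

Lemma real_trigE t : real_trig t -> exists N, forall p,
  of_real t p = \sum_(m <- box N) fourier t m * expmode m p.
Proof.
move=> [N [c ht]]; exists N => p; rewrite ht big_seq [RHS]big_seq.
by apply: eq_bigr => k hk; rewrite (fourier_trig _ ht) hk.
Qed.

Lemma IO_mul_trig u t N : L2 u -> real_trig t ->
  (forall p, of_real t p = \sum_(m <- box N) fourier t m * expmode m p) ->
  integralO (fun p => u p * t p) =
  \sum_(m <- box N) (complex.Re (fourier u m) * complex.Re (fourier t m) +
    complex.Im (fourier u m) * complex.Im (fourier t m)).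
Proof.
move=> hu rt ht.
rewrite -fourier0_IO (fourier_mul_trig _ hu ht) Re_sum; apply: eq_bigr => m _.
rewrite sub0r fourierN //; case: (fourier u m) (fourier t m) => a b [x y] /=; ring.
Qed.

(** Completing the square mode by mode. The last sum vanishes for the partial sum of [u], which is
    therefore the best approximation with frequencies in the box. *)
Lemma IO_sub_trig u t N : L2 u -> real_trig t ->
  (forall p, of_real t p = \sum_(m <- box N) fourier t m * expmode m p) ->
  integralO (fun p => (u p - t p) ^+ 2) = integralO (fun p => u p ^+ 2) -
    \sum_(m <- box N) nc (fourier u m) ^+ 2 +
    \sum_(m <- box N) nc (fourier u m - fourier t m) ^+ 2.
Proof.
move=> hu rt ht; have L2t := real_trig_L2 rt.
have -> : integralO (fun p => (u p - t p) ^+ 2) =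
    integralO (fun p => u p ^+ 2 + ((-2) * (u p * t p) + t p * t p)).
  by apply: eq_IO => p _; ring.
have iut := intg_mul hu L2t; have itt := intg_mul L2t L2t; have [_ iu] := hu.
rewrite IO_D //; last by apply: intgD => //; exact: intgZ.
rewrite IO_D //; last exact: intgZ.
rewrite IO_Z // (IO_mul_trig hu rt ht) (IO_mul_trig L2t rt ht) -addrA; congr (_ + _).
rewrite mulr_sumr -sumrN -!big_split; apply: eq_bigr => m _.
rewrite !nc_sqr; case: (fourier u m) (fourier t m) => a b [x y] /=; ring.
Qed.

Lemma IO_sub_partial_sum u N : L2 u ->
  integralO (fun p => (u p - partial_sum N u p) ^+ 2) = integralO (fun p => u p ^+ 2) -
    \sum_(m <- box N) nc (fourier u m) ^+ 2.
Proof.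
move=> hu; have ht p := @partial_sumE N u p hu.
have cf m : m \in box N -> fourier (partial_sum N u) m = fourier u m.
  by move=> hm; rewrite (fourier_trig _ ht) hm.
rewrite (@IO_sub_trig u (partial_sum N u) N) //; last first.
- by move=> p; rewrite ht big_seq [RHS]big_seq; apply: eq_bigr => m /cf ->.
- exact: real_trig_partial_sum.
rewrite big_seq [X in _ - _ + X]big_seq [X in _ + X]big1 ?addr0 -?big_seq // => m /cf ->.
by rewrite subrr nc0 expr0n.
Qed.

Lemma bessel u N : L2 u ->
  \sum_(m <- box N) nc (fourier u m) ^+ 2 <= integralO (fun p => u p ^+ 2).
Proof.
move=> hu; rewrite -subr_ge0 -IO_sub_partial_sum //; apply: IO_ge0 => p.
exact: sqr_ge0.
Qed.

(** A partial sum over a box containing the frequencies of [t] is at least as close to [u] as [t]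
    is, so the density theorem applies. *)
Lemma parseval_limit u e : L2 u -> 0 < e -> exists N, forall M, (N <= M)%N ->
  integralO (fun p => (u p - partial_sum M u p) ^+ 2) <= e.
Proof.
move=> hu e0; have [_ /(_ e e0)[t rt ht]] := L2_trig_approximable hu.
have [N tE] := real_trigE rt; exists N => M NM.
rewrite IO_sub_partial_sum //; apply: le_trans ht.
rewrite (IO_sub_trig hu rt tE) -addrA lerD2l.
have : \sum_(m <- box N) nc (fourier u m) ^+ 2 <= \sum_(m <- box M) nc (fourier u m) ^+ 2.
  by apply: sum_subset_le; [exact: box_uniq|exact: box_sub|move=> m; exact: sqr_ge0].
have : 0 <= \sum_(m <- box N) nc (fourier u m - fourier t m) ^+ 2.
  by apply: sumr_ge0 => m _; exact: sqr_ge0.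
lra.
Qed.

Lemma parseval_le u B : L2 u -> wsum_le (fun k => nc (fourier u k) ^+ 2) B ->
  integralO (fun p => u p ^+ 2) <= B.
Proof.
move=> hu hB; apply/ler_addgt0Pr => e e0.
have [N /(_ N (leqnn N))] := parseval_limit hu e0.
rewrite IO_sub_partial_sum // lerBlDr => /le_trans; apply.
by rewrite addrC lerD2r hB // box_uniq.
Qed.

Lemma parseval_ge u : L2 u -> wsum_le (fun k => nc (fourier u k) ^+ 2) (integralO (fun p => u p ^+ 2)).
Proof.
by move=> hu; apply: wsum_le_box => [k|N]; [exact: sqr_ge0|exact: bessel].
Qed.

Lemma nc_fourier_le u k : L2 u -> nc (fourier u k) ^+ 2 <= integralO (fun p => u p ^+ 2).
Proof.
by move=> hu; have := @parseval_ge u hu [:: k] isT; rewrite big_seq1.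
Qed.

End FourierCoefficients.

(** * Coefficients of products and of derivatives *)

Section ProductsAndDerivatives.
Variable R : realType.

(** The unfolding of [fourier], recorded before the constant is made opaque. *)
Lemma fourier_inner (u : R * R -> R) k : fourier u k = inner (of_real u) (expmode k).
Proof. by []. Qed.

Opaque fourier.

Local Notation Om := (@Omega R).
Local Notation C := (real_complex R).
Implicit Types (u v f t : R * R -> R) (g : R * R -> R[i]) (k m : int * int) (c : int * int -> R[i]).

Lemma fourier_mulE u v k : L2 u -> L2 v -> fourier (fun p => u p * v p) k =
  Complex (integralO (fun p => cos (phase k p) * u p * v p))
    (- integralO (fun p => sin (phase k p) * u p * v p)).
Proof.
move=> hu hv; rewrite fourier_inner /inner; congr Complex.
  by apply: eq_IO => p _; rewrite expmodeE /=; ring.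
have hs : L2 (fun p => sin (phase k p) * u p).
  by apply: (@L2_mul_bounded _ _ _ 1) => //; [exact: measurable2_sin|move=> p; exact: sin_bound].
rewrite -[RHS]mulN1r -IO_Z; last exact: intg_mul.
by apply: eq_IO => p _; rewrite expmodeE /=; ring.
Qed.

(** A product of two L^2 functions is merely integrable, yet its coefficients are limits of finite
    convolutions: replacing [v] by a partial sum costs, by Cauchy-Schwarz, the norm of [u] times
    that of the remainder. *)
Lemma fourier_product_limit u v k e : L2 u -> L2 v -> 0 < e -> exists N, forall M, (N <= M)%N ->
  nc (fourier (fun p => u p * v p) k - \sum_(m <- box M) fourier u (k - m) * fourier v m) <= e.
Proof.
move=> hu hv e0.
set U := integralO (fun p => u p ^+ 2).
have U0 : 0 <= U by apply: IO_ge0 => p; exact: sqr_ge0.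
(* The [+ 1] covers [U = 0]; the 2 shares the error between real and imaginary part. *)
have e1 : 0 < e ^+ 2 / (2 * (U + 1)) by rewrite divr_gt0 ?exprn_gt0 ?mulr_gt0 //; lra.
have [N H] := parseval_limit hv e1; exists N => M /H hM.
have hS := real_trig_L2 (real_trig_partial_sum M hv).
have hd := L2_B hv hS.
rewrite -(fourier_mul_trig k hu (fun p => partial_sumE M p hv)) !fourier_mulE //.
have hw (w : R * R -> R) : measurable2 w -> (forall p, `|w p| <= 1) ->
    (integralO (fun p => w p * u p * v p) - integralO (fun p => w p * u p * partial_sum M v p)) ^+ 2
    <= e ^+ 2 / 2.
  move=> mw w1; have hwu : L2 (fun p => w p * u p) by exact: L2_mul_bounded mw w1 hu.
  have -> : integralO (fun p => w p * u p * v p) - integralO (fun p => w p * u p * partial_sum M v p)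
      = integralO (fun p => w p * u p * (v p - partial_sum M v p)).
    rewrite -[X in _ + X]mulN1r -IO_Z; last exact: intg_mul.
    rewrite -IO_D; [|exact: intg_mul|by apply: intgZ; exact: intg_mul].
    by apply: eq_IO => p _; ring.
  apply: le_trans (IO_cauchy_schwarz hwu hd) _.
  apply: (@le_trans _ _ (U * (e ^+ 2 / (2 * (U + 1))))).
    apply: ler_pM => //; try by apply: IO_ge0 => p; exact: sqr_ge0.
    have [_ iu] := hu; have [_ iwu] := hwu; apply: IO_le => // p _.
    rewrite exprMn ler_piMl ?sqr_ge0 // -[w p ^+ 2]real_normK ?num_real //.
    by rewrite exprn_ile1.
  have U1 : 0 < U + 1 by lra.
  have -> : U * (e ^+ 2 / (2 * (U + 1))) = U / (U + 1) * (e ^+ 2 / 2).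
    by field; rewrite gt_eqF.
  rewrite ler_piMl ?divr_ge0 ?sqr_ge0 // ler_pdivrMr //; lra.
have h1 := hw _ (@measurable2_cos R k) (fun p => cos_bound _).
have h2 := hw _ (@measurable2_sin R k) (fun p => sin_bound _).
rewrite -(ler_pXn2r (n := 2)) ?nnegrE ?nc_ge0 ?(ltW e0) // nc_sqr /=.
by move: h1 h2; set a := integralO _; set b := integralO _; set a' := integralO _; set b' := integralO _; nra.
Qed.

Lemma phaseE k p : phase k p = kap1 R k * p.1 + kap2 R k * p.2.
Proof. by rewrite /phase /kap1 /kap2; ring. Qed.

Lemma is_derive_cos_fst k (a x y : R) :
  is_derive x 1 (fun s => a * cos (phase k (s, y))) (a * - (kap1 R k * sin (phase k (x, y)))).
Proof.
have H := is_derive_cos_affine (kap1 R k) (kap2 R k * y) x.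
rewrite (_ : (fun s => _) = a \*: (fun s : R => cos (kap1 R k * s + kap2 R k * y))).
  by apply: is_derive_eq; rewrite phaseE.
by apply/funext => s; rewrite phaseE.
Qed.

Lemma is_derive_cos_snd k (a x y : R) :
  is_derive y 1 (fun s => a * cos (phase k (x, s))) (a * - (kap2 R k * sin (phase k (x, y)))).
Proof.
have H := is_derive_cos_affine (kap2 R k) (kap1 R k * x) y.
rewrite (_ : (fun s => _) = a \*: (fun s : R => cos (kap2 R k * s + kap1 R k * x))).
  by apply: is_derive_eq; rewrite phaseE addrC.
by apply/funext => s; rewrite phaseE addrC.
Qed.

Lemma is_derive_sin_fst k (a x y : R) :
  is_derive x 1 (fun s => a * sin (phase k (s, y))) (a * (kap1 R k * cos (phase k (x, y)))).
Proof.
have H := is_derive_sin_affine (kap1 R k) (kap2 R k * y) x.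
rewrite (_ : (fun s => _) = a \*: (fun s : R => sin (kap1 R k * s + kap2 R k * y))).
  by apply: is_derive_eq; rewrite phaseE.
by apply/funext => s; rewrite phaseE.
Qed.

Lemma is_derive_sin_snd k (a x y : R) :
  is_derive y 1 (fun s => a * sin (phase k (x, s))) (a * (kap2 R k * cos (phase k (x, y)))).
Proof.
have H := is_derive_sin_affine (kap2 R k) (kap1 R k * x) y.
rewrite (_ : (fun s => _) = a \*: (fun s : R => sin (kap2 R k * s + kap1 R k * x))).
  by apply: is_derive_eq; rewrite phaseE addrC.
by apply/funext => s; rewrite phaseE addrC.
Qed.

Lemma is_derive_bigsum (I : Type) (s : seq I) (F : I -> R -> R) (dF : I -> R) (x : R) :
  (forall i, is_derive x 1 (F i) (dF i)) ->
  is_derive x 1 (fun y => \sum_(i <- s) F i y) (\sum_(i <- s) dF i).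
Proof.
move=> H; elim: s => [|i s IH].
  rewrite big_nil (_ : (fun y => _) = cst 0); first exact: is_derive_cst.
  by apply/funext => y; rewrite big_nil.
rewrite big_cons (_ : (fun y => _) = F i + (fun y => \sum_(j <- s) F j y)).
  exact: is_deriveD.
by apply/funext => y; rewrite big_cons.
Qed.

Lemma derive1_of_is_derive (h : R -> R) (x l : R) : is_derive x 1 h l -> derive1 h x = l.
Proof. by move=> [_ H]; rewrite derive1E. Qed.

Let trig_re t N c : (forall p, of_real t p = \sum_(m <- box N) c m * expmode m p) ->
  t = (fun p => \sum_(m <- box N) (complex.Re (c m) * cos (phase m p) +
     (- complex.Im (c m)) * sin (phase m p))).
Proof.
move=> H; apply/funext => p; rewrite -[LHS]/(complex.Re (of_real t p)) H Re_sum.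
by apply: eq_bigr => m _; rewrite expmodeE; case: (c m) => a b /=; rewrite mulNr.
Qed.

(** Common to both partial derivatives: [kap] is the symbol of the derivative without the imaginary
    unit, and its oddness keeps the differentiated sum real. *)
Lemma trig_derivative t N (kap : int * int -> R) (dt : R * R -> R) :
  L2 t -> (forall k, kap (- k) = - kap k) ->
  (forall p, of_real t p = \sum_(m <- box N) fourier t m * expmode m p) ->
  (forall p, dt p = \sum_(m <- box N) (complex.Re (fourier t m) * - (kap m * sin (phase m p)) +
     (- complex.Im (fourier t m)) * (kap m * cos (phase m p)))) ->
  real_trig dt /\ forall k, fourier dt k = Complex 0 (kap k) * fourier t k.
Proof.
move=> L2t kN ht hdt.
have dtE p : of_real dt p = \sum_(m <- box N) (Complex 0 (kap m) * fourier t m) * expmode m p.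
  rewrite /of_real.
  have := @hermitian_sum_real R N (fun m => Complex 0 (kap m) * fourier t m) p.
  set S := \sum_(m <- box N) _ => hS.
  have -> : dt p = complex.Re S.
    rewrite hdt /S Re_sum; apply: eq_bigr => m _.
    by rewrite expmodeE; case: (fourier t m) => a b /=; ring.
  suff : complex.Im S = 0 by case: (S) => a b /= ->.
  apply: hS => k; rewrite fourierN // kN; case: (fourier t k) => x y.
  by apply/eqP; rewrite eq_complex /=; apply/andP; split; apply/eqP; ring.
split; first by exists N, (fun m => Complex 0 (kap m) * fourier t m).
move=> k; rewrite (fourier_trig _ dtE); case: ifP => // hk.
by rewrite (fourier_trig _ ht) hk mulr0.
Qed.

Lemma pd1_trig t : real_trig t ->
  real_trig (pd1 t) /\ forall k, fourier (pd1 t) k = Complex 0 (kap1 R k) * fourier t k.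
Proof.
move=> rt; have [N ht] := real_trigE rt.
apply: (trig_derivative (N := N)) => //; first exact: real_trig_L2.
  by move=> k; rewrite /kap1 /= mulrNz mulrN.
move=> [x y]; apply: derive1_of_is_derive.
rewrite (_ : (fun s => t (s, _)) = fun s => \sum_(m <- box N)
  (complex.Re (fourier t m) * cos (phase m (s, y)) +
   (- complex.Im (fourier t m)) * sin (phase m (s, y)))); last first.
  by apply/funext => s; rewrite {1}(trig_re ht).
apply: is_derive_bigsum => m; apply: is_deriveD.
  exact: is_derive_cos_fst.
exact: is_derive_sin_fst.
Qed.

Lemma pd2_trig t : real_trig t ->
  real_trig (pd2 t) /\ forall k, fourier (pd2 t) k = Complex 0 (kap2 R k) * fourier t k.
Proof.
move=> rt; have [N ht] := real_trigE rt.
apply: (trig_derivative (N := N)) => //; first exact: real_trig_L2.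
  by move=> k; rewrite /kap2 /= mulrNz mulrN.
move=> [x y]; apply: derive1_of_is_derive.
rewrite (_ : (fun s => t (_, s)) = fun s => \sum_(m <- box N)
  (complex.Re (fourier t m) * cos (phase m (x, s)) +
   (- complex.Im (fourier t m)) * sin (phase m (x, s)))); last first.
  by apply/funext => s; rewrite {1}(trig_re ht).
apply: is_derive_bigsum => m; apply: is_deriveD.
  exact: is_derive_cos_snd.
exact: is_derive_sin_snd.
Qed.

Lemma lap_trig t : real_trig t ->
  real_trig (lap t) /\ forall k, fourier (lap t) k = - C (kapsq R k) * fourier t k.
Proof.
move=> rt.
have [r1 f1] := pd1_trig rt; have [r11 f11] := pd1_trig r1.
have [r2 f2] := pd2_trig rt; have [r22 f22] := pd2_trig r2.
split; first exact: real_trigD.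
move=> k; rewrite /lap fourierD; [|exact: real_trig_L2..].
transitivity (Complex 0 (kap1 R k) * (Complex 0 (kap1 R k) * fourier t k) +
    Complex 0 (kap2 R k) * (Complex 0 (kap2 R k) * fourier t k)).
  exact: congr2 (etrans (f11 k) (congr1 (fun x => _ * x) (f1 k)))
    (etrans (f22 k) (congr1 (fun x => _ * x) (f2 k))).
rewrite /kapsq; case: (fourier t k) => a b.
by apply/eqP; rewrite eq_complex /=; apply/andP; split; apply/eqP; ring.
Qed.

Lemma divergence_trig t f : real_trig t -> real_trig f ->
  real_trig (divergence t f) /\ forall k, fourier (divergence t f) k =
    Complex 0 (kap1 R k) * fourier t k + Complex 0 (kap2 R k) * fourier f k.
Proof.
move=> rt rf; have [r1 f1] := pd1_trig rt; have [r2 f2] := pd2_trig rf.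
split; first exact: real_trigD.
by move=> k; rewrite /divergence fourierD ?f1 ?f2 //; exact: real_trig_L2.
Qed.

End ProductsAndDerivatives.

(** * Fourier form of the Galerkin and of the distributional equations *)

Section WeakForms.
Variable R : realType.
Opaque fourier.
Local Notation Om := (@Omega R).
Local Notation C := (real_complex R).
Implicit Types (u v f t : R * R -> R) (g : R * R -> R[i]) (k m : int * int) (c : int * int -> R[i]).

Lemma SN_sum N c : SN N (fun p => \sum_(m <- box N) c m * expmode m p).
Proof.
exists (fun i j => c (i%:Z - N%:Z, j%:Z - N%:Z)) => p; rewrite /box big_allpairs /zrange -lock big_map
  -[iota 0%N _]/(index_iota 0 (2 * N).+1) big_mkord.
by apply: eq_bigr => i _; rewrite big_map big_mkord.
Qed.

Lemma SN_box N g : SN N g -> exists c, forall p, g p = \sum_(m <- box N) c m * expmode m p.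
Proof.
(* The given coefficients are indexed by ordinals; [inord] of the shifted frequency recovers the
   index. *)
move=> [d H]; exists (fun m => d (inord (absz (m.1 + N%:Z)%R)) (inord (absz (m.2 + N%:Z)%R))) => p.
rewrite H /box big_allpairs /zrange -lock big_map
  -[iota 0%N _]/(index_iota 0 (2 * N).+1) big_mkord.
apply: eq_bigr => i _; rewrite big_map big_mkord.
by apply: eq_bigr => j _; rewrite /= !subrK /= !inord_val.
Qed.

Lemma SN_expmode N k : k \in box N -> SN N (expmode k : R * R -> R[i]).
Proof.
move=> hk; have := SN_sum N (fun m => if m == k then 1 else 0); congr (SN N _).
apply/funext => p; rewrite (bigD1_seq k) ?box_uniq //= eqxx mul1r big1 ?addr0 // => m /negPf ->.
by rewrite mul0r.
Qed.

Lemma SN0 N : SN N (fun _ : R * R => 0 : R[i]).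
Proof.
have := SN_sum N (fun=> 0); congr (SN N _); apply/funext => p.
by rewrite big1 // => m _; rewrite mul0r.
Qed.

Lemma SN_real_trig N u : SN_real N u -> real_trig u.
Proof. by move=> /SN_box[c H]; exists N, c. Qed.

Lemma SN_realE N u : SN_real N u ->
  (forall p, of_real u p = \sum_(m <- box N) fourier u m * expmode m p) /\
  (forall k, k \notin box N -> fourier u k = 0).
Proof.
move=> /SN_box[c H]; split => [p|k /negPf hk].
  rewrite H big_seq [RHS]big_seq; apply: eq_bigr => m hm.
  by rewrite (fourier_trig _ H) hm.
by rewrite (fourier_trig _ H) hk.
Qed.

Lemma ip_expmode u k : ip u (expmode k) = fourier u k.
Proof. by rewrite fourier_inner. Qed.

Lemma ip0 u : ip u (fun=> 0) = 0.
Proof.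
apply/eqP; rewrite eq_complex /ip /inner /=; apply/andP; split; apply/eqP.
  by rewrite -[RHS](@IO_cst R); apply: eq_IO => p _; rewrite mulr0 mul0r subr0.
by rewrite -[RHS](@IO_cst R); apply: eq_IO => p _; ring.
Qed.

Lemma fourier_cconv N u v k : SN_real N v -> L2 u ->
  fourier (fun p => u p * v p) k = cconv N (fourier u) (fourier v) k.
Proof. by move=> /SN_realE[vE _] hu; rewrite (fourier_mul_trig _ hu vE). Qed.

Lemma vip_l f1 f2 chi : vip f1 f2 chi (fun=> 0) = ip f1 chi.
Proof. by rewrite /vip ip0 addr0. Qed.

Lemma vip_r f1 f2 chi : vip f1 f2 (fun=> 0) chi = ip f2 chi.
Proof. by rewrite /vip ip0 add0r. Qed.

(** Replaces the five summands of a Galerkin equation at once, while the operators in them stay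
    opaque. *)
Lemma subst_combination (a b c d x1 x2 x3 x4 x5 y1 y2 y3 y4 y5 : R[i]) :
  x1 = y1 -> x2 = y2 -> x3 = y3 -> x4 = y4 -> x5 = y5 ->
  x1 + a * x2 + b * x3 + c * x4 - d * x5 = 0 ->
  y1 + a * y2 + b * y3 + c * y4 - d * y5 = 0.
Proof. by move=> -> -> -> -> ->. Qed.

Lemma vip_expmode_l f1 f2 k : vip f1 f2 (expmode k) (fun=> 0) = fourier f1 k.
Proof. by rewrite vip_l ip_expmode. Qed.

Lemma vip_expmode_r f1 f2 k : vip f1 f2 (fun=> 0) (expmode k) = fourier f2 k.
Proof. by rewrite vip_r ip_expmode. Qed.

Section Galerkin.
Opaque ip vip expmode pd1 pd2 lap divergence.
Variables (N : nat) (a b c d gamma delta : R) (z v1 v2 zt v1t v2t : R * R -> R).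
Hypotheses (Sz : SN_real N z) (S1 : SN_real N v1) (S2 : SN_real N v2)
  (Szt : SN_real N zt) (S1t : SN_real N v1t) (S2t : SN_real N v2t).

(** Test functions are [expmode k] and the pairs having it in one component and 0 in the other.
    Since the velocity factors lie in S_N, the products have finite convolutions as coefficients,
    and no residual arises here. *)
Lemma galerkin_fourier_system k : galerkin N a b c d gamma delta z v1 v2 zt v1t v2t ->
  k \in box N ->
  fourier_system a b (coef_c gamma c) d (coef_r1 gamma delta) (coef_r2 gamma)
    (lambda gamma delta) k (fourier z k) (fourier v1 k) (fourier v2 k)
    (fourier zt k) (fourier v1t k) (fourier v2t k)
    (cconv N (fourier z) (fourier v1) k) (cconv N (fourier z) (fourier v2) k)
    (cconv N (fourier v1) (fourier v1) k + cconv N (fourier v2) (fourier v2) k).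
Proof.
move=> [G1 G2] hk.
have Tz := SN_real_trig Sz; have T1 := SN_real_trig S1; have T2 := SN_real_trig S2.
have Tzt := SN_real_trig Szt; have T1t := SN_real_trig S1t; have T2t := SN_real_trig S2t.
have [Td Fd] := divergence_trig T1 T2.
have [Tnl Fnl] := divergence_trig (real_trigM Tz T1) (real_trigM Tz T2).
have Tvv : real_trig (fun p => v1 p ^+ 2 + v2 p ^+ 2).
  by apply: real_trigD; exact: real_trigX.
have Fvv : fourier (fun p => v1 p ^+ 2 + v2 p ^+ 2) k =
    cconv N (fourier v1) (fourier v1) k + cconv N (fourier v2) (fourier v2) k.
  rewrite fourierD; [|by apply: real_trig_L2; exact: real_trigX..].
  by rewrite -!fourier_cconv //; exact: real_trig_L2.
have [Tz1 Fz1] := pd1_trig Tz; have [Tz2 Fz2] := pd2_trig Tz.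
have [_ Fvv1] := pd1_trig Tvv; have [_ Fvv2] := pd2_trig Tvv.
have [_ Fld] := lap_trig Td; have [_ Flzt] := lap_trig Tzt.
have [_ Fl1] := lap_trig T1t; have [_ Fl2] := lap_trig T2t.
have [_ Flz1] := lap_trig Tz1; have [_ Flz2] := lap_trig Tz2.
set Q := (cconv N (fourier v1) (fourier v1) k + cconv N (fourier v2) (fourier v2) k) in Fvv *.
split.
- have := subst_combination (ip_expmode zt k) (etrans (ip_expmode _ k) (Fd k))
    (etrans (ip_expmode _ k) (etrans (Fnl k) (congr2 (fun x y => _ * x + _ * y)
       (fourier_cconv k S1 (real_trig_L2 Tz)) (fourier_cconv k S2 (real_trig_L2 Tz)))))
    (etrans (ip_expmode _ k) (etrans (Fld k) (congr1 (fun x => _ * x) (Fd k))))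
    (etrans (ip_expmode _ k) (Flzt k)) (G1 _ (SN_expmode hk)).
  move=> H; rewrite -[RHS]H.
  case: (fourier z k) (fourier v1 k) (fourier v2 k) (fourier zt k) => [z1 z2] [x1 x2] [y1 y2] [t1 t2].
  case: (cconv _ _ _ _) (cconv _ _ _ _) => [p1 p2] [q1 q2].
  by apply/eqP; rewrite eq_complex /=; apply/andP; split; apply/eqP; ring.
- have := subst_combination (vip_expmode_l v1t v2t k) (etrans (vip_expmode_l _ _ k) (Fz1 k))
    (etrans (vip_expmode_l _ _ k) (etrans (Fvv1 k) (congr1 (fun x => _ * x) Fvv)))
    (etrans (vip_expmode_l _ _ k) (etrans (Flz1 k) (congr1 (fun x => _ * x) (Fz1 k))))
    (etrans (vip_expmode_l _ _ k) (Fl1 k)) (G2 _ _ (SN_expmode hk) (SN0 N)).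
  move=> H; rewrite -[RHS]H.
  case: (fourier z k) (fourier v1t k) (Q) => [z1 z2] [x1 x2] [q1 q2].
  by apply/eqP; rewrite eq_complex /=; apply/andP; split; apply/eqP; ring.
- have := subst_combination (vip_expmode_r v1t v2t k) (etrans (vip_expmode_r _ _ k) (Fz2 k))
    (etrans (vip_expmode_r _ _ k) (etrans (Fvv2 k) (congr1 (fun x => _ * x) Fvv)))
    (etrans (vip_expmode_r _ _ k) (etrans (Flz2 k) (congr1 (fun x => _ * x) (Fz2 k))))
    (etrans (vip_expmode_r _ _ k) (Fl2 k)) (G2 _ _ (SN0 N) (SN_expmode hk)).
  move=> H; rewrite -[RHS]H.
  case: (fourier z k) (fourier v2t k) (Q) => [z1 z2] [x1 x2] [q1 q2].
  by apply/eqP; rewrite eq_complex /=; apply/andP; split; apply/eqP; ring.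
Qed.

Transparent ip vip expmode pd1 pd2 lap divergence.
End Galerkin.

(** Distributions are tested on real functions, hence on cosines and sines; the amplitude [a] makes
    the family stable under [pd1] and [pd2]. *)
Definition trig_mode (s : bool) k (a : R) : R * R -> R :=
  fun p => a * (if s then sin (phase k p) else cos (phase k p)).

Lemma pd1_mode s k a : pd1 (trig_mode s k a) =
  trig_mode (~~ s) k (a * (if s then kap1 R k else - kap1 R k)).
Proof.
apply/funext => -[x y]; apply: derive1_of_is_derive; rewrite /trig_mode /=.
case: s => /=.
  by have := is_derive_sin_fst k a x y; congr is_derive; ring.
by have := is_derive_cos_fst k a x y; congr is_derive; ring.
Qed.

Lemma pd2_mode s k a : pd2 (trig_mode s k a) =
  trig_mode (~~ s) k (a * (if s then kap2 R k else - kap2 R k)).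
Proof.
apply/funext => -[x y]; apply: derive1_of_is_derive; rewrite /trig_mode /=.
case: s => /=.
  by have := is_derive_sin_snd k a x y; congr is_derive; ring.
by have := is_derive_cos_snd k a x y; congr is_derive; ring.
Qed.

Lemma continuous_mode s k a : continuous (trig_mode s k a).
Proof.
have cp : continuous (phase k : R * R -> R).
  move=> p; rewrite /phase; apply: cvgM; first exact: cvg_cst.
  by apply: cvgD; (apply: cvgM; first exact: cvg_cst); [exact: cvg_fst|exact: cvg_snd].
move=> p; apply: cvgM; first exact: cvg_cst.
case: s.
  by apply: (continuous_comp (cp p)); exact: continuous_sin.
by apply: (continuous_comp (cp p)); exact: continuous_cos.
Qed.

Lemma test_mode s k a : test_function (trig_mode s k a).
Proof.
split.
  move=> x y; rewrite /trig_mode.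
  have -> : phase k (x + 1, y) = 2 * pi * k.1%:~R + phase k (x, y) by rewrite /phase /=; ring.
  have -> : phase k (x, y + 1) = 2 * pi * k.2%:~R + phase k (x, y) by rewrite /phase /=; ring.
  by rewrite !sin_period_int !cos_period_int.
move=> l; have [s' [a' ->]] : exists s' a', partials l (trig_mode s k a) = trig_mode s' k a'.
  elim: l => [|b l [s' [a' IH]]] /=; first by exists s, a.
  by rewrite IH; case: b; rewrite ?pd1_mode ?pd2_mode; eexists; eexists.
split; first exact: continuous_mode.
move=> x y; rewrite /trig_mode; case: s'; split.
- by have [] := is_derive_sin_fst k a' x y.
- by have [] := is_derive_sin_snd k a' x y.
- by have [] := is_derive_cos_fst k a' x y.
- by have [] := is_derive_cos_snd k a' x y.
Qed.

(* [homogeneous D]: enough linearity of the distribution [D] to compute the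
   Fourier coefficients of its derivatives. *)
Definition homogeneous (D : distr R) : Prop :=
  forall s k a, D (trig_mode s k a) = a * D (trig_mode s k 1).

(** The pairing with exp(-i phase), reassembled from a cosine and a sine. *)
Definition distr_fourier (D : distr R) k : R[i] :=
  Complex (D (trig_mode false k 1)) (- D (trig_mode true k 1)).

Lemma homogeneous_dd1 D : homogeneous D -> homogeneous (dd1 D) /\
  forall k, distr_fourier (dd1 D) k = Complex 0 (kap1 R k) * distr_fourier D k.
Proof.
move=> hD; split => [s k a|k].
  by rewrite /dd1 !pd1_mode hD [in RHS]hD; ring.
rewrite /distr_fourier /dd1 !pd1_mode /= hD (hD false k (1 * _)).
by apply/eqP; rewrite eq_complex /=; apply/andP; split; apply/eqP; ring.
Qed.

Lemma homogeneous_dd2 D : homogeneous D -> homogeneous (dd2 D) /\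
  forall k, distr_fourier (dd2 D) k = Complex 0 (kap2 R k) * distr_fourier D k.
Proof.
move=> hD; split => [s k a|k].
  by rewrite /dd2 !pd2_mode hD [in RHS]hD; ring.
rewrite /distr_fourier /dd2 !pd2_mode /= hD (hD false k (1 * _)).
by apply/eqP; rewrite eq_complex /=; apply/andP; split; apply/eqP; ring.
Qed.

Lemma distr_fourierD D D' k : distr_fourier (fun phi => D phi + D' phi) k =
  distr_fourier D k + distr_fourier D' k.
Proof. by apply/eqP; rewrite eq_complex /= opprD !eqxx. Qed.

Lemma homogeneous_lap D : homogeneous D -> homogeneous (dlap D) /\
  forall k, distr_fourier (dlap D) k = - C (kapsq R k) * distr_fourier D k.
Proof.
move=> hD.
have [h1 f1] := homogeneous_dd1 hD; have [h11 f11] := homogeneous_dd1 h1.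
have [h2 f2] := homogeneous_dd2 hD; have [h22 f22] := homogeneous_dd2 h2.
split => [s k a|k].
  by rewrite /dlap h11 h22 mulrDr.
rewrite distr_fourierD; transitivity (Complex 0 (kap1 R k) * (Complex 0 (kap1 R k) * distr_fourier D k)
    + Complex 0 (kap2 R k) * (Complex 0 (kap2 R k) * distr_fourier D k)).
  exact: congr2 (etrans (f11 k) (congr1 (fun x => _ * x) (f1 k)))
    (etrans (f22 k) (congr1 (fun x => _ * x) (f2 k))).
rewrite /kapsq; case: (distr_fourier D k) => x y.
by apply/eqP; rewrite eq_complex /=; apply/andP; split; apply/eqP; ring.
Qed.

Lemma distr_fourier_div D D' k : homogeneous D -> homogeneous D' ->
  distr_fourier (ddiv D D') k =
  Complex 0 (kap1 R k) * distr_fourier D k + Complex 0 (kap2 R k) * distr_fourier D' k.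
Proof.
move=> hD hD'; rewrite distr_fourierD.
by have [_ ->] := homogeneous_dd1 hD; have [_ ->] := homogeneous_dd2 hD'.
Qed.

Lemma intg_mul_bounded u f : intg u -> measurable2 u -> measurable2 f -> (forall p, `|f p| <= 1) ->
  intg (fun p => u p * f p).
Proof.
move=> iu mu_ mf f1.
have hn : intg (fun p => `|u p|).
  by have := integrable_norm iu.
apply: intg_le hn; first exact: measurable2M.
by move=> p; rewrite normrM ler_piMr.
Qed.

(** Stated for integrable functions so as to cover products of two L^2 functions. *)
Lemma regular_fourier u : intg u -> measurable2 u ->
  homogeneous (regular u) /\ forall k, distr_fourier (regular u) k = fourier u k.
Proof.
move=> iu mu_.
have hc k := intg_mul_bounded iu mu_ (@measurable2_cos R k) (fun p => cos_bound _).
have hs k := intg_mul_bounded iu mu_ (@measurable2_sin R k) (fun p => sin_bound _).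
split => [s k a|k].
  rewrite /regular /trig_mode; case: s.
    rewrite -IO_Z; last by have := hs k; congr intg; apply/funext => p; rewrite mul1r.
    by apply: eq_IO => p _; ring.
  rewrite -IO_Z; last by have := hc k; congr intg; apply/funext => p; rewrite mul1r.
  by apply: eq_IO => p _; ring.
rewrite fourier_inner /inner /distr_fourier /regular /trig_mode; congr Complex.
  by apply: eq_IO => p _; rewrite expmodeE /=; ring.
rewrite -mulN1r -IO_Z; last by have := hs k; congr intg; apply/funext => p; rewrite mul1r.
by apply: eq_IO => p _; rewrite expmodeE /=; ring.
Qed.

Lemma regular_product u v : L2 u -> L2 v ->
  homogeneous (regular (fun p => u p * v p)) /\
  forall k, distr_fourier (regular (fun p => u p * v p)) k = fourier (fun p => u p * v p) k.
Proof.
move=> hu hv; apply: regular_fourier; first exact: intg_mul.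
by apply: measurable2M; [case: hu|case: hv].
Qed.

Lemma distr_fourier_combination k (D1 D2 D3 D4 D5 : distr R) (a b c d : R) (y1 y2 y3 y4 y5 : R[i]) :
  distr_fourier D1 k = y1 -> distr_fourier D2 k = y2 -> distr_fourier D3 k = y3 ->
  distr_fourier D4 k = y4 -> distr_fourier D5 k = y5 ->
  (forall s, let phi := trig_mode s k 1 in
    D1 phi - a * D2 phi + b * D3 phi + c * D4 phi + d * D5 phi = 0) ->
  y1 - C a * y2 + C b * y3 + C c * y4 + C d * y5 = 0.
Proof.
move=> <- <- <- <- <- H; rewrite /distr_fourier; apply/eqP; rewrite eq_complex /=.
apply/andP; split; apply/eqP.
  by rewrite -[RHS](H false) /=; ring.
transitivity (- 0 : R); last exact: oppr0.
by rewrite -[in RHS](H true) /=; ring.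
Qed.

Lemma boussinesq_fourier_system (a b c d gamma delta : R) (z v1 v2 zt v1t v2t : R * R -> R) k :
  L2 z -> L2 v1 -> L2 v2 -> L2 zt -> L2 v1t -> L2 v2t ->
  boussinesq a b c d gamma delta z v1 v2 zt v1t v2t ->
  fourier_system a b (coef_c gamma c) d (coef_r1 gamma delta) (coef_r2 gamma)
    (lambda gamma delta) k (fourier z k) (fourier v1 k) (fourier v2 k)
    (fourier zt k) (fourier v1t k) (fourier v2t k)
    (fourier (fun p => z p * v1 p) k) (fourier (fun p => z p * v2 p) k)
    (fourier (fun p => v1 p * v1 p) k + fourier (fun p => v2 p * v2 p) k).
Proof.
move=> hz h1 h2 hzt h1t h2t HB.
have reg u : L2 u -> homogeneous (regular u) /\ forall k, distr_fourier (regular u) k = fourier u k.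
  by move=> hu; apply: regular_fourier; [exact: intg_L2|case: hu].
have [gz fz] := reg _ hz; have [g1 f1] := reg _ h1; have [g2 f2] := reg _ h2.
have [gzt fzt] := reg _ hzt; have [g1t f1t] := reg _ h1t; have [g2t f2t] := reg _ h2t.
have [gp1 fp1] := regular_product hz h1; have [gp2 fp2] := regular_product hz h2.
have [gvv fvv] : homogeneous (regular (fun p => v1 p ^+ 2 + v2 p ^+ 2)) /\
    forall k, distr_fourier (regular (fun p => v1 p ^+ 2 + v2 p ^+ 2)) k =
      fourier (fun p => v1 p * v1 p) k + fourier (fun p => v2 p * v2 p) k.
  have [m1 i1] := h1; have [m2 i2] := h2.
  have [|g f] := @regular_fourier (fun p => v1 p ^+ 2 + v2 p ^+ 2) (intgD i1 i2).
    by apply: measurable2D; exact: measurable2_sqr.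
  split => // j; have [_ q1] := regular_product h1 h1; have [_ q2] := regular_product h2 h2.
  rewrite -q1 -q2 -distr_fourierD /distr_fourier.
  have e s : regular (fun p => v1 p ^+ 2 + v2 p ^+ 2) (trig_mode s j 1) =
    regular (fun p => v1 p * v1 p) (trig_mode s j 1) + regular (fun p => v2 p * v2 p) (trig_mode s j 1).
    have mt : measurable2 (trig_mode s j 1).
      by apply: measurable2Z; case: s; [exact: measurable2_sin|exact: measurable2_cos].
    have bt p : `|trig_mode s j 1 p| <= 1.
      by rewrite /trig_mode mul1r; case: s {mt}; [exact: sin_bound|exact: cos_bound].
    rewrite /regular -IO_D.
    + by apply: eq_IO => p _; ring.
    + by apply: intg_mul_bounded => //; exact: measurable2M.
    + by apply: intg_mul_bounded => //; exact: measurable2M.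
  by rewrite !e.
have [l1 fl1] := homogeneous_lap g1; have [l2 fl2] := homogeneous_lap g2.
have [_ flzt] := homogeneous_lap gzt; have [_ fl1t] := homogeneous_lap g1t.
have [_ fl2t] := homogeneous_lap g2t.
have [gz1 fz1] := homogeneous_dd1 gz; have [gz2 fz2] := homogeneous_dd2 gz.
have [_ flz1] := homogeneous_lap gz1; have [_ flz2] := homogeneous_lap gz2.
have [_ fvv1] := homogeneous_dd1 gvv; have [_ fvv2] := homogeneous_dd2 gvv.
have B s := HB _ (test_mode s k 1).
have div D D' y y' (hD : homogeneous D) (hD' : homogeneous D') :
    distr_fourier D k = y -> distr_fourier D' k = y' ->
    distr_fourier (ddiv D D') k = Complex 0 (kap1 R k) * y + Complex 0 (kap2 R k) * y'.
  by move=> <- <-; exact: distr_fourier_div.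
set Q := (fourier (fun p => v1 p * v1 p) k + fourier (fun p => v2 p * v2 p) k).
have fvvk : distr_fourier (regular (fun p => v1 p ^+ 2 + v2 p ^+ 2)) k = Q := fvv k.
have mulE (x y y' : R[i]) : y = y' -> x * y = x * y' by move->.
split.
- have H := distr_fourier_combination (fzt k) (etrans (flzt k) (mulE _ _ _ (fzt k)))
    (div _ _ _ _ g1 g2 (f1 k) (f2 k)) (div _ _ _ _ gp1 gp2 (fp1 k) (fp2 k))
    (div _ _ _ _ l1 l2 (etrans (fl1 k) (mulE _ _ _ (f1 k))) (etrans (fl2 k) (mulE _ _ _ (f2 k))))
    (fun s => let: And3 e _ _ := B s in e).
  rewrite -[RHS]H.
  case: (fourier z k) (fourier v1 k) (fourier v2 k) (fourier zt k) => [z1 z2] [x1 x2] [y1 y2] [t1 t2].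
  case: (fourier _ _) (fourier _ _) => [p1 p2] [q1 q2].
  by apply/eqP; rewrite eq_complex /=; apply/andP; split; apply/eqP; ring.
- have H := distr_fourier_combination (f1t k) (etrans (fl1t k) (mulE _ _ _ (f1t k)))
    (etrans (fz1 k) (mulE _ _ _ (fz k))) (etrans (fvv1 k) (mulE _ _ _ fvvk))
    (etrans (flz1 k) (mulE _ _ _ (etrans (fz1 k) (mulE _ _ _ (fz k)))))
    (fun s => let: And3 _ e _ := B s in e).
  rewrite -[RHS]H.
  case: (fourier z k) (fourier v1t k) (Q) => [z1 z2] [x1 x2] [q1 q2].
  by apply/eqP; rewrite eq_complex /=; apply/andP; split; apply/eqP; ring.
- have H := distr_fourier_combination (f2t k) (etrans (fl2t k) (mulE _ _ _ (f2t k)))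
    (etrans (fz2 k) (mulE _ _ _ (fz k))) (etrans (fvv2 k) (mulE _ _ _ fvvk))
    (etrans (flz2 k) (mulE _ _ _ (etrans (fz2 k) (mulE _ _ _ (fz k)))))
    (fun s => let: And3 _ _ e := B s in e).
  rewrite -[RHS]H.
  case: (fourier z k) (fourier v2t k) (Q) => [z1 z2] [x1 x2] [q1 q2].
  by apply/eqP; rewrite eq_complex /=; apply/andP; split; apply/eqP; ring.
Qed.

End WeakForms.

(** * Sobolev norms and regularity in time *)

Section SobolevNorms.
Variable R : realType.
Opaque fourier.
Local Notation Om := (@Omega R).
Local Notation C := (real_complex R).
Implicit Types (u v f : R * R -> R) (k m : int * int) (s B : R).

(** A bound on the squared norm, in place of the extended-valued [hnorm], so that real arithmetic
    suffices; [sob_hnorm] and [hnorm_sob] pass between the two. *)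
Definition sob s f B : Prop := wsum_le (fun k => wt R k `^ s * nc (fourier f k) ^+ 2) B.

Lemma sob_term_ge0 s f k : 0 <= wt R k `^ s * nc (fourier f k) ^+ 2.
Proof. by rewrite mulr_ge0 ?powR_ge0 ?sqr_ge0. Qed.

Lemma sob_hnorm s f B : sob s f B -> (hnorm s f <= (Num.sqrt B)%:E)%E.
Proof.
move=> h; have B0 := wsum_le_ge0 h.
rewrite /hnorm -[(Num.sqrt B)%:E]/(sqrte B%:E) lee_sqrt ?lee_fin //.
apply/ereal_supP => _ [X [finX _] <-].
rewrite fsbig_finite // sumEFin lee_fin; apply: h; exact: finmap.fset_uniq.
Qed.

Lemma hnorm_ge_sum s f (t : seq (int * int)) : uniq t ->
  ((\sum_(k <- t) wt R k `^ s * nc (fourier f k) ^+ 2)%:E <= hnorm s f ^+ 2)%E.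
Proof.
move=> ut; rewrite /hnorm sqr_sqrte; last first.
  by apply: esum_ge0 => k _; rewrite lee_fin; exact: sob_term_ge0.
apply: esum_ge; exists [set` t]; first by split => //; exact: finite_seq.
by rewrite -fsbig_seq // sumEFin.
Qed.

Lemma hnorm_sob s f B : (hnorm s f <= B%:E)%E -> sob s f (B ^+ 2).
Proof.
move=> h t ut; rewrite -lee_fin; apply: le_trans (hnorm_ge_sum s f ut) _.
by rewrite EFin_expe; have h0 := sqrte_ge0 _ : (0 <= hnorm s f)%E; rewrite lee_sqr // (le_trans h0).
Qed.

Lemma sobD s u v A B : L2 u -> L2 v -> sob s u A -> sob s v B ->
  sob s (fun p => u p + v p) (2 * A + 2 * B).
Proof.
move=> hu hv hA hB t ut.
apply: le_trans (lerD (ler_wpM2l (ler0n _ 2) (hA t ut)) (ler_wpM2l (ler0n _ 2) (hB t ut))).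
rewrite !mulr_sumr -big_split /=; apply: ler_sum => k _; rewrite fourierD //.
rewrite [X in _ <= X + _]mulrCA [X in _ <= _ + X]mulrCA -mulrDr.
by apply: ler_wpM2l (nc_sqrD _ _); exact: powR_ge0.
Qed.

Lemma sobZ s c u B : L2 u -> sob s u B -> sob s (fun p => c * u p) (c ^+ 2 * B).
Proof.
move=> hu hB t ut; apply: le_trans (ler_wpM2l (sqr_ge0 c) (hB t ut)).
rewrite mulr_sumr; apply: ler_sum => k _; rewrite fourierZ // ncM nc_real exprMn real_normK ?num_real //.
by apply: eq_lew; ring.
Qed.

Lemma sob_weaken s s' u B : s' <= s -> sob s u B -> sob s' u B.
Proof.
move=> ss; apply: wsum_le_weaken => // k; rewrite ler_wpM2r ?sqr_ge0 //.
by apply: ler_powR => //; exact: wt_ge1.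
Qed.

Lemma sob1 u B : sob 1 u B -> wsum_le (fun k => wt R k * nc (fourier u k) ^+ 2) B.
Proof. by apply: wsum_le_weaken => // k; rewrite powRr1. Qed.

Lemma nc_sob s u B k : 0 <= s -> sob s u B -> nc (fourier u k) ^+ 2 <= B.
Proof.
move=> s0 h; have := h [:: k] isT; rewrite big_seq1; apply: le_trans.
by rewrite ler_peMl ?sqr_ge0 // -(powRr0 (wt R k)) ler_powR.
Qed.

Lemma Hs_L2 s u : Hs s u -> L2 u.
Proof. by move=> [mu_ _ h _]; exact: l2norm_L2. Qed.

Lemma Hs_sob s u : Hs s u -> exists B, sob s u B.
Proof.
move=> [_ _ _ h].
have h0 : (0 <= hnorm s u)%E by exact: sqrte_ge0.
case: (hnorm s u) h h0 (@hnorm_sob s u) => [r _ _ H|//|//].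
by exists (r ^+ 2); exact: H.
Qed.

(** The exact solution meets its initial data only almost everywhere, a difference that coefficients
    do not see. *)
Lemma fourier_ae_eq u v k : L2 u -> L2 v -> {ae lebesgue2 R, forall p, u p = v p} ->
  fourier u k = fourier v k.
Proof.
move=> hu hv uv.
have IOae f : measurable2 f -> integralO (fun p => u p * f p) = integralO (fun p => v p * f p).
  move=> mf; rewrite /integralO /Rintegral; congr fine; apply: ae_eq_integral.
  + exact: measurable_Omega.
  + by apply/measurable_EFinP; apply: measurable2_Omega; apply: measurable2M => //; case: hu.
  + by apply/measurable_EFinP; apply: measurable2_Omega; apply: measurable2M => //; case: hv.
  + by apply: (@filterS _ _ (ae_filter_ringOfSetsType (lebesgue2 R)) _ _ _ uv) => p /= -> _.
rewrite !fourierE // (IOae _ (@measurable2_cos R k)) (IOae _ (@measurable2_sin R k)) //.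
Qed.

Lemma PN_fourier N u p k : is_PN N u p -> k \in box N -> fourier p k = fourier u k.
Proof. by move=> [_ H] hk; have := H _ (SN_expmode R hk); rewrite -!fourier_inner. Qed.

Section TimeRegularity.
Variables (T : R) (X : set (R * R -> R)) (nrm : (R * R -> R) -> \bar R).
Hypothesis XL2 : forall f, X f -> L2 f.
Variables u ut : R -> R * R -> R.
Hypothesis C1u : C1_time T X nrm u ut.
Implicit Types t e : R.

Let quotient s t : R * R -> R := fun p => (u s p - u t p) / (s - t) - ut t p.

Lemma C1_time_L2 t : 0 <= t <= T -> L2 (u t) /\ L2 (ut t).
Proof. by move=> /C1u[h1 h2 _ _]; split; exact: XL2. Qed.

Lemma C1_time_quotient t e : 0 <= t <= T -> 0 < e -> exists2 h : R, 0 < h &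
  forall s, 0 <= s <= T -> s != t -> `|s - t| < h -> (nrm (quotient s t) < e%:E)%E.
Proof.
move=> tT e0; have [_ _ H _] := C1u tT.
have /H : nbhs (0%E : \bar R) [set x | (x < e%:E)%E].
  by apply: open_nbhs_nbhs; split; [exact: open_ereal_lt_ereal|rewrite /= lte_fin].
move=> /nbhs_ballP[h /= h0 Hh]; exists h => // s sT st sh.
by apply: (Hh s) => //=; rewrite ?in_itv // /ball /= distrC.
Qed.

Lemma C1_time_cont t e : 0 <= t <= T -> 0 < e -> exists2 h : R, 0 < h &
  forall s, 0 <= s <= T -> `|s - t| < h -> (nrm (fun p => ut s p - ut t p)%R < e%:E)%E.
Proof.
move=> tT e0; have [_ _ _ H] := C1u tT.
have /H : nbhs (0%E : \bar R) [set x | (x < e%:E)%E].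
  by apply: open_nbhs_nbhs; split; [exact: open_ereal_lt_ereal|rewrite /= lte_fin].
move=> /nbhs_ballP[h /= h0 Hh]; exists h => // s sT sh.
by apply: (Hh s) => //=; rewrite ?in_itv // /ball /= distrC.
Qed.

Lemma L2_quotient s t : 0 <= s <= T -> 0 <= t <= T -> L2 (quotient s t).
Proof.
move=> /C1_time_L2[h1 _] /C1_time_L2[h2 h3]; apply: L2_B => //.
have := L2_Z (s - t)^-1 (L2_B h1 h2); congr L2.
by apply/funext => p; rewrite mulrC.
Qed.

Lemma quotientE s t p : s != t ->
  u s p = u t p + (s - t) * (quotient s t p + ut t p).
Proof.
rewrite /quotient -subr_eq0 => st; rewrite addrNK mulrCA divff // mulr1; ring.
Qed.

Lemma fourier_quotient s t k : 0 <= s <= T -> 0 <= t <= T -> s != t ->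
  fourier (u s) k - fourier (u t) k - C (s - t) * fourier (ut t) k =
  C (s - t) * fourier (quotient s t) k.
Proof.
move=> sT tT st; have [_ h2] := C1_time_L2 sT; have [h3 h4] := C1_time_L2 tT.
have hq := L2_quotient sT tT.
have -> : fourier (u s) k =
    fourier (fun p => u t p + (s - t) * (quotient s t p + ut t p)) k.
  by congr (fourier _ k); apply/funext => p; exact: quotientE.
by rewrite (fourierD _ h3 (L2_Z _ (L2_D hq h4))) (fourierZ _ _ (L2_D hq h4)) (fourierD _ hq h4); ring.
Qed.

(** Differentiability in [nrm] passes to each coefficient because, by the first hypothesis, [nrm]
    bounds coefficients. It is applied with [hnorm] to the exact solution and with [l2norm] to the
    Galerkin solution. *)
Lemma C1_time_fourier t k :
  (forall f e, L2 f -> (nrm f <= e%:E)%E -> nc (fourier f k) <= e) -> 0 <= t <= T ->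
  has_deriv T (fun s => complex.Re (fourier (u s) k)) t (complex.Re (fourier (ut t) k)) /\
  has_deriv T (fun s => complex.Im (fourier (u s) k)) t (complex.Im (fourier (ut t) k)).
Proof.
move=> hn tT.
have key e : 0 < e -> exists2 h : R, 0 < h & forall s, 0 <= s <= T -> `|s - t| < h ->
    nc (fourier (u s) k - fourier (u t) k - C (s - t) * fourier (ut t) k) <= e * `|s - t|.
  move=> e0; have [h h0 H] := C1_time_quotient tT e0; exists h => // s sT sh.
  have [->|st] := eqVneq s t.
    by rewrite !subrr rmorph0 mul0r subr0 nc0 normr0 mulr0.
  rewrite fourier_quotient // ncM nc_real mulrC ler_wpM2r // hn //; first exact: L2_quotient.
  by rewrite ltW // H.
split => e /key[h h0 H]; exists h => // s sT /(H _ sT).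
  apply: le_trans; apply: le_trans (Re_le_nc _).
  by case: (fourier (u s) k) (fourier (u t) k) (fourier (ut t) k) => [? ?] [? ?] [? ?] /=; rewrite mul0r subr0.
apply: le_trans; apply: le_trans (Im_le_nc _).
by case: (fourier (u s) k) (fourier (u t) k) (fourier (ut t) k) => [? ?] [? ?] [? ?] /=; rewrite mul0r addr0.
Qed.

End TimeRegularity.

Lemma hnorm_fourier_le s f e k : 0 <= s -> (hnorm s f <= e%:E)%E -> nc (fourier f k) <= e.
Proof.
move=> s0 h; have e0 : 0 <= e by rewrite -lee_fin; apply: le_trans h; exact: sqrte_ge0.
by have := nc_sob k s0 (hnorm_sob h); rewrite ler_pXn2r ?nnegrE // nc_ge0.
Qed.

Lemma l2norm_fourier_le f e k : L2 f -> (l2norm f <= e%:E)%E -> nc (fourier f k) <= e.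
Proof.
move=> hf; rewrite L2_l2norm // lee_fin => h.
have e0 : 0 <= e by apply: le_trans h; exact: sqrtr_ge0.
have I0 : 0 <= integralO (fun p => f p ^+ 2) by apply: IO_ge0 => p; exact: sqr_ge0.
have : nc (fourier f k) ^+ 2 <= e ^+ 2.
  apply: le_trans (nc_fourier_le k hf) _; rewrite -(sqr_sqrtr I0).
  by rewrite ler_pXn2r ?nnegrE ?sqrtr_ge0.
by rewrite ler_pXn2r ?nnegrE // nc_ge0.
Qed.

(** Near [t], [u s] is [u t] plus [s - t] times a function close to [ut t], which bounds it locally;
    compactness of the time interval, in the form of [locally_bounded], makes the bound uniform. *)
Lemma C1_time_sob_bounded (T s : R) (u ut : R -> R * R -> R) : 0 < T -> C1_time T (Hs s) (hnorm s) u ut ->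
  exists B, forall t, 0 <= t <= T -> sob s (u t) B /\ sob s (ut t) B.
Proof.
move=> T0 C1u.
have XL2 f : Hs s f -> L2 f by exact: Hs_L2.
have [A HA] : exists A, forall t, 0 <= t <= T -> sob s (u t) A.
  apply: (locally_bounded T0) => [t B B' BB' h|t tT]; first exact: wsum_le_weaken BB' h.
  have [hu hut] := C1_time_L2 XL2 C1u tT.
  have [/Hs_sob[B HB] /Hs_sob[B' HB'] _ _] := C1u _ tT.
  have [h h0 H] := C1_time_quotient C1u tT ltr01.
  exists (Num.min h 1); first by rewrite lt_min h0 /=.
  exists (2 * B + 2 * (2 * 1 + 2 * B')) => r rT; rewrite lt_min => /andP[rh r1].
  have B'0 := wsum_le_ge0 HB'; have B0 := wsum_le_ge0 HB.
  have [->|rt] := eqVneq r t.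
    by apply: wsum_le_weaken HB => //; lra.
  rewrite (_ : u r = fun p => u t p + (r - t) * (((u r p - u t p) / (r - t) - ut t p) + ut t p)); last first.
    by apply/funext => p; apply: quotientE.
  have hq := L2_quotient XL2 C1u rT tT.
  have hd := sobD hq hut (hnorm_sob (ltW (H _ rT rt rh))) HB'.
  apply: sobD => //; first by apply: L2_Z; exact: L2_D.
  apply: wsum_le_weaken (sobZ _ (L2_D hq hut) hd) => //; rewrite expr1n.
  apply: ler_piMl; first lra.
  by rewrite -real_normK ?num_real // expr_le1 // ltW.
have [B HB] : exists A, forall t, 0 <= t <= T -> sob s (ut t) A.
  apply: (locally_bounded T0) => [t B B' BB' h|t tT]; first exact: wsum_le_weaken BB' h.
  have [hu hut] := C1_time_L2 XL2 C1u tT.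
  have [_ /Hs_sob[B' HB'] _ _] := C1u _ tT.
  have [h h0 H] := C1_time_cont C1u tT ltr01.
  exists h => //; exists (2 * B' + 2 * 1) => r rT rh.
  have [_ hutr] := C1_time_L2 XL2 C1u rT.
  rewrite (_ : ut r = fun p => ut t p + (ut r p - ut t p)); last first.
    by apply/funext => p; ring.
  have := sobD hut (L2_B hutr hut) HB' (hnorm_sob (ltW (H _ rT rh))).
  by rewrite expr1n.
exists (Num.max A B) => t tT.
split; [apply: wsum_le_weaken (HA t tT)|apply: wsum_le_weaken (HB t tT)] => //.
  by rewrite le_max lexx.
by rewrite le_max lexx orbT.
Qed.

End SobolevNorms.

(** * Truncation to the box and the residual of a product *)

Lemma sum_support (V : nmodType) (I : eqType) (s t : seq I) (G : I -> V) :
  uniq s -> uniq t -> {subset s <= t} -> (forall i, i \notin s -> G i = 0) ->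
  \sum_(i <- s) G i = \sum_(i <- t) G i.
Proof.
move=> us ut st G0.
have -> : \sum_(i <- t) G i = \sum_(i <- [seq i <- t | i \in s]) G i.
  rewrite big_filter [RHS]big_mkcond /=; apply: eq_bigr => i _.
  by case: ifPn => // /G0.
apply: perm_big; apply: uniq_perm => //=; first exact: filter_uniq.
by move=> i; rewrite mem_filter; case: (boolP (i \in s)) => //= /st ->.
Qed.

Section Truncation.
Variable R : realType.
Opaque fourier.
Implicit Types (k m : int * int) (c th U : int * int -> R[i]).

Definition trunc N c k : R[i] := if k \in box N then c k else 0.

Lemma trunc_out N c k : k \notin box N -> trunc N c k = 0.
Proof. by rewrite /trunc => /negPf ->. Qed.

Lemma trunc_in N c k : k \in box N -> trunc N c k = c k.
Proof. by rewrite /trunc => ->. Qed.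

Lemma nc_trunc N c k : nc (trunc N c k) <= nc (c k).
Proof. by rewrite /trunc; case: ifP => // _; rewrite nc0 nc_ge0. Qed.

(** For [k] in the box the reflection of [m] into [k - m] maps the box into the one of size [2 * N],
    and [G] vanishes at the additional points. *)
Lemma sum_reflect_box N k (G : int * int -> R[i]) : k \in box N ->
  (forall m, m \notin box N -> G m = 0) ->
  \sum_(m <- box N) G m = \sum_(m <- box (2 * N)) G (k - m).
Proof.
move=> hk G0; rewrite -(big_map (fun m => k - m) xpredT G); apply: sum_support => //.
- exact: box_uniq.
- by rewrite map_inj_uniq ?box_uniq //; exact: sub_inj_r.
move=> m hm; apply/mapP; exists (k - m); last by rewrite opprB addrC subrK.
by move: hk hm; rewrite !mem_box /=; plia.
Qed.

Lemma cconv_sym N th U k : k \in box N ->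
  (forall m, m \notin box N -> th m = 0) -> (forall m, m \notin box N -> U m = 0) ->
  cconv N th U k = cconv N U th k.
Proof.
move=> hk th0 U0; rewrite /cconv (sum_reflect_box hk); last first.
  by move=> m /U0 ->; rewrite mulr0.
rewrite [RHS](@sum_support _ _ (box N) (box (2 * N))) ?box_uniq //.
- by apply: eq_bigr => m _; rewrite opprB addrC subrK mulrC.
- by apply: box_sub; lia.
- by move=> m /th0 ->; rewrite mulr0.
Qed.

Definition tail_le N c (G : R) : Prop := forall t, uniq t ->
  (forall m, m \in t -> m \notin box N) -> \sum_(m <- t) nc (c m) ^+ 2 <= G.

Lemma fourier_product_limit_seq (s : seq (int * int)) (u v : R * R -> R) (e : R) :
  L2 u -> L2 v -> 0 < e -> exists N, forall M k, (N <= M)%N -> k \in s ->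
  nc (fourier (fun p => u p * v p) k -
      \sum_(m <- box M) fourier u (k - m) * fourier v m) <= e.
Proof.
move=> hu hv e0; elim: s => [|x s [N HN]]; first by exists 0%N.
have [N' HN'] := fourier_product_limit x hu hv e0.
exists (maxn N N') => M k; rewrite geq_max => /andP[h1 h2].
by rewrite in_cons => /orP[/eqP ->|]; [exact: HN'|exact: HN].
Qed.

Section Residual.
Variables (N : nat) (z v : R * R -> R) (F G : R).
Hypotheses (L2z : L2 z) (L2v : L2 v).
Hypotheses (Fz : wsum_le (fun k => wt R k * nc (fourier z k) ^+ 2) F)
  (Fv : wsum_le (fun k => wt R k * nc (fourier v k) ^+ 2) F)
  (Gz : tail_le N (fourier z) G) (Gv : tail_le N (fourier v) G).

(** With z_N and v_N the truncations, z_N v_N - z v = - z (v - v_N) - (z - z_N) v_N. Reflecting the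
    second convolution puts the tail of [z] on the summation index, so that both sums have the form
    treated by [truncated_product]. *)
Lemma truncation_error M k : (2 * N <= M)%N -> k \in box N ->
  nc (cconv N (trunc N (fourier z)) (trunc N (fourier v)) k -
      \sum_(m <- box M) fourier z (k - m) * fourier v m) <=
  \sum_(m <- [seq m <- box M | m \notin box N]) nc (fourier z (k - m)) * nc (fourier v m) +
  \sum_(m <- [seq m <- box (2 * N) | m \notin box N]) nc (fourier v (k - m)) * nc (fourier z m).
Proof.
move=> NM hk.
pose Z := trunc N (fourier z); pose V := trunc N (fourier v).
have e1 : \sum_(m <- box M) fourier z (k - m) * fourier v m =
    \sum_(m <- box N) fourier z (k - m) * V m +
    \sum_(m <- [seq m <- box M | m \notin box N]) fourier z (k - m) * fourier v m.
  rewrite (@sum_support _ _ (box N) (box M)) ?box_uniq //; first last.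
  - by move=> m hm; rewrite /V trunc_out ?mulr0.
  - by apply: box_sub; lia.
  rewrite big_filter [X in _ + X]big_mkcond -big_split /=; apply: eq_bigr => m _.
  by rewrite /V /trunc; case: ifP => /= _; rewrite ?addr0 // mulr0 add0r.
have e2 : cconv N Z V k - \sum_(m <- box N) fourier z (k - m) * V m =
    - \sum_(m <- [seq m <- box (2 * N) | m \notin box N]) V (k - m) * fourier z m.
  rewrite /cconv -sumrB -sumrN (@sum_reflect_box _ k (fun m => Z (k - m) * V m - fourier z (k - m) * V m)) //; last first.
    by move=> m hm; rewrite /V trunc_out // !mulr0 subrr.
  rewrite big_filter [RHS]big_mkcond /=; apply: eq_bigr => m _.
  have -> : k - (k - m) = m by rewrite opprB addrC subrK.
  rewrite /Z /trunc; case: ifP => /= _; first by rewrite subrr.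
  by rewrite mul0r sub0r mulrC.
rewrite e1 opprD addrA e2 -opprD ncN addrC.
apply: le_trans (ncD _ _) _; apply: lerD; apply: le_trans (nc_sum _ _ _) _;
  apply: ler_sum => m _; rewrite ncM //.
by apply: ler_wpM2r; [exact: nc_ge0|exact: nc_trunc].
Qed.

(** 960 = 3 * (160 + 160): two tails and the cut-off of the infinite convolution make three
    summands, and the last one tends to 0. *)
Lemma residual_bound : \sum_(k <- box N) nc (cconv N (trunc N (fourier z)) (trunc N (fourier v)) k -
    fourier (fun p => z p * v p) k) ^+ 2 <= 960 * F * G.
Proof.
pose s k := nc (cconv N (trunc N (fourier z)) (trunc N (fourier v)) k -
  fourier (fun p => z p * v p) k) ^+ 2.
rewrite -/(\sum_(k <- box N) s k).
pose c := 3 * \sum_(k <- box N) (1 : R).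
have c0 : 0 <= c by rewrite mulr_ge0 // sumr_ge0.
suff H (e : R) : 0 < e -> \sum_(k <- box N) s k <= 960 * F * G + c * e ^+ 2.
  apply/ler_addgt0Pr => e e0.
  have c1 : 0 < 1 + c by lra.
  have h0 : 0 < Num.min 1 (e / (1 + c)) by rewrite lt_min ltr01 divr_gt0.
  apply: le_trans (H _ h0) _; rewrite lerD2l.
  have : Num.min 1 (e / (1 + c)) <= 1 by rewrite ge_min lexx.
  have : Num.min 1 (e / (1 + c)) * (1 + c) <= e.
    by rewrite -ler_pdivlMr // ge_min lexx orbT.
  move: (Num.min _ _) h0 => x; nra.
move=> e0; have [M HM] := fourier_product_limit_seq (box N) L2z L2v e0.
pose L := maxn M (2 * N).
pose A k := \sum_(m <- [seq m <- box L | m \notin box N]) nc (fourier z (k - m)) * nc (fourier v m).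
pose B k := \sum_(m <- [seq m <- box (2 * N) | m \notin box N]) nc (fourier v (k - m)) * nc (fourier z m).
have hA : \sum_(k <- box N) A k ^+ 2 <= 160 * F * G.
  apply: (@truncated_product _ N (fun k => nc (fourier z k)) (fun k => nc (fourier v k))) => //.
  - by apply: filter_uniq; exact: box_uniq.
  - by move=> m; rewrite mem_filter => /andP[].
  - by apply: Gv; [apply: filter_uniq; exact: box_uniq|move=> m; rewrite mem_filter => /andP[]].
have hB : \sum_(k <- box N) B k ^+ 2 <= 160 * F * G.
  apply: (@truncated_product _ N (fun k => nc (fourier v k)) (fun k => nc (fourier z k))) => //.
  - by apply: filter_uniq; exact: box_uniq.
  - by move=> m; rewrite mem_filter => /andP[].
  - by apply: Gz; [apply: filter_uniq; exact: box_uniq|move=> m; rewrite mem_filter => /andP[]].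
apply: (@le_trans _ _ (\sum_(k <- box N) (3 * A k ^+ 2 + 3 * B k ^+ 2 + 3 * e ^+ 2 * 1))).
  rewrite big_seq [leRHS]big_seq; apply: ler_sum => k hk.
  have h1 := HM L k (leq_maxl _ _) hk.
  have h2 := truncation_error (leq_maxr M (2 * N)) hk.
  rewrite -/(A k) -/(B k) in h2.
  set X := cconv _ _ _ _ in h2 *; set S := \sum_(m <- box L) _ in h1 h2.
  set P := fourier (fun p => _) k in h1 *.
  have h3 : nc (X - P) <= A k + B k + e.
    have -> : X - P = (X - S) - (P - S) by ring.
    by apply: le_trans (ncB _ _) _; lra.
  have : s k <= (A k + B k + e) ^+ 2.
    by rewrite /s ler_pXn2r ?nnegrE ?nc_ge0 // (le_trans (nc_ge0 _) h3).
  move=> /le_trans; apply.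
  have := sqr_ge0 (A k - B k); have := sqr_ge0 (A k - e); have := sqr_ge0 (B k - e); nra.
rewrite !big_split /= -!mulr_sumr /c; move: hA hB; clear; lra.
Qed.

End Residual.
End Truncation.

(** * Decay of high-frequency tails *)

Section Tails.
Variable R : realType.
Opaque fourier.
Implicit Types (k m : int * int) (s : R).
Local Notation wt := (wt R).

(** Outside the box the weight is at least [N ^ 2], so giving up smoothness of order [s - s'] gains
    [N] to the power [s' - s] in the norm. *)
Lemma wt_tail N k s s' : (0 < N)%N -> s' <= s -> k \notin box N ->
  wt k `^ s' <= (N%:R `^ (s' - s)) ^+ 2 * wt k `^ s.
Proof.
move=> N0 ss hk.
have Np : 0 < N%:R :> R by rewrite ltr0n.
have NN : N%:R ^+ 2 <= wt k.
  move: hk; rewrite mem_box negb_and -!ltnNge => hk.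
  have : (N%:R : R) ^+ 2 <= k.1%:~R ^+ 2 \/ (N%:R : R) ^+ 2 <= k.2%:~R ^+ 2.
    have sq (i : int) : (N < `|i|)%N -> (N%:R : R) ^+ 2 <= i%:~R ^+ 2.
      move=> h; rewrite -[leRHS]real_normK ?num_real // ler_pXn2r ?nnegrE //.
      by rewrite -intr_norm -abszE -pmulrn ler_nat ltnW.
    by case/orP: hk => /sq; [left|right].
  rewrite wtE; have := sqr_ge0 (k.1%:~R : R); have := sqr_ge0 (k.2%:~R : R); lra.
have w0 := wt_gt0 R k.
have -> : wt k `^ s = wt k `^ s' * wt k `^ (s - s').
  by rewrite -powRD ?subrKC // (gt_eqF w0) implybT.
rewrite mulrCA ler_peMr ?powR_ge0 // -opprB powRN exprVn.
rewrite mulrC ler_pdivlMr ?exprn_gt0 ?powR_gt0 // mul1r.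
rewrite expr2 -powRM ?ler0n // -expr2; apply: ge0_ler_powR => //; rewrite ?nnegrE ?subr_ge0 // ?exprn_ge0 // ltW.
Qed.

Lemma sob_tail N s u B : (0 < N)%N -> 0 <= s -> sob s u B ->
  tail_le N (fourier u) ((N%:R `^ (- s)) ^+ 2 * B).
Proof.
move=> N0 s0 hu t ut ht; apply: le_trans (ler_wpM2l (sqr_ge0 _) (hu t ut)).
rewrite mulr_sumr big_seq [leRHS]big_seq; apply: ler_sum => k /ht hk.
rewrite mulrA ler_peMl ?sqr_ge0 //.
by have := wt_tail N0 s0 hk; rewrite sub0r powRr0.
Qed.

End Tails.

(** * Absolute summability of the coefficients of zeta *)

Section WienerBound.
Variable R : realType.
Opaque fourier.
Implicit Types (k m : int * int).
Local Notation wt := (wt R).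
Local Notation C := (real_complex R).

Lemma wsum_leD (F G : int * int -> R) A B : wsum_le F A -> wsum_le G B ->
  wsum_le (fun k => F k + G k) (A + B).
Proof. by move=> hF hG s us; rewrite big_split lerD ?hF ?hG. Qed.

Lemma le_1D_of_sqr_le (x c : R) : 0 <= c -> x ^+ 2 <= c -> x <= 1 + c.
Proof. by move=> c0 h; rewrite leNgt; apply/negP => lt; nra. Qed.

(** [trilinear_sobolev] with the square summable [(wt k)^-1] as its L^2 factor. On the finitely many
    frequencies of [s] the infinite convolution is replaced by a finite one, the error [e] being
    spread evenly over them. *)
Lemma square_inv_weight (v : R * R -> R) M : L2 v ->
  wsum_le (fun k => wt k * nc (fourier v k) ^+ 2) M ->
  wsum_le (fun k => (wt k)^-1 * nc (fourier (fun p => v p * v p) k)) (25 * M).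
Proof.
move=> hv hM s us; have M0 := wsum_le_ge0 hM.
apply/ler_addgt0Pr => e e0.
have c0 : 0 <= \sum_(k <- s) (1 : R) by apply: sumr_ge0.
have e1 : 0 < e / (1 + \sum_(k <- s) (1 : R)) by rewrite divr_gt0 //; lra.
have [N /(_ N)HN] := fourier_product_limit_seq s hv hv e1.
pose S := \sum_(k <- s) \sum_(m <- box N) (wt k)^-1 * nc (fourier v (k - m)) * nc (fourier v m).
have hS : S <= 25 * M.
  have : S ^+ 2 <= 25 * M * M * 25.
    apply: (@trilinear_sobolev _ s (box N) (fun k => nc (fourier v k)) (fun k => nc (fourier v k))
      (fun k => (wt k)^-1) us (box_uniq N) true) => //=.
      by under eq_bigr do rewrite expr1; apply: hM; exact: box_uniq.
    under eq_bigr do rewrite expr0 mul1r exprVn; exact: sum_inv_wt_sqr.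
  have -> : 25 * M * M * 25 = (25 * M) ^+ 2 by ring.
  move=> h; rewrite leNgt; apply/negP => lt; move: h lt; nra.
apply: (@le_trans _ _ (S + \sum_(k <- s) e / (1 + \sum_(k <- s) (1 : R)) * 1)).
  rewrite /S -big_split /= big_seq [leRHS]big_seq; apply: ler_sum => k hk.
  have h := HN k (leqnn _) hk.
  set T := \sum_(m <- box N) _ in h.
  have hT : nc T <= \sum_(m <- box N) nc (fourier v (k - m)) * nc (fourier v m).
    by apply: le_trans (nc_sum _ _ _) _; apply: ler_sum => m _; rewrite ncM.
  have -> : \sum_(m <- box N) (wt k)^-1 * nc (fourier v (k - m)) * nc (fourier v m) =
      (wt k)^-1 * \sum_(m <- box N) nc (fourier v (k - m)) * nc (fourier v m).
    by rewrite mulr_sumr; apply: eq_bigr => m _; rewrite mulrA.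
  set X := fourier _ k in h *.
  have hX : nc X <= \sum_(m <- box N) nc (fourier v (k - m)) * nc (fourier v m) +
      e / (1 + \sum_(k <- s) (1 : R)).
    by have := ncD (X - T) T; rewrite subrK; lra.
  have w0 : 0 <= (wt k)^-1 by rewrite invr_ge0.
  have w1 : (wt k)^-1 <= 1 by rewrite invf_le1.
  apply: le_trans (ler_wpM2l w0 hX) _; rewrite mulrDr mulr1 lerD2l.
  by rewrite ler_piMl // ltW.
apply: lerD => //; rewrite -mulr_sumr mulrAC ler_pdivrMr; last by lra.
by rewrite ler_pM2l //; lra.
Qed.

(** If x is the larger of the two squared frequencies then x >= 1 and [wt k <= 3 * x], whereas (2
    pi)^2 >= 16. *)
Lemma kap_lower k : k != 0 ->
  Num.sqrt (wt k) <= `|kap1 R k| \/ Num.sqrt (wt k) <= `|kap2 R k|.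
Proof.
move=> k0.
have key (i : int) : 4 * wt k <= 16 * i%:~R ^+ 2 ->
    Num.sqrt (wt k) <= `|2 * pi * i%:~R : R|.
  move=> h; rewrite -sqrtr_sqr ler_wsqrtr // !exprMn.
  have := pi_ge2 R; move: (pi : R) => p p2.
  have : 4 <= p ^+ 2 by nra.
  move: (sqr_ge0 (i%:~R : R)) h; move: (i%:~R ^+ 2) (p ^+ 2) => x y; nra.
have sq (x y : int) : `|x| <= `|y| -> (x%:~R : R) ^+ 2 <= y%:~R ^+ 2.
  by move=> h; rewrite -!rmorphXn /= ler_int -(real_normK (num_real x)) -(real_normK (num_real y)) ler_pXn2r ?nnegrE.
have sq1 (x : int) : x != 0 -> (1 : R) <= x%:~R ^+ 2.
  by move=> x0; have := sq 1 x; rewrite expr1n; apply; move: x0; lia.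
have nz : k.1 != 0 \/ k.2 != 0.
  by move: k0; case: (k) => x y; rewrite xpair_eqE negb_and => /orP.
have [h|h] := leP (`|k.2| : int) `|k.1|; [left|right]; apply: key; rewrite wtE.
  have h1 := sq _ _ h; have [//|h2] : k.1 = 0 \/ k.1 != 0 by case: eqP; [left|right].
    by move=> e; move: nz h; rewrite e; lia.
  have := sq1 _ h2; lra.
have h1 := sq _ _ (ltW h); have h2 : k.2 != 0 by apply/eqP => e; move: h; rewrite e; lia.
have := sq1 _ h2; lra.
Qed.

Variables (c' d r2 lam : R).

(** The velocity equation solved for [zeta]: as [r2 - c' * kapsq R k] has order two and [kk] is at
    least of the size of the frequency, [v_t] enters with one derivative gained and the square of
    [v] with two. *)
Lemma mode_bound (m D : R) k (kk : R) (z vt q : R[i]) : k != 0 -> 0 < m -> 0 <= D ->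
  m * wt k <= r2 - c' * kapsq R k -> 1 + d * kapsq R k <= D * wt k -> 0 <= 1 + d * kapsq R k ->
  Num.sqrt (wt k) <= `|kk| ->
  C (1 + d * kapsq R k) * vt +
    Complex 0 1 * (C kk * (C (r2 - c' * kapsq R k) * z + C (lam / 2) * q)) = 0 ->
  nc z <= D / m * ((Num.sqrt (wt k))^-1 * nc vt) + `|lam| / m * ((wt k)^-1 * nc q).
Proof.
move=> k0 m0 D0 hm hD hD0 hk heq.
set A := r2 - _ in hm heq; set B := 1 + _ in hD hD0 heq.
have w0 := wt_gt0 R k; have s0 : 0 < Num.sqrt (wt k) by rewrite sqrtr_gt0.
have kk0 : 0 < `|kk| by apply: lt_le_trans hk.
have A0 : 0 < A by apply: lt_le_trans hm; rewrite mulr_gt0.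
have e1 : Complex 0 1 * (C kk * (C A * z)) = - (C B * vt) - Complex 0 1 * (C kk * (C (lam / 2) * q)).
  apply/eqP; rewrite -subr_eq0 -[X in _ == X]heq; apply/eqP; ring.
have n1 : nc (Complex 0 1 : R[i]) = 1 by rewrite /= expr0n /= add0r expr1n sqrtr1.
have e2 : `|kk| * (A * nc z) <= B * nc vt + `|kk| * (`|lam| / 2 * nc q).
  have -> : `|kk| * (A * nc z) = nc (Complex 0 1 * (C kk * (C A * z))).
    by rewrite !ncM n1 !nc_real mul1r (ger0_norm (ltW A0)).
  rewrite e1; apply: le_trans (ncB _ _) _; rewrite ncN !ncM n1 !nc_real mul1r (ger0_norm hD0).
  by rewrite normrM (@ger0_norm _ 2^-1) // invr_ge0.
have kw : 0 < `|kk| * (m * wt k) by rewrite !mulr_gt0.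
have e3 : `|kk| * (m * wt k) * nc z <= D * wt k * nc vt + `|kk| * (`|lam| / 2 * nc q).
  apply: le_trans (le_trans e2 _).
    by rewrite -mulrA ler_pM2l // ler_wpM2r ?nc_ge0.
  by rewrite lerD2r ler_wpM2r ?nc_ge0.
rewrite -(ler_pM2l kw); apply: le_trans e3 _; rewrite [leRHS]mulrDr; apply: lerD.
  have -> : `|kk| * (m * wt k) * (D / m * ((Num.sqrt (wt k))^-1 * nc vt)) =
    D * wt k * nc vt * (`|kk| / Num.sqrt (wt k)) by field; rewrite !gt_eqF.
  by rewrite ler_peMr ?ler_pdivlMr ?mul1r // !mulr_ge0 // ?nc_ge0.
have -> : `|kk| * (m * wt k) * (`|lam| / m * ((wt k)^-1 * nc q)) = `|kk| * (`|lam| * nc q).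
  by field; rewrite !gt_eqF.
rewrite ler_pM2l // ler_wpM2r ?nc_ge0 // ler_pdivrMr //.
by have := normr_ge0 lam; lra.
Qed.

(** [A] is chosen before the functions, which makes it uniform in time. The term in [v_t] is
    summable by Cauchy-Schwarz against [(wt k ^+ 2)^-1]. At [k = 0] the velocity equation says
    nothing about [zeta], so the mean is bounded separately. *)
Lemma wiener_bound : 0 < d -> c' < 0 -> 0 < r2 -> forall M, exists A, forall a b r1
    (z v1 v2 : R * R -> R) (v1h v2h zth v1t v2t p1 p2 : int * int -> R[i]),
  L2 v1 -> L2 v2 -> nc (fourier z 0) ^+ 2 <= M ->
  wsum_le (fun k => wt k * nc (fourier v1 k) ^+ 2) M ->
  wsum_le (fun k => wt k * nc (fourier v2 k) ^+ 2) M ->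
  wsum_le (fun k => wt k * nc (v1t k) ^+ 2) M ->
  wsum_le (fun k => wt k * nc (v2t k) ^+ 2) M ->
  (forall k, fourier_system a b c' d r1 r2 lam k (fourier z k) (v1h k) (v2h k)
     (zth k) (v1t k) (v2t k) (p1 k) (p2 k)
     (fourier (fun p => v1 p * v1 p) k + fourier (fun p => v2 p * v2 p) k)) ->
  wsum_le (fun k => nc (fourier z k)) A.
Proof.
move=> d0 c0 r0 M.
pose P : R := (2 * pi) ^+ 2.
pose m := Num.min r2 (- c' * P); pose D := 1 + d * P.
have P0 : 0 < P by rewrite exprn_gt0 // mulr_gt0 // pi_gt0.
have m0 : 0 < m by rewrite lt_min r0 mulr_gt0 // oppr_gt0.
have D0 : 0 <= D by rewrite addr_ge0 // mulr_ge0 // ltW.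
(* Both velocity components are included, since the equation used at [k] depends on which of its
   frequencies is the larger. *)
exists (D / m * (1 + 25 * M) + D / m * (1 + 25 * M) + `|lam| / m * (25 * M + 25 * M) + (1 + M)).
move=> a b r1 z v1 v2 v1h v2h zth v1t v2t p1 p2 hv1 hv2 hz0 h1 h2 h1t h2t hsys.
have M0 := wsum_le_ge0 h1.
have Dm : 0 <= D / m by rewrite divr_ge0 // ltW.
have Lm : 0 <= `|lam| / m by rewrite divr_ge0 // ltW.
pose q k := fourier (fun p => v1 p * v1 p) k + fourier (fun p => v2 p * v2 p) k.
have hvt vt : wsum_le (fun k => wt k * nc (vt k) ^+ 2) M ->
    wsum_le (fun k => (Num.sqrt (wt k))^-1 * nc (vt k : R[i])) (1 + 25 * M).
  move=> h s us; apply: le_1D_of_sqr_le; first by rewrite mulr_ge0.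
  apply: le_trans (@cauchy_schwarz _ _ s _ (fun k => (wt k ^+ 2)^-1) (fun k => wt k * nc (vt k) ^+ 2) _ _ _) _.
  - by move=> k _; nneg.
  - by move=> k _; nneg.
  - by move=> k _; apply: eq_lew; rewrite exprMn exprVn sqr_sqrtr //; field; rewrite gt_eqF.
  by apply: ler_pM; [nneg|nneg|exact: sum_inv_wt_sqr|exact: h].
have hq : wsum_le (fun k => (wt k)^-1 * nc (q k)) (25 * M + 25 * M).
  apply: wsum_le_weaken (wsum_leD (square_inv_weight hv1 h1) (square_inv_weight hv2 h2)) => // k.
  by rewrite -mulrDr ler_wpM2l ?invr_ge0 // ncD.
have h0 : wsum_le (fun k => (k == 0)%:R * nc (fourier z 0)) (1 + M).
  move=> s us; apply: (@le_trans _ _ (nc (fourier z 0))).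
    rewrite -mulr_suml ler_piMl ?nc_ge0 //.
    rewrite -natr_sum; apply: (@le_trans _ _ ((0 \in s)%:R)); last by case: (_ \in _).
    rewrite ler_nat -(count_uniq_mem _ us) -sum1_count [leqRHS]big_mkcond /=.
    by apply: leq_sum => k _; case: (k == 0).
  exact: le_1D_of_sqr_le.
have := wsum_leD (wsum_leD (wsum_leD (wsum_leZ Dm (hvt _ h1t)) (wsum_leZ Dm (hvt _ h2t)))
  (wsum_leZ Lm hq)) h0.
apply: wsum_le_weaken => // k.
have hk : m * wt k <= r2 - c' * kapsq R k.
  have nc0 : 0 < - c' by rewrite oppr_gt0.
  by rewrite -mulNr; exact: affine_lower.
have hD : 1 + d * kapsq R k <= D * wt k.
  rewrite kapsq_wt -/P /D; have := wt_ge1 R k; have := mulr_gt0 d0 P0; nra.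
have hD0 : 0 <= 1 + d * kapsq R k by rewrite addr_ge0 // mulr_ge0 ?kapsq_ge0 // ltW.
have t1 : 0 <= D / m * ((Num.sqrt (wt k))^-1 * nc (v1t k)).
  by rewrite !mulr_ge0 ?invr_ge0 ?sqrtr_ge0 ?nc_ge0 // ltW.
have t2 : 0 <= D / m * ((Num.sqrt (wt k))^-1 * nc (v2t k)).
  by rewrite !mulr_ge0 ?invr_ge0 ?sqrtr_ge0 ?nc_ge0 // ltW.
have t3 : 0 <= `|lam| / m * ((wt k)^-1 * nc (q k)).
  by rewrite !mulr_ge0 ?invr_ge0 ?nc_ge0 // ltW.
have [k0|k0] := eqVneq k 0.
  by rewrite mul1r (_ : fourier z 0 = fourier z k) ?k0 //; move: t1 t2 t3; rewrite k0; lra.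
rewrite mul0r addr0; have [_ e1 e2] := hsys k.
have [hkk|hkk] := kap_lower k0.
  have := mode_bound k0 m0 D0 hk hD hD0 hkk e1; rewrite -/(q k); lra.
have := mode_bound k0 m0 D0 hk hD hD0 hkk e2; rewrite -/(q k); lra.
Qed.

End WienerBound.

(** * Time derivatives of complex coefficients *)

Section ComplexTimeDerivative.
Variables (R : realType) (T : R).
Implicit Types (f g : R -> R[i]) (t : R).

Definition has_cderiv f t (l : R[i]) : Prop :=
  has_deriv T (fun s => complex.Re (f s)) t (complex.Re l) /\
  has_deriv T (fun s => complex.Im (f s)) t (complex.Im l).

Lemma has_cderivB f g t l l' : has_cderiv f t l -> has_cderiv g t l' ->
  has_cderiv (fun s => f s - g s) t (l - l').
Proof.
move=> [f1 f2] [g1 g2]; split.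
  have := has_derivD f1 (has_derivZ (-1) g1).
  rewrite (_ : (fun s => _) = (fun s => complex.Re (f s - g s))).
    by congr has_deriv; case: l l' {f1 f2 g1 g2} => [? ?] [? ?] /=; rewrite mulN1r.
  by apply/funext => s; case: (f s) (g s) => [? ?] [? ?] /=; rewrite mulN1r.
have := has_derivD f2 (has_derivZ (-1) g2).
rewrite (_ : (fun s => _) = (fun s => complex.Im (f s - g s))).
  by congr has_deriv; case: l l' {f1 f2 g1 g2} => [? ?] [? ?] /=; rewrite mulN1r.
by apply/funext => s; case: (f s) (g s) => [? ?] [? ?] /=; rewrite mulN1r.
Qed.

Lemma has_cderiv_cst c t : has_cderiv (fun=> c) t 0.
Proof. by split; exact: has_deriv_cst. Qed.

Lemma has_cderiv_nc_sqr f t l : has_cderiv f t l ->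
  has_deriv T (fun s => nc (f s) ^+ 2) t (dnorm2 (f t) l).
Proof.
move=> [h1 h2]; have := has_derivD (has_deriv_sqr h1) (has_deriv_sqr h2).
rewrite (_ : (fun s => _) = (fun s => nc (f s) ^+ 2)); last by apply/funext => s; rewrite nc_sqr.
by congr has_deriv; rewrite /dnorm2 mulrDr.
Qed.

End ComplexTimeDerivative.

(** * The stability estimate over the time interval *)

Section Stability.
Variables (R : realType) (T a b c' d r1 r2 lam : R) (al be : bool) (c0 : R)
  (q : int * int -> R) (M A : R).
Hypotheses (ab : ~~ (al && be)) (c01 : 1 <= c0) (M0 : 0 <= M)
  (hq : admissible_weight a b c' d r1 r2 lam al be c0 q).

Definition growth : R := expR ((22 * energy_constant c0 M A + 1) * T).

(** The Gronwall lemma is applied to the energy plus [eps2], which makes the differential inequality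
    homogeneous and the initial value [eps2 < y0]. The level [y0 * growth] of the barrier is also
    the one below which [N * energy <= 1]. *)
Lemma stability N (eps2 y0 : R) (z u1 u2 th x1 x2 tht x1t x2t s1 s2 s0 : R -> int * int -> R[i]) :
  (0 < N)%N -> 0 <= eps2 -> eps2 < y0 -> N%:R * (y0 * growth) <= 1 ->
  (forall t k, 0 <= t <= T -> [/\ has_cderiv T (th ^~ k) t (tht t k),
     has_cderiv T (x1 ^~ k) t (x1t t k) & has_cderiv T (x2 ^~ k) t (x2t t k)]) ->
  (forall k, [/\ th 0 k = 0, x1 0 k = 0 & x2 0 k = 0]) ->
  (forall t k, 0 <= t <= T -> k \notin box N -> [/\ th t k = 0, x1 t k = 0 & x2 t k = 0]) ->
  (forall t, 0 <= t <= T -> [/\ wsum_le (fun k => wt R k * nc (z t k) ^+ 2) M,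
     wsum_le (fun k => wt R k * nc (u1 t k) ^+ 2) M,
     wsum_le (fun k => wt R k * nc (u2 t k) ^+ 2) M
   & al -> wsum_le (fun k => nc (z t k)) A]) ->
  (forall t, 0 <= t <= T -> [/\ \sum_(k <- box N) nc (s0 t k) ^+ 2 <= eps2,
     \sum_(k <- box N) nc (s1 t k) ^+ 2 <= eps2 &
     \sum_(k <- box N) nc (s2 t k) ^+ 2 <= eps2]) ->
  (forall t k, 0 <= t <= T -> k \in box N ->
    fourier_system a b c' d r1 r2 lam k (th t k) (x1 t k) (x2 t k) (tht t k) (x1t t k) (x2t t k)
    (cconv N (z t) (x1 t) k + cconv N (u1 t) (th t) k + cconv N (th t) (x1 t) k + s1 t k)
    (cconv N (z t) (x2 t) k + cconv N (u2 t) (th t) k + cconv N (th t) (x2 t) k + s2 t k)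
    (2 * cconv N (u1 t) (x1 t) k + 2 * cconv N (u2 t) (x2 t) k +
       cconv N (x1 t) (x1 t) k + cconv N (x2 t) (x2 t) k + s0 t k)) ->
  forall t, 0 <= t <= T ->
    \sum_(k <- box N) (nc (th t k) ^+ 2 + nc (x1 t k) ^+ 2 + nc (x2 t k) ^+ 2) <=
      c0 * (y0 * growth).
Proof.
move=> N0 e0 ey Ny hder hinit hsupp hbnd hres hsys t tT.
have c00 : 0 < c0 by exact: lt_le_trans ltr01 c01.
pose K : R := 22 * energy_constant c0 M A.
have [hpos hw1 hw2 _ _] := hq.
pose F s := energy a b c' d r1 r2 q N (th s) (x1 s) (x2 s) + eps2.
pose F' s := energy_derivative a b c' d r1 r2 q N (th s) (x1 s) (x2 s) (tht s) (x1t s) (x2t s).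
have K0 : 0 <= K.
  exact: mulr_ge0 (energy_constant_ge0 A c01 M0).
have y00 : 0 < y0 by lra.
have bound := @gronwall_barrier R T F F' K y0 (y0 * growth) K0 y00.
have FE s : 0 <= s <= T -> F s <= y0 * growth.
  apply: bound => // [r rT||r rT Fr].
  - have -> : F' r = F' r + 0 by rewrite addr0.
    apply: has_derivD; last exact: has_deriv_cst.
    apply: (@has_deriv_sum R T _ _
      (fun k s => weight1 b c' r2 (q k) k * nc (th s k) ^+ 2 +
         weight2 a d r1 (q k) k * (nc (x1 s k) ^+ 2 + nc (x2 s k) ^+ 2))
      (fun k s => weight1 b c' r2 (q k) k * dnorm2 (th s k) (tht s k) +
         weight2 a d r1 (q k) k * (dnorm2 (x1 s k) (x1t s k) + dnorm2 (x2 s k) (x2t s k)))) => k.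
    have [h1 h2 h3] := hder r k rT.
    apply: has_derivD; apply: has_derivZ; first exact: has_cderiv_nc_sqr h1.
    apply: has_derivD; [exact: has_cderiv_nc_sqr h2|exact: has_cderiv_nc_sqr h3].
  - rewrite /F /energy big1 ?add0r // => k _; have [-> -> ->] := hinit k.
    by rewrite nc0 expr0n /= addr0 !mulr0 addr0.
  - have [hz hu1 hu2 hA] := hbnd r rT; have [r0 r1' r2'] := hres r rT.
    have NF : N%:R * energy a b c' d r1 r2 q N (th r) (x1 r) (x2 r) <= 1.
      apply: le_trans Ny; rewrite ler_wpM2l //; apply: le_trans Fr.
      by rewrite /F lerDl.
    have := energy_inequality N0 ab c01 e0 M0 hq (fun k hk => hsupp r k rT hk) hz hu1 hu2 hA
      r0 r1' r2' (fun k hk => hsys r k rT hk) NF.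
    by rewrite /F' /F /K mulrA.
apply: le_trans (ler_wpM2l (ltW c00) (FE t tT)).
rewrite /F mulrDr -[leLHS]addr0; apply: lerD; last by rewrite mulr_ge0 // ltW.
rewrite mulr_sumr; apply: ler_sum => k _.
have g1 := le_trans (exprn_ege1 al (wt_ge1 R k)) (hw1 k).
have g2 := le_trans (exprn_ege1 be (wt_ge1 R k)) (hw2 k).
rewrite mulrDr [X in _ <= X + _]mulrA [X in _ <= _ + X]mulrA -addrA; apply: lerD.
  by rewrite ler_peMl ?sqr_ge0.
by rewrite ler_peMl // addr_ge0 ?sqr_ge0.
Qed.

End Stability.

(** * Differences of truncated convolutions *)

Section ConvolutionDifference.
Variable R : realType.
Implicit Types (Z U X Y : int * int -> R[i]).

Lemma cconvBl N X Y U k : cconv N (fun m => X m - Y m) U k = cconv N X U k - cconv N Y U k.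
Proof. by rewrite /cconv -sumrB; apply: eq_bigr => m _; rewrite mulrBl. Qed.

Lemma cconvBr N X Y U k : cconv N U (fun m => X m - Y m) k = cconv N U X k - cconv N U Y k.
Proof. by rewrite /cconv -sumrB; apply: eq_bigr => m _; rewrite mulrBr. Qed.

(** Bilinear expansion around [(Z, U)]. One term comes out with its factors in the opposite order,
    and [cconv_sym] exchanges them for sequences supported in the box. *)
Lemma cconv_difference N X U Y Z k : k \in box N ->
  (forall m, m \notin box N -> X m = 0) -> (forall m, m \notin box N -> U m = 0) ->
  (forall m, m \notin box N -> Z m = 0) ->
  cconv N X Y k - cconv N Z U k = cconv N Z (fun m => Y m - U m) k +
    cconv N U (fun m => X m - Z m) k + cconv N (fun m => X m - Z m) (fun m => Y m - U m) k.
Proof.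
move=> hk X0 U0 Z0.
rewrite (@cconv_sym _ N U (fun m => X m - Z m)) //; last first.
  by move=> m hm; rewrite X0 // Z0 // subr0.
rewrite !cconvBl !cconvBr; ring.
Qed.

End ConvolutionDifference.

(** * Galerkin solutions compared with a reference curve *)

Section GalerkinStability.
Variables (R : realType) (T a b c d gamma delta : R) (z0 v10 v20 : R * R -> R).
Opaque fourier.
Hypothesis T0 : 0 < T.
Variables (al be : bool) (c0 : R) (q : int * int -> R) (M A : R).
Hypotheses (ab : ~~ (al && be)) (c01 : 1 <= c0) (M0 : 0 <= M)
  (hq : admissible_weight a b (coef_c gamma c) d (coef_r1 gamma delta) (coef_r2 gamma)
     (lambda gamma delta) al be c0 q).
Local Notation growth := (growth T c0 M A).

Section Fixed.
Variables (N : nat) (zN v1N v2N zNt v1Nt v2Nt : R -> R * R -> R).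
Hypothesis gal : galerkin_solution N T a b c d gamma delta z0 v10 v20 zN v1N v2N zNt v1Nt v2Nt.

Lemma SN_real_L2 u : SN_real N u -> L2 (u : R * R -> R).
Proof. by move=> /SN_real_trig /real_trig_L2. Qed.

Lemma galerkin_cderiv t k : 0 <= t <= T ->
  [/\ has_cderiv T (fun s => fourier (zN s) k) t (fourier (zNt t) k),
      has_cderiv T (fun s => fourier (v1N s) k) t (fourier (v1Nt t) k) &
      has_cderiv T (fun s => fourier (v2N s) k) t (fourier (v2Nt t) k)].
Proof.
move=> tT; have [h1 h2 h3 _ _] := gal.
by split; [apply: (C1_time_fourier SN_real_L2 h1 _ tT)|apply: (C1_time_fourier SN_real_L2 h2 _ tT)|
  apply: (C1_time_fourier SN_real_L2 h3 _ tT)] => f e; exact: l2norm_fourier_le.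
Qed.

Lemma galerkin_SN t : 0 <= t <= T ->
  [/\ SN_real N (zN t), SN_real N (v1N t), SN_real N (v2N t),
      SN_real N (zNt t) & SN_real N (v1Nt t) /\ SN_real N (v2Nt t)].
Proof.
move=> tT; have [h1 h2 h3 _ _] := gal.
by have [? ? _ _] := h1 t tT; have [? ? _ _] := h2 t tT; have [? ? _ _] := h3 t tT.
Qed.

Lemma galerkin_support t k : 0 <= t <= T -> k \notin box N ->
  [/\ fourier (zN t) k = 0, fourier (v1N t) k = 0 & fourier (v2N t) k = 0].
Proof.
by move=> /galerkin_SN[/SN_realE[_ h1] /SN_realE[_ h2] /SN_realE[_ h3] _ _] hk; rewrite h1 ?h2 ?h3.
Qed.

Lemma galerkin_system t k : 0 <= t <= T -> k \in box N ->
  fourier_system a b (coef_c gamma c) d (coef_r1 gamma delta) (coef_r2 gamma)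
    (lambda gamma delta) k (fourier (zN t) k) (fourier (v1N t) k) (fourier (v2N t) k)
    (fourier (zNt t) k) (fourier (v1Nt t) k) (fourier (v2Nt t) k)
    (cconv N (fourier (zN t)) (fourier (v1N t)) k) (cconv N (fourier (zN t)) (fourier (v2N t)) k)
    (cconv N (fourier (v1N t)) (fourier (v1N t)) k + cconv N (fourier (v2N t)) (fourier (v2N t)) k).
Proof.
move=> tT hk; have [S1 S2 S3 S4 [S5 S6]] := galerkin_SN tT.
by have [_ _ _ hsys _] := gal; apply: galerkin_fourier_system => //; exact: hsys.
Qed.

Lemma galerkin_init k : k \in box N ->
  [/\ fourier (zN 0) k = fourier z0 k, fourier (v1N 0) k = fourier v10 k &
      fourier (v2N 0) k = fourier v20 k].
Proof. by move=> hk; have [_ _ _ _ [h1 h2 h3]] := gal; rewrite (PN_fourier h1 hk) (PN_fourier h2 hk) (PN_fourier h3 hk). Qed.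

Lemma has_cderiv_trunc (f ft : R -> int * int -> R[i]) k t :
  (forall k, has_cderiv T (f ^~ k) t (ft t k)) ->
  has_cderiv T (fun s => trunc N (f s) k) t (trunc N (ft t) k).
Proof. by rewrite /trunc; case: ifP => // _ _; exact: has_cderiv_cst. Qed.

(* The reference curve [(Z, U1, U2)] solves the Galerkin system up to the
   residuals of its products [P1], [P2], [Q]. *)
Lemma galerkin_stability (eps2 y0 : R) (Z U1 U2 Zt U1t U2t P1 P2 Q : R -> int * int -> R[i]) :
  (0 < N)%N -> 0 <= eps2 -> eps2 < y0 -> N%:R * (y0 * growth) <= 1 ->
  (forall t k, 0 <= t <= T -> [/\ has_cderiv T (Z ^~ k) t (Zt t k),
     has_cderiv T (U1 ^~ k) t (U1t t k) & has_cderiv T (U2 ^~ k) t (U2t t k)]) ->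
  (forall k, k \in box N -> [/\ Z 0 k = fourier z0 k, U1 0 k = fourier v10 k & U2 0 k = fourier v20 k]) ->
  (forall t k, k \notin box N -> [/\ Z t k = 0, U1 t k = 0 & U2 t k = 0]) ->
  (forall t, 0 <= t <= T -> [/\ wsum_le (fun k => wt R k * nc (Z t k) ^+ 2) M,
     wsum_le (fun k => wt R k * nc (U1 t k) ^+ 2) M,
     wsum_le (fun k => wt R k * nc (U2 t k) ^+ 2) M
   & al -> wsum_le (fun k => nc (Z t k)) A]) ->
  (forall t, 0 <= t <= T -> [/\
     \sum_(k <- box N) nc (cconv N (U1 t) (U1 t) k + cconv N (U2 t) (U2 t) k - Q t k) ^+ 2 <= eps2,
     \sum_(k <- box N) nc (cconv N (Z t) (U1 t) k - P1 t k) ^+ 2 <= eps2 &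
     \sum_(k <- box N) nc (cconv N (Z t) (U2 t) k - P2 t k) ^+ 2 <= eps2]) ->
  (forall t k, 0 <= t <= T -> k \in box N ->
    fourier_system a b (coef_c gamma c) d (coef_r1 gamma delta) (coef_r2 gamma)
     (lambda gamma delta) k (Z t k) (U1 t k) (U2 t k) (Zt t k) (U1t t k) (U2t t k)
     (P1 t k) (P2 t k) (Q t k)) ->
  forall t, 0 <= t <= T ->
    \sum_(k <- box N) (nc (fourier (zN t) k - Z t k) ^+ 2 +
       nc (fourier (v1N t) k - U1 t k) ^+ 2 + nc (fourier (v2N t) k - U2 t k) ^+ 2) <=
      c0 * (y0 * growth).
Proof.
move=> N0 e0 ey Ny hder hinit hsupp hbnd hres hsys.
apply: (@stability R T a b (coef_c gamma c) d (coef_r1 gamma delta) (coef_r2 gamma)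
  (lambda gamma delta) al be c0 q M A ab c01 M0 hq N eps2 y0 Z U1 U2
  (fun t k => fourier (zN t) k - Z t k) (fun t k => fourier (v1N t) k - U1 t k)
  (fun t k => fourier (v2N t) k - U2 t k)
  (fun t k => fourier (zNt t) k - Zt t k) (fun t k => fourier (v1Nt t) k - U1t t k)
  (fun t k => fourier (v2Nt t) k - U2t t k)
  (fun t k => cconv N (Z t) (U1 t) k - P1 t k) (fun t k => cconv N (Z t) (U2 t) k - P2 t k)
  (fun t k => cconv N (U1 t) (U1 t) k + cconv N (U2 t) (U2 t) k - Q t k)) => //.
- move=> t k tT; have [g1 g2 g3] := galerkin_cderiv k tT; have [h1 h2 h3] := hder t k tT.
  by split; exact: has_cderivB.
- move=> k; have T00 : 0 <= (0 : R) <= T by rewrite lexx (ltW T0).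
  have [hk|hk] := boolP (k \in box N).
    have [-> -> ->] := galerkin_init hk; have [-> -> ->] := hinit k hk.
    by rewrite !subrr.
  have [-> -> ->] := galerkin_support T00 hk; have [-> -> ->] := hsupp 0 k hk.
  by rewrite !subrr.
- move=> t k tT hk.
  have [-> -> ->] := galerkin_support tT hk; have [-> -> ->] := hsupp t k hk.
  by rewrite !subrr.
move=> t k tT hk.
have s1 m : m \notin box N -> fourier (zN t) m = 0 by move=> /(galerkin_support tT)[].
have s2 m : m \notin box N -> fourier (v1N t) m = 0 by move=> /(galerkin_support tT)[].
have s3 m : m \notin box N -> fourier (v2N t) m = 0 by move=> /(galerkin_support tT)[].
have s4 m : m \notin box N -> Z t m = 0 by move=> /(hsupp t)[].
have s5 m : m \notin box N -> U1 t m = 0 by move=> /(hsupp t)[].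
have s6 m : m \notin box N -> U2 t m = 0 by move=> /(hsupp t)[].
have := fourier_system_sub (galerkin_system tT hk) (hsys t k tT hk).
have e1 := cconv_difference (fourier (v1N t)) hk s1 s5 s4.
have e2 := cconv_difference (fourier (v2N t)) hk s1 s6 s4.
have e3 := cconv_difference (fourier (v1N t)) hk s2 s5 s5.
have e4 := cconv_difference (fourier (v2N t)) hk s3 s6 s6.
congr (fourier_system _ _ _ _ _ _ _ _ _ _ _ _ _ _ _ _ _).
- by rewrite -e1; ring.
- by rewrite -e2; ring.
rewrite -[RHS]/(2 * cconv N (U1 t) (fun m => fourier (v1N t) m - U1 t m) k +
  2 * cconv N (U2 t) (fun m => fourier (v2N t) m - U2 t m) k +
  cconv N (fun m => fourier (v1N t) m - U1 t m) (fun m => fourier (v1N t) m - U1 t m) k +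
  cconv N (fun m => fourier (v2N t) m - U2 t m) (fun m => fourier (v2N t) m - U2 t m) k +
  (cconv N (U1 t) (U1 t) k + cconv N (U2 t) (U2 t) k - Q t k)).
transitivity ((cconv N (fourier (v1N t)) (fourier (v1N t)) k - cconv N (U1 t) (U1 t) k) +
  (cconv N (fourier (v2N t)) (fourier (v2N t)) k - cconv N (U2 t) (U2 t) k) +
  (cconv N (U1 t) (U1 t) k + cconv N (U2 t) (U2 t) k - Q t k)); first by ring.
by rewrite e3 e4; ring.
Qed.

End Fixed.
End GalerkinStability.

(** * The error on the retained frequencies *)

Section ErrorOnBox.
Variables (R : realType) (T mu a b c d gamma delta : R) (z0 v10 v20 : R * R -> R)
  (z v1 v2 zt v1t v2t : R -> R * R -> R).
Opaque fourier L2 sob.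
Hypotheses (hT : 0 < T) (hmu : 1 <= mu) (hgamma : 0 <= gamma < 1) (hdelta : 0 < delta)
    (hcase : admissible_case a b c d)
    (hz0 : Hs mu z0) (hv10 : Hs mu v10) (hv20 : Hs mu v20)
    (hsol : exact_solution T mu a b c d gamma delta z0 v10 v20 z v1 v2 zt v1t v2t).

Definition mode_error (zN v1N v2N : R * R -> R) t k : R :=
  nc (fourier zN k - fourier (z t) k) ^+ 2 + nc (fourier v1N k - fourier (v1 t) k) ^+ 2 +
  nc (fourier v2N k - fourier (v2 t) k) ^+ 2.

(** One [D] has to serve every Galerkin solution of level [N]. *)
Definition box_error_le N D : Prop := forall zN v1N v2N zNt v1Nt v2Nt,
  galerkin_solution N T a b c d gamma delta z0 v10 v20 zN v1N v2N zNt v1Nt v2Nt ->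
  forall t, 0 <= t <= T ->
    \sum_(k <- box N) mode_error (zN t) (v1N t) (v2N t) t k <= D.

Let mu0 : 0 <= mu. Proof. exact: le_trans hmu. Qed.

Lemma exact_bounded : exists2 B, 1 <= B & forall t, 0 <= t <= T ->
  [/\ sob mu (z t) B, sob mu (v1 t) B, sob mu (v2 t) B, sob mu (zt t) B &
      sob mu (v1t t) B /\ sob mu (v2t t) B].
Proof.
have [hz h1 h2 _ _] := hsol.
have [Bz HBz] := C1_time_sob_bounded hT hz.
have [B1 HB1] := C1_time_sob_bounded hT h1.
have [B2 HB2] := C1_time_sob_bounded hT h2.
exists (1 + `|Bz| + `|B1| + `|B2|).
  by have := normr_ge0 Bz; have := normr_ge0 B1; have := normr_ge0 B2; lra.
have le3 (u : R * R -> R) B B' : B <= B' -> sob mu u B -> sob mu u B'.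
  by move=> BB' h; apply: wsum_le_weaken h.
have n1 := ler_norm Bz; have n2 := ler_norm B1; have n3 := ler_norm B2.
have m1 := normr_ge0 Bz; have m2 := normr_ge0 B1; have m3 := normr_ge0 B2.
move=> t tT; have [a1 a2] := HBz t tT; have [b1 b2] := HB1 t tT; have [c1 c2] := HB2 t tT.
have Bz' : Bz <= 1 + `|Bz| + `|B1| + `|B2| by lra.
have B1' : B1 <= 1 + `|Bz| + `|B1| + `|B2| by lra.
have B2' : B2 <= 1 + `|Bz| + `|B1| + `|B2| by lra.
by split; [exact: le3 Bz' a1|exact: le3 B1' b1|exact: le3 B2' c1|exact: le3 Bz' a2|
  split; [exact: le3 B1' b2|exact: le3 B2' c2]].
Qed.

Lemma exact_L2 t : 0 <= t <= T ->
  [/\ L2 (z t), L2 (v1 t), L2 (v2 t), L2 (zt t) & L2 (v1t t) /\ L2 (v2t t)].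
Proof.
move=> tT; have [hz h1 h2 _ _] := hsol; have XL2 := @Hs_L2 R mu.
by have [] := C1_time_L2 XL2 hz tT; have [] := C1_time_L2 XL2 h1 tT; have [] := C1_time_L2 XL2 h2 tT.
Qed.

Lemma exact_cderiv t k : 0 <= t <= T ->
  [/\ has_cderiv T (fun s => fourier (z s) k) t (fourier (zt t) k),
      has_cderiv T (fun s => fourier (v1 s) k) t (fourier (v1t t) k) &
      has_cderiv T (fun s => fourier (v2 s) k) t (fourier (v2t t) k)].
Proof.
move=> tT; have [h1 h2 h3 _ _] := hsol; have XL2 := @Hs_L2 R mu.
by split; [apply: (C1_time_fourier XL2 h1 _ tT)|apply: (C1_time_fourier XL2 h2 _ tT)|
  apply: (C1_time_fourier XL2 h3 _ tT)] => f e _; exact: hnorm_fourier_le.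
Qed.

Lemma exact_system t k : 0 <= t <= T ->
  fourier_system a b (coef_c gamma c) d (coef_r1 gamma delta) (coef_r2 gamma)
    (lambda gamma delta) k (fourier (z t) k) (fourier (v1 t) k) (fourier (v2 t) k)
    (fourier (zt t) k) (fourier (v1t t) k) (fourier (v2t t) k)
    (fourier (fun p => z t p * v1 t p) k) (fourier (fun p => z t p * v2 t p) k)
    (fourier (fun p => v1 t p * v1 t p) k + fourier (fun p => v2 t p * v2 t p) k).
Proof.
move=> tT; have [? ? ? ? [? ?]] := exact_L2 tT.
by have [_ _ _ hsys _] := hsol; apply: boussinesq_fourier_system => //; exact: hsys.
Qed.

Lemma exact_init k : [/\ fourier (z 0) k = fourier z0 k, fourier (v1 0) k = fourier v10 k &
  fourier (v2 0) k = fourier v20 k].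
Proof.
have T00 : 0 <= (0 : R) <= T by rewrite lexx (ltW hT).
have [lz l1 l2 _ _] := exact_L2 T00; have [_ _ _ _ hae] := hsol.
have F := ae_filter_ringOfSetsType (lebesgue2 R).
split.
- apply: (fourier_ae_eq k lz (Hs_L2 hz0)).
  by apply: (@filterS _ _ F _ _ _ hae) => p [].
- apply: (fourier_ae_eq k l1 (Hs_L2 hv10)).
  by apply: (@filterS _ _ F _ _ _ hae) => p [].
- apply: (fourier_ae_eq k l2 (Hs_L2 hv20)).
  by apply: (@filterS _ _ F _ _ _ hae) => p [].
Qed.

Lemma exact_wiener : 0 < d -> coef_c gamma c < 0 -> exists A, forall t, 0 <= t <= T ->
  wsum_le (fun k => nc (fourier (z t) k)) A.
Proof.
move=> d0 c0; have [B B1 HB] := exact_bounded.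
have r0 : 0 < coef_r2 gamma by rewrite /coef_r2 subr_gt0; case/andP: hgamma.
have [A HA] := wiener_bound (lambda gamma delta) d0 c0 r0 B.
exists A => t tT; have [_ l1 l2 _ _] := exact_L2 tT; have [bz b1 b2 bzt [b1t b2t]] := HB t tT.
apply: (HA a b (coef_r1 gamma delta) (z t) (v1 t) (v2 t) (fourier (v1 t)) (fourier (v2 t)) (fourier (zt t))
  (fourier (v1t t)) (fourier (v2t t)) (fourier (fun p => z t p * v1 t p)) (fourier (fun p => z t p * v2 t p))
  l1 l2).
- exact: (nc_sob 0 mu0 bz).
- exact: (sob1 (sob_weaken hmu b1)).
- exact: (sob1 (sob_weaken hmu b2)).
- exact: (sob1 (sob_weaken hmu b1t)).
- exact: (sob1 (sob_weaken hmu b2t)).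
- by move=> k; exact: exact_system.
Qed.

Local Notation eps N := (N%:R `^ (- mu) : R).

Lemma eps_le_inv N : (0 < N)%N -> eps N <= N%:R^-1.
Proof.
move=> N0; rewrite -powR_inv1 // ler_powR ?ler1n //.
by rewrite lerN2.
Qed.

Lemma wsum_le_trunc (w : int * int -> R) f N M : (forall k, 0 <= w k) ->
  wsum_le (fun k => w k * nc (f k) ^+ 2) M ->
  wsum_le (fun k => w k * nc (trunc N f k) ^+ 2) M.
Proof.
move=> w0; apply: wsum_le_weaken => // k; rewrite ler_wpM2l // ler_pXn2r ?nnegrE ?nc_ge0 //.
exact: nc_trunc.
Qed.

(** The reference curve is the truncated exact solution, its residuals being those of
    [residual_bound] with tails of order [eps N]. *)
Lemma box_error_large : exists n D, 0 <= D /\ forall N, (n < N)%N -> box_error_le N (D * eps N ^+ 2).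
Proof.
have [al [be [c0 [q [c01 ab hal hq]]]]] := boussinesq_weight hgamma hdelta hcase.
have [B B1 HB] := exact_bounded.
have [A HA] : exists A, forall t, 0 <= t <= T -> al -> wsum_le (fun k => nc (fourier (z t) k)) A.
  case: al hal {ab hq} => hal; last by exists 0.
  by have [d0 c0'] := hal isT; have [A HA] := exact_wiener d0 c0'; exists A => t /HA.
have B0 : 0 <= B by apply: le_trans B1.
pose g : R := growth T c0 B A.
have g0 : 0 <= g by exact: expR_ge0.
have c00 : 0 <= c0 by apply: le_trans c01.
have BB : 1 <= B ^+ 2 by rewrite exprn_ege1.
(* Hiding 960 behind [r] keeps the numeral out of the arithmetic below. *)
have [r r0 res] : exists2 r : R, 0 < r & forall N u v F G, L2 u -> L2 v ->
    wsum_le (fun k => wt R k * nc (fourier u k) ^+ 2) F ->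
    wsum_le (fun k => wt R k * nc (fourier v k) ^+ 2) F ->
    tail_le N (fourier u) G -> tail_le N (fourier v) G ->
    \sum_(k <- box N) nc (cconv N (trunc N (fourier u)) (trunc N (fourier v)) k -
      fourier (fun p => u p * v p) k) ^+ 2 <= r * F * G.
  by exists 960; [rewrite ltr0n|exact: residual_bound].
pose D := 8 * (r * B ^+ 2) * g.
have rB : 0 < r * B ^+ 2 by apply: mulr_gt0 => //; apply: lt_le_trans BB.
have D0 : 0 <= D by rewrite /D mulr_ge0 // mulr_ge0 // ltW.
exists (Num.bound D), (c0 * D).
split; first by rewrite mulr_ge0.
move=> N hN zN v1N v2N zNt v1Nt v2Nt gal t tT.
have N0 : (0 < N)%N by exact: leq_ltn_trans hN.
have Np : 0 < N%:R :> R by rewrite ltr0n.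
have DN : D <= N%:R.
  by apply: ltW; apply: lt_trans (archi_boundP D0) _; rewrite ltr_nat.
have E0 : 0 < eps N by rewrite powR_gt0.
have E2 : 0 < eps N ^+ 2 by rewrite exprn_gt0.
(* The 4 is due to the residual of the squared velocity, a sum of two products: (x + y)^2 <= 2 x^2 +
   2 y^2. *)
pose eps2 := 4 * (r * B ^+ 2) * eps N ^+ 2.
have eps20 : 0 < eps2 by rewrite /eps2 mulr_gt0 // mulr_gt0.
have -> : c0 * D * eps N ^+ 2 = c0 * (2 * eps2 * growth T c0 B A) by rewrite /D /eps2 /g; ring.
pose W (u : R -> R * R -> R) t := trunc N (fourier (u t)).
have key := @galerkin_stability R T a b c d gamma delta z0 v10 v20 hT al be c0 q B A ab c01 B0 hq
  N zN v1N v2N zNt v1Nt v2Nt gal eps2 (2 * eps2) (W z) (W v1) (W v2) (W zt) (W v1t) (W v2t)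
  (fun t k => fourier (fun p => z t p * v1 t p) k) (fun t k => fourier (fun p => z t p * v2 t p) k)
  (fun t k => fourier (fun p => v1 t p * v1 t p) k + fourier (fun p => v2 t p * v2 t p) k).
apply: le_trans (key N0 (ltW eps20) _ _ _ _ _ _ _ _ t tT).
- apply: eq_lew; rewrite big_seq [RHS]big_seq; apply: eq_bigr => k hk.
  by rewrite /W !trunc_in.
- by lra.
(* As [mu >= 1], [eps N ^+ 2] is at most [N ^ -2], and [D <= N] by the choice of the threshold: this
   is where [N] has to be large. *)
- have -> : N%:R * (2 * eps2 * growth T c0 B A) = N%:R * (D * eps N ^+ 2) by rewrite /D /eps2 /g; ring.
  have hE := eps_le_inv N0.
  apply: (@le_trans _ _ (N%:R * (N%:R * N%:R^-1 ^+ 2))).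
    rewrite ler_pM2l //; apply: (ler_pM D0 (exprn_ge0 _ (ltW E0)) DN).
    by apply: lerXn2r => //; rewrite nnegrE ?invr_ge0 ?ler0n // (ltW E0).
  by rewrite expr2; apply: eq_lew; field; rewrite gt_eqF.
- move=> s k sT; have hd k' := exact_cderiv k' sT.
  by split; [apply: (@has_cderiv_trunc R T N (fun s => fourier (z s)) (fun s => fourier (zt s)))|
    apply: (@has_cderiv_trunc R T N (fun s => fourier (v1 s)) (fun s => fourier (v1t s)))|
    apply: (@has_cderiv_trunc R T N (fun s => fourier (v2 s)) (fun s => fourier (v2t s)))] => k';
    have [] := hd k'.
- by move=> k hk; rewrite /W !trunc_in //; exact: exact_init.
- by move=> s k hk; rewrite /W !trunc_out.
- move=> s sT; have [bz b1 b2 _ _] := HB s sT.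
  have wg0 := wt_ge0 R; split; [exact: (wsum_le_trunc N wg0 (sob1 (sob_weaken hmu bz)))|
    exact: (wsum_le_trunc N wg0 (sob1 (sob_weaken hmu b1)))|
    exact: (wsum_le_trunc N wg0 (sob1 (sob_weaken hmu b2)))|move=> hal'].
  by apply: wsum_le_weaken (HA s sT hal') => // k; exact: nc_trunc.
- move=> s sT; have [bz b1 b2 _ _] := HB s sT; have [lz l1 l2 _ _] := exact_L2 sT.
  have hz := sob1 (sob_weaken hmu bz); have h1 := sob1 (sob_weaken hmu b1).
  have h2 := sob1 (sob_weaken hmu b2).
  have tz := sob_tail N0 mu0 bz; have t1 := sob_tail N0 mu0 b1; have t2 := sob_tail N0 mu0 b2.
  have p1 := res N _ _ _ _ lz l1 hz h1 tz t1; have p2 := res N _ _ _ _ lz l2 hz h2 tz t2.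
  have q1 := res N _ _ _ _ l1 l1 h1 h1 t1 t1; have q2 := res N _ _ _ _ l2 l2 h2 h2 t2 t2.
  have BE : 0 <= r * B ^+ 2 * eps N ^+ 2 by apply: ltW; exact: mulr_gt0.
  have eE : r * B * (eps N ^+ 2 * B) = r * B ^+ 2 * eps N ^+ 2 by ring.
  rewrite eE in p1 p2 q1 q2.
  have eps2E : eps2 = 4 * (r * B ^+ 2 * eps N ^+ 2) by rewrite /eps2; ring.
  split.
  + have h := ler_wpM2l (ler0n R 2) (lerD q1 q2).
    apply: (le_trans _ (le_trans h _)); last by rewrite eps2E; apply: eq_lew; ring.
    rewrite -big_split mulr_sumr; apply: ler_sum => k _; rewrite /W /= mulrDr.
    set X := cconv _ _ _ _; set Y := cconv _ _ _ _; set P := fourier _ k; set Q := fourier _ k.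
    have -> : X + Y - (P + Q) = (X - P) + (Y - Q) by ring.
    exact: nc_sqrD.
  + by apply: le_trans p1 _; rewrite eps2E ler_peMl ?ler1n.
  + by apply: le_trans p2 _; rewrite eps2E ler_peMl ?ler1n.
- by move=> s k sT hk; rewrite /W !trunc_in //; exact: exact_system.
Qed.

Lemma trunc_id N (f : int * int -> R[i]) : (forall k, k \notin box N -> f k = 0) -> trunc N f = f.
Proof. by move=> h; apply/funext => k; rewrite /trunc; case: ifPn => // /h. Qed.


Lemma galerkin_bounded N zN v1N v2N zNt v1Nt v2Nt :
  galerkin_solution N T a b c d gamma delta z0 v10 v20 zN v1N v2N zNt v1Nt v2Nt ->
  exists2 M, 0 <= M & forall t, 0 <= t <= T -> \sum_(k <- box N) wt R k *
    (nc (fourier (zN t) k) ^+ 2 + nc (fourier (v1N t) k) ^+ 2 + nc (fourier (v2N t) k) ^+ 2) <= M.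
Proof.
move=> gal.
pose f t := \sum_(k <- box N) wt R k * (nc (fourier (zN t) k) ^+ 2 +
  nc (fourier (v1N t) k) ^+ 2 + nc (fourier (v2N t) k) ^+ 2).
pose f' t := \sum_(k <- box N) wt R k * (dnorm2 (fourier (zN t) k) (fourier (zNt t) k) +
  dnorm2 (fourier (v1N t) k) (fourier (v1Nt t) k) + dnorm2 (fourier (v2N t) k) (fourier (v2Nt t) k)).
have [t tT|M HM] := @has_deriv_bounded R T hT f f'.
  apply: (@has_deriv_sum R T _ _ (fun k s => wt R k * (nc (fourier (zN s) k) ^+ 2 +
    nc (fourier (v1N s) k) ^+ 2 + nc (fourier (v2N s) k) ^+ 2)) (fun k t => wt R k *
    (dnorm2 (fourier (zN t) k) (fourier (zNt t) k) + dnorm2 (fourier (v1N t) k) (fourier (v1Nt t) k) +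
     dnorm2 (fourier (v2N t) k) (fourier (v2Nt t) k)))) => k.
  have [h1 h2 h3] := galerkin_cderiv gal k tT.
  apply: has_derivZ; apply: has_derivD; last exact: has_cderiv_nc_sqr h3.
  by apply: has_derivD; [exact: has_cderiv_nc_sqr h1|exact: has_cderiv_nc_sqr h2].
have T00 : 0 <= (0 : R) <= T by rewrite lexx (ltW hT).
exists M; first exact: le_trans (HM 0 T00).
by move=> t tT; apply: le_trans (HM t tT); exact: ler_norm.
Qed.

Lemma sumD3 (I : Type) (s : seq I) (f g h : I -> R) :
  \sum_(k <- s) (f k + g k + h k) = \sum_(k <- s) f k + \sum_(k <- s) g k + \sum_(k <- s) h k.
Proof. by rewrite !big_split. Qed.

Lemma sum_square_triangle (I : Type) (s : seq I) (x y w : I -> R[i]) :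
  \sum_(k <- s) nc (x k - w k) ^+ 2 <= 3 * (\sum_(k <- s) nc (x k - y k) ^+ 2 +
    \sum_(k <- s) nc (y k) ^+ 2 + \sum_(k <- s) nc (w k) ^+ 2).
Proof.
rewrite -!big_split mulr_sumr; apply: ler_sum => k _ /=.
have h : nc (x k - w k) <= nc (x k - y k) + nc (y k) + nc (w k).
  apply: le_trans (ncB _ _) _; rewrite lerD2r.
  by have := ncD (x k - y k) (y k); rewrite subrK.
have h0 := nc_ge0 (x k - w k).
have : nc (x k - w k) ^+ 2 <= (nc (x k - y k) + nc (y k) + nc (w k)) ^+ 2.
  by apply: lerXn2r => //; rewrite nnegrE // (le_trans h0 h).
move: (nc _) (nc _) (nc _) (nc _) {h h0} => A B C D h; apply: le_trans h _.
by have := sqr_ge0 (B - C); have := sqr_ge0 (B - A); have := sqr_ge0 (C - A); nra.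
Qed.

Lemma combine_errors (x1 x2 x3 a1 a2 a3 b1 b2 b3 c1 c2 c3 D M B : R) :
  x1 <= 3 * (a1 + b1 + c1) -> x2 <= 3 * (a2 + b2 + c2) -> x3 <= 3 * (a3 + b3 + c3) ->
  a1 + a2 + a3 <= D -> b1 + b2 + b3 <= M -> c1 <= B -> c2 <= B -> c3 <= B ->
  x1 + x2 + x3 <= 3 * (D + M + 3 * B).
Proof. lra. Qed.

(** Continuity bounds each Galerkin solution in time, but with a constant of its own. Taking one
    fixed solution as the reference curve, whose residual is zero, makes the bound common to all. If
    there is no solution the claim is void. *)
Lemma box_error_small N : (0 < N)%N -> exists D, box_error_le N D.
Proof.
move=> N0.
have [[zM [v1M [v2M [zMt [v1Mt [v2Mt galM]]]]]]|noM] := pselect (exists zN v1N v2N zNt v1Nt v2Nt,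
    galerkin_solution N T a b c d gamma delta z0 v10 v20 zN v1N v2N zNt v1Nt v2Nt); last first.
  by exists 0 => zN v1N v2N zNt v1Nt v2Nt gal; case: noM; exists zN, v1N, v2N, zNt, v1Nt, v2Nt.
have [al [be [c0 [q [c01 ab _ hq]]]]] := boussinesq_weight hgamma hdelta hcase.
have [B B1 HB] := exact_bounded.
have [M M0 HM] := galerkin_bounded galM.
(* From x <= 1 + w x^2 for w >= 1, summed over the box. *)
pose A : R := \sum_(k <- box N) 1 + M.
pose g : R := growth T c0 M A.
have g0 : 0 < g by exact: expR_gt0.
have Np : 0 < N%:R :> R by rewrite ltr0n.
(* With residual zero any positive [y0] may be taken; this one turns the smallness condition into an
   equality. *)
pose y0 := (N%:R * g)^-1.
have y00 : 0 < y0 by rewrite invr_gt0 mulr_gt0.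
have sum0 t : 0 <= t <= T -> [/\ \sum_(k <- box N) wt R k * nc (fourier (zM t) k) ^+ 2 <= M,
    \sum_(k <- box N) wt R k * nc (fourier (v1M t) k) ^+ 2 <= M &
    \sum_(k <- box N) wt R k * nc (fourier (v2M t) k) ^+ 2 <= M].
  move=> /HM h; split; apply: le_trans h; apply: ler_sum => k _; apply: ler_wpM2l => //.
  - by rewrite -addrA lerDl addr_ge0 ?sqr_ge0.
  - by rewrite addrAC lerDr addr_ge0 ?sqr_ge0.
  - by rewrite lerDr addr_ge0 ?sqr_ge0.
have tr0 t : 0 <= t <= T -> [/\ trunc N (fourier (zM t)) = fourier (zM t),
    trunc N (fourier (v1M t)) = fourier (v1M t) & trunc N (fourier (v2M t)) = fourier (v2M t)].
  by move=> tT; split; apply: trunc_id => k hk; have [] := galerkin_support galM tT hk.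
have bnd (u : R * R -> R) : \sum_(k <- box N) wt R k * nc (fourier u k) ^+ 2 <= M ->
    wsum_le (fun k => wt R k * nc (trunc N (fourier u) k) ^+ 2) M.
  move=> h; apply: (@wsum_le_support R N) => [k|k hk|].
  - by rewrite mulr_ge0 ?wt_ge0 ?sqr_ge0.
  - by rewrite trunc_out // nc0 expr0n mulr0.
  by apply: le_trans h; rewrite big_seq [leRHS]big_seq; apply: ler_sum => k hk; rewrite trunc_in.
pose W (u : R -> R * R -> R) t := trunc N (fourier (u t)).
exists (3 * (c0 * (y0 * g) + M + 3 * B)) => zN v1N v2N zNt v1Nt v2Nt gal t tT.
have key := @galerkin_stability R T a b c d gamma delta z0 v10 v20 hT al be c0 q M A ab c01 M0 hq
  N zN v1N v2N zNt v1Nt v2Nt gal 0 y0 (W zM) (W v1M) (W v2M) (W zMt) (W v1Mt) (W v2Mt)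
  (fun t k => cconv N (fourier (zM t)) (fourier (v1M t)) k)
  (fun t k => cconv N (fourier (zM t)) (fourier (v2M t)) k)
  (fun t k => cconv N (fourier (v1M t)) (fourier (v1M t)) k + cconv N (fourier (v2M t)) (fourier (v2M t)) k).
have {key} dist : \sum_(k <- box N) (nc (fourier (zN t) k - fourier (zM t) k) ^+ 2 +
    nc (fourier (v1N t) k - fourier (v1M t) k) ^+ 2 + nc (fourier (v2N t) k - fourier (v2M t) k) ^+ 2)
    <= c0 * (y0 * g).
  apply: le_trans (key N0 (lexx _) y00 _ _ _ _ _ _ _ t tT).
  - by have [e1 e2 e3] := tr0 t tT; rewrite /W e1 e2 e3.
  - by apply: eq_lew; rewrite -/g /y0; field; rewrite !gt_eqF.
  - move=> s k sT; have hd k' := galerkin_cderiv galM k' sT.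
    by split; [apply: (@has_cderiv_trunc R T N (fun s => fourier (zM s)) (fun s => fourier (zMt s)))|
      apply: (@has_cderiv_trunc R T N (fun s => fourier (v1M s)) (fun s => fourier (v1Mt s)))|
      apply: (@has_cderiv_trunc R T N (fun s => fourier (v2M s)) (fun s => fourier (v2Mt s)))] => k';
      have [] := hd k'.
  - by move=> k hk; rewrite /W !trunc_in //; exact: (galerkin_init galM hk).
  - by move=> s k hk; rewrite /W !trunc_out.
  - move=> s sT; have [h1 h2 h3] := sum0 s sT.
    split; [exact: bnd|exact: bnd|exact: bnd|move=> _].
    apply: (@wsum_le_support R N) => [k|k hk|]; first exact: nc_ge0.
      by rewrite /W trunc_out // nc0.
    rewrite /W; have [-> _ _] := tr0 s sT.
    apply: (@le_trans _ _ (\sum_(k <- box N) (1 + wt R k * nc (fourier (zM s) k) ^+ 2))).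
      apply: ler_sum => k _; have := wt_ge1 R k; have := sqr_ge0 (nc (fourier (zM s) k)).
      by have := sqr_ge0 (nc (fourier (zM s) k) - 1); nra.
    rewrite (big_split _ _ (fun=> 1)) /A lerD2l; exact: h1.
  - move=> s sT; have [e1 e2 e3] := tr0 s sT.
    by split; apply: eq_lew; apply: big1 => k _; rewrite /W ?e1 ?e2 ?e3 subrr nc0 expr0n.
  - move=> s k sT hk; rewrite /W !trunc_in //; exact: (galerkin_system galM sT hk).
have sob_box (u : R * R -> R) : sob mu u B -> \sum_(k <- box N) nc (fourier u k) ^+ 2 <= B.
  move=> h; apply: le_trans (sob_weaken mu0 h (box_uniq N)); apply: ler_sum => k _.
  by rewrite powRr0 mul1r.
have hM : \sum_(k <- box N) (nc (fourier (zM t) k) ^+ 2 + nc (fourier (v1M t) k) ^+ 2 +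
    nc (fourier (v2M t) k) ^+ 2) <= M.
  apply: le_trans (HM t tT); apply: ler_sum => k _; rewrite ler_peMl ?wt_ge1 //.
  by rewrite !addr_ge0 ?sqr_ge0.
have [/sob_box bz /sob_box b1 /sob_box b2 _ _] := HB t tT.
have h1 := sum_square_triangle (box N) (fourier (zN t)) (fourier (zM t)) (fourier (z t)).
have h2 := sum_square_triangle (box N) (fourier (v1N t)) (fourier (v1M t)) (fourier (v1 t)).
have h3 := sum_square_triangle (box N) (fourier (v2N t)) (fourier (v2M t)) (fourier (v2 t)).
rewrite sumD3 in dist; rewrite sumD3 in hM; rewrite /mode_error sumD3.
exact: (combine_errors h1 h2 h3 dist hM bz b1 b2).
Qed.

Lemma box_error : exists2 D, 0 <= D & forall N, (0 < N)%N -> box_error_le N (D * eps N ^+ 2).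
Proof.
have [n [D [D0 HD]]] := box_error_large.
have box_mono N D1 D2 : D1 <= D2 -> box_error_le N D1 -> box_error_le N D2.
  by move=> le h zN v1N v2N zNt v1Nt v2Nt gal t tT; apply: le_trans (h _ _ _ _ _ _ gal t tT) le.
have [D' D'0 HD'] : exists2 D', 0 <= D' &
    forall N, (0 < N <= n)%N -> box_error_le N (D' * eps N ^+ 2).
  elim: n {HD} => [|n [D' D'0 IH]]; first by exists 0 => // N; case: N.
  have [E HE] := box_error_small (ltn0Sn n).
  have e0 : 0 < eps n.+1 by rewrite powR_gt0.
  (* A constant for a single [N] becomes a multiple of [eps N ^+ 2] by division, and finitely many
     such multiples add up. *)
  exists (D' + `|E| / eps n.+1 ^+ 2); first by rewrite addr_ge0 // divr_ge0 // exprn_ge0 // ltW.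
  move=> N /andP[N0]; rewrite leq_eqVlt => /orP[/eqP ->|].
    apply: box_mono HE; rewrite mulrDl mulfVK ?gt_eqF ?exprn_gt0 //.
    by apply: le_trans (ler_norm _) _; rewrite lerDr mulr_ge0 // exprn_ge0 // ltW.
  rewrite ltnS => Nn; apply: box_mono (IH N _); last by rewrite N0.
  by rewrite ler_wpM2r ?sqr_ge0 // lerDl divr_ge0 // exprn_ge0 // ltW.
exists (D + D'); first exact: addr_ge0.
move=> N N0; have [nN|Nn] := ltnP n N.
  by apply: box_mono (HD N nN); rewrite ler_wpM2r ?sqr_ge0 // lerDl.
by apply: box_mono (HD' N _); rewrite ?N0 // ler_wpM2r ?sqr_ge0 // lerDr.
Qed.

End ErrorOnBox.

(** * From coefficients back to norms *)

Section ErrorNorms.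
Variable R : realType.
Opaque fourier.
Implicit Types (k : int * int) (u : R * R -> R).

Lemma wsum_le_box_tail N (F : int * int -> R) X Y : (forall k, 0 <= F k) ->
  \sum_(k <- box N) F k <= X ->
  (forall t, uniq t -> (forall m, m \in t -> m \notin box N) -> \sum_(k <- t) F k <= Y) ->
  wsum_le F (X + Y).
Proof.
move=> F0 hX hY s us; rewrite (bigID (fun k => k \in box N)) /=; apply: lerD.
  apply: le_trans hX; rewrite -big_filter; apply: sum_subset_le => //; first exact: filter_uniq.
  by move=> k; rewrite mem_filter => /andP[].
rewrite -big_filter; apply: hY; first exact: filter_uniq.
by move=> m; rewrite mem_filter => /andP[].
Qed.

(** Inside the box [wt k] is at most 1 + 2 N^2 <= 3 N^2, and 3 to the power [s] is at most 3. *)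
Lemma wt_box N k (s : R) : (0 < N)%N -> 0 <= s <= 1 -> k \in box N ->
  wt R k `^ s <= 3 * (N%:R `^ s) ^+ 2.
Proof.
move=> N0 /andP[s0 s1] hk.
have N1 : 1 <= N%:R :> R by rewrite ler1n.
have NN : wt R k <= 3 * (N%:R * N%:R).
  have sq (i : int) : (`|i| <= N)%N -> i%:~R ^+ 2 <= N%:R * N%:R :> R.
    move=> h; rewrite -(real_normK (num_real _)) -expr2; apply: lerXn2r; rewrite ?nnegrE //.
    by rewrite -intr_norm -abszE -pmulrn ler_nat.
  move: hk; rewrite mem_box => /andP[/sq h1 /sq h2]; rewrite /wt.
  have : 1 <= N%:R * N%:R :> R by nra.
  lra.
apply: (@le_trans _ _ ((3 * (N%:R * N%:R)) `^ s)).
  by apply: ge0_ler_powR => //; rewrite nnegrE ?wt_ge0 // !mulr_ge0.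
rewrite powRM ?mulr_ge0 // powRM // -expr2 ler_wpM2r ?sqr_ge0 //.
by rewrite -[leRHS]powRr1 // ler_powR // ler1n.
Qed.

(** Covers both final estimates, [s = 0] and [s = 1]: [3 * D] comes from [wt_box] on the box, [B]
    from the tail of [u], as [uN] has no frequencies outside. *)
Lemma error_sob N (uN u : R * R -> R) (D B mu s : R) : (0 < N)%N -> 0 <= s <= 1 -> 1 <= mu ->
  L2 uN -> L2 u -> (forall k, k \notin box N -> fourier uN k = 0) ->
  \sum_(k <- box N) nc (fourier uN k - fourier u k) ^+ 2 <= D * (N%:R `^ (- mu)) ^+ 2 ->
  sob mu u B -> sob s (fun p => uN p - u p) ((3 * D + B) * (N%:R `^ (s - mu)) ^+ 2).
Proof.
move=> N0 s01 hmu huN hu hs hD hB.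
have N1 : N%:R != 0 :> R by rewrite pnatr_eq0 -lt0n.
have -> : (3 * D + B) * (N%:R `^ (s - mu)) ^+ 2 =
    3 * (N%:R `^ s) ^+ 2 * (D * (N%:R `^ (- mu)) ^+ 2) + (N%:R `^ (s - mu)) ^+ 2 * B.
  by rewrite powRD ?N1 ?implybT //; ring.
apply: (@wsum_le_box_tail N) => [k||t ut ht]; first by rewrite mulr_ge0 ?powR_ge0 ?sqr_ge0.
  apply: le_trans (ler_wpM2l _ hD); last by rewrite mulr_ge0 ?sqr_ge0.
  rewrite mulr_sumr big_seq [leRHS]big_seq; apply: ler_sum => k hk.
  by rewrite fourierB // ler_wpM2r ?sqr_ge0 // wt_box.
apply: le_trans (ler_wpM2l (sqr_ge0 _) (hB t ut)).
rewrite mulr_sumr big_seq [leRHS]big_seq; apply: ler_sum => k /ht hk.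
rewrite fourierB // hs // sub0r ncN [leRHS]mulrA ler_wpM2r ?sqr_ge0 //.
by apply: wt_tail => //; move: s01 => /andP[_ h]; apply: le_trans hmu.
Qed.

Lemma sob0_l2norm u B : L2 u -> sob 0 u B -> (l2norm u <= (Num.sqrt B)%:E)%E.
Proof.
move=> hu hB; rewrite L2_l2norm // lee_fin ler_wsqrtr //; apply: parseval_le => //.
by apply: wsum_le_weaken hB => // k; rewrite powRr0 mul1r.
Qed.

Lemma l2norm_ge0 u : L2 u -> (0 <= l2norm u)%E.
Proof. by move=> hu; rewrite L2_l2norm // lee_fin sqrtr_ge0. Qed.

Lemma vnorm_le (nrm : (R * R -> R) -> \bar R) (u v : R * R -> R) (x : R) :
  (0 <= nrm u)%E -> (0 <= nrm v)%E -> (nrm u <= x%:E)%E -> (nrm v <= x%:E)%E ->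
  (vnorm nrm u v <= (2 * x)%:E)%E.
Proof.
rewrite /vnorm; case: (nrm u) => [r| |] //; case: (nrm v) => [r'| |] //.
rewrite !lee_fin => r0 r'0 rx r'x.
have x0 : 0 <= x by apply: le_trans rx.
rewrite -!expr2.
rewrite -[leRHS]ger0_norm ?mulr_ge0 // -sqrtr_sqr ler_wsqrtr //.
have h1 : r ^+ 2 <= x ^+ 2 by apply: lerXn2r.
have h2 : r' ^+ 2 <= x ^+ 2 by apply: lerXn2r.
by have := sqr_ge0 x; rewrite exprMn; lra.
Qed.

End ErrorNorms.

(** * The L^2 and H^1 error estimates *)

Unset Implicit Arguments.

Theorem proposition3p2 (R : realType) (T mu a b c d gamma delta : R)
    (z0 v10 v20 : R * R -> R) (z v1 v2 zt v1t v2t : R -> R * R -> R)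
    (hT : 0 < T) (hmu : 1 <= mu)
    (hgamma : 0 <= gamma < 1) (hdelta : 0 < delta)
    (hcase : admissible_case a b c d)
    (hz0 : Hs mu z0) (hv10 : Hs mu v10) (hv20 : Hs mu v20)
    (hsol : exact_solution T mu a b c d gamma delta
              z0 v10 v20 z v1 v2 zt v1t v2t) :
  exists C : R, forall (N : nat) (zN v1N v2N zNt v1Nt v2Nt : R -> R * R -> R),
    (1 <= N)%N ->
    galerkin_solution N T a b c d gamma delta
      z0 v10 v20 zN v1N v2N zNt v1Nt v2Nt ->
    forall t, 0 <= t <= T ->
      let ez := fun p => zN t p - z t p in
      let ev1 := fun p => v1N t p - v1 t p in
      let ev2 := fun p => v2N t p - v2 t p in
      (l2norm ez + vnorm (@l2norm R) ev1 ev2 <= (C * N%:R `^ (- mu))%:E)%E /\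
      (hnorm 1 ez + vnorm (hnorm 1) ev1 ev2 <= (C * N%:R `^ (1 - mu))%:E)%E.
Proof.
have [D D0 HD] := box_error hT hmu hgamma hdelta hcase hz0 hv10 hv20 hsol.
have [B B1 HB] := exact_bounded hT hsol.
(* 3 = 1 + 2: one share for the scalar error, two for the vector norm by [vnorm_le]. *)
exists (3 * Num.sqrt (3 * D + B)) => N zN v1N v2N zNt v1Nt v2Nt N1 gal t tT ez ev1 ev2.
have [S1 S2 S3 _ _] := galerkin_SN gal tT.
have [lz l1 l2 _ _] := exact_L2 hsol tT; have [bz b1 b2 _ _] := HB t tT.
have := HD N N1 _ _ _ _ _ _ gal t tT; rewrite /mode_error sumD3 => hsum.
have L2N (u : R * R -> R) : SN_real N u -> L2 u by exact: SN_real_L2.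
have part (uN u : R * R -> R) : SN_real N uN -> L2 u -> sob mu u B ->
    \sum_(k <- box N) nc (fourier uN k - fourier u k) ^+ 2 <= D * (N%:R `^ (- mu)) ^+ 2 ->
    [/\ L2 (fun p => uN p - u p),
      (l2norm (fun p => (uN p - u p)%R) <= (Num.sqrt (3 * D + B) * N%:R `^ (- mu))%:E)%E &
      (hnorm 1 (fun p => (uN p - u p)%R) <= (Num.sqrt (3 * D + B) * N%:R `^ (1 - mu))%:E)%E].
  move=> SN lu bu hu.
  have DB : 0 <= 3 * D + B by apply: addr_ge0; [exact: mulr_ge0|exact: le_trans B1].
  have err s : 0 <= s <= 1 -> sob s (fun p => uN p - u p) ((3 * D + B) * (N%:R `^ (s - mu)) ^+ 2).
    by move=> s01; exact: (error_sob N1 s01 hmu (L2N _ SN) lu (proj2 (SN_realE SN)) hu bu).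
  have sq s : Num.sqrt ((3 * D + B) * (N%:R `^ (s - mu)) ^+ 2) =
      Num.sqrt (3 * D + B) * N%:R `^ (s - mu).
    by rewrite sqrtrM // sqrtr_sqr ger0_norm // powR_ge0.
  have Ld := L2_B (L2N _ SN) lu; split => //.
    rewrite -(sub0r mu) -sq; apply: sob0_l2norm => //; apply: err.
    by rewrite lexx ler01.
  by rewrite -sq; apply: sob_hnorm; apply: err; rewrite lexx ler01.
have sum0 (u v : R * R -> R) : 0 <= \sum_(k <- box N) nc (fourier u k - fourier v k) ^+ 2.
  by apply: sumr_ge0 => k _; exact: sqr_ge0.
have p1 := sum0 (zN t) (z t); have p2 := sum0 (v1N t) (v1 t); have p3 := sum0 (v2N t) (v2 t).
have [lez hez0 hez1] := part _ _ S1 lz bz (le_trans (ler_wpDr p3 (ler_wpDr p2 (lexx _))) hsum).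
have [le1 h10 h11] := part _ _ S2 l1 b1 (le_trans (ler_wpDr p3 (ler_wpDl p1 (lexx _))) hsum).
have [le2 h20 h21] := part _ _ S3 l2 b2 (le_trans (ler_wpDl (addr_ge0 p1 p2) (lexx _)) hsum).
have three (x : R) : (3 * Num.sqrt (3 * D + B) * x)%:E =
    ((Num.sqrt (3 * D + B) * x)%:E + (2 * (Num.sqrt (3 * D + B) * x))%:E)%E.
  by rewrite -EFinD; congr EFin; ring.
have hn0 (u : R * R -> R) : (0 <= hnorm 1 u)%E by exact: sqrte_ge0.
split; rewrite three.
  exact: (leeD hez0 (vnorm_le (l2norm_ge0 le1) (l2norm_ge0 le2) h10 h20)).
exact: (leeD hez1 (vnorm_le (hn0 _) (hn0 _) h11 h21)).
Qed.
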